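(* Let $D_1, D_2 \subset \mathbb{R}^2$ be compact domains and let $f : D_1 \to D_2$ be an orientation reversing diffeomorphism. Then $f$ is locally, in a neighborhood of any point of $D_1$, a composition of two gradient diffeomorphisms. That is, for every $x \in D_1$ there exist a neighborhood $U$ of $x$ in $D_1$ and smooth functions $\varphi : U \to \mathbb{R}$ and $\psi : V \to \mathbb{R}$, where $V = \nabla\varphi(U)$, such that $\nabla\varphi : U \to V$ and $\nabla\psi : V \to f(U)$ are diffeomorphisms and $f|_U = \nabla\psi \circ \nabla\varphi$.
   Context: A compact domain is the closure of a bounded domain. Smoothness of functions and maps on a set that is not open means that they extend smoothly to an open neighborhood of that set. Orientation reversing means that the Jacobian determinant of $f$ is negative. *)

(* Defs.v *)
From mathcomp Require Import all_boot all_order all_algebra.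
From mathcomp Require Import all_classical all_reals all_analysis.

Set Implicit Arguments.
Unset Strict Implicit.
Unset Printing Implicit Defensive.
Import Order.TTheory GRing.Theory Num.Theory.
Import numFieldNormedType.Exports.

Local Open Scope classical_set_scope.
Local Open Scope ring_scope.

Section Smoothness.
Context {R : realType} {V W : normedModType R}.
Implicit Types (S O : set V) (f g : V -> W).

(* C^n on an open set O. A map is C^(n+1) iff it is Frechet differentiable on O
   and all its directional derivatives are C^n; values outside O are ignored
   because O is open. *)
Fixpoint is_Ck (n : nat) (O : set V) (f : V -> W) : Prop :=
  if n is m.+1 then
    (forall x, O x -> differentiable f x) /\ (forall v, is_Ck m O ('D_v f))
  else forall x, O x -> {for x, continuous f}.

Definition smooth_open O f := forall n, is_Ck n O f.

Definition smooth_extension S f g :=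
  exists O, [/\ open O, S `<=` O, smooth_open O g & {in S, g =1 f}].

(* Maps on S are represented by total functions whose values outside S are
   irrelevant. *)
Definition smooth_on S f := exists g, smooth_extension S f g.

(* A chosen smooth extension (f itself if there is none). On S, its derivatives
   do not depend on the choice as soon as S is contained in the closure of its
   interior: see derive_extend below. *)
Definition extend S f : V -> W := xget f (smooth_extension S f).

End Smoothness.

Section Diffeomorphisms.
Context {R : realType} {n : nat}.
Local Notation E := 'rV[R]_n.+1.
Implicit Types (S T D U : set E).

Definition diffeomorphism S T (f : E -> E) :=
  [/\ smooth_on S f, f @` S = T &
      exists g : E -> E,
        [/\ smooth_on T g, {in S, cancel f g} & {in T, cancel g f}]].

Definition compact_domain D :=
  exists O, [/\ open O, O !=set0, connected O, bounded_set O & D = closure O].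

Definition open_nbhd_in D (x : E) U :=
  exists O, [/\ open O, O x & U = D `&` O].

Definition orientation_reversing D (f : E -> E) :=
  forall x, D x -> \det ('J (extend D f) x) < 0.

Definition gradient (phi : E -> R) (x : E) : E :=
  \row_i 'D_(delta_mx 0 i) phi x.

(* gradient of a smooth function on a set that need not be open *)
Definition gradient_on S (phi : E -> R) : E -> E := gradient (extend S phi).

End Diffeomorphisms.

Section WellDefined.
Context {R : realType} {V W : normedModType R}.

Lemma extendP (S : set V) (f : V -> W) :
  smooth_on S f -> smooth_extension S f (extend S f).
Proof. by case=> g gP; apply: (xgetI f gP). Qed.

Lemma derive_extend (S : set V) (f g : V -> W) (x v : V) :
  S `<=` closure (interior S) -> smooth_extension S f g -> S x ->
  'D_v (extend S f) x = 'D_v g x.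
Proof.
move=> SS gP Sx; have [A [oA SA sg gf]] := gP.
have [B [oB SB sh hf]] : smooth_extension S f (extend S f).
  by apply: extendP; exists g.
set h := extend S f in sh hf *.
have ch : {for x, continuous ('D_v h)} by apply: (sh 1%N).2; exact: SB.
have cg : {for x, continuous ('D_v g)} by apply: (sg 1%N).2; exact: SA.
apply/eqP; rewrite -subr_eq0 -normr_le0; apply/ler_addgt0Pr => e e0; rewrite add0r.
have e2 : 0 < e / 2 by rewrite divr_gt0.
move/cvgrPdist_lt: ch => /(_ _ e2) nh.
move/cvgrPdist_lt: cg => /(_ _ e2) ng.
have xS := SS _ Sx.
have [y [Sy [hy gy]]] := xS _ (filterI nh ng).
have dE : 'D_v h y = 'D_v g y.
  apply: near_eq_derive; near=> z.
  have /set_mem Sz : z \in S by rewrite inE; near: z; exact: Sy.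
  by rewrite hf ?gf ?inE.
rewrite (splitr e) -(subrKA ('D_v h y)) {2}dE.
by rewrite (le_trans (ler_normD _ _))// lerD// ltW// distrC.
Unshelve. all: by end_near. Qed.

Lemma compact_domain_regular (n : nat) (D U : set 'rV[R]_n.+1) x :
  compact_domain D -> open_nbhd_in D x U -> U `<=` closure (interior U).
Proof.
move=> [Q [oQ _ _ _ ->]] [A [oA _ ->]] y [cy Ay] B By.
have [z [Qz [Az Bz]]] := cy _ (filterI (open_nbhs_nbhs (conj oA Ay)) By).
exists z; split=> //; apply: (@filterS _ _ _ (Q `&` A)).
  by move=> t [Qt At]; split=> //; exact: subset_closure.
by apply: open_nbhs_nbhs; split; [exact: openI|].
Qed.

End WellDefined.

(* Main.v *)
(** Where det Df < 0 the differential has two distinct real eigenvalues, hence a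
smooth frame of eigenvectors p, q near the point.  If f is the composition of
two gradients, write X for the point and v for its image under the first one, in
coordinates (s, t) such that X_s is parallel to p, X_t to q, v_s orthogonal to q
and v_t orthogonal to p.  Then v.dX and f(X).dv are closed 1-forms, and their
potentials phi, psi, transported by X^-1 and v^-1, have gradients v o X^-1 and
f o X o v^-1.  Conversely, X_s = al p(X), X_t = be q(X) and the closedness
conditions making v exist form a semilinear hyperbolic system for X and the
scalars al, be, mu, nu, in which every unknown is differentiated along one of the
two coordinate directions; it is solved by Picard iteration in the plane, and
its solutions are smooth because differentiating it yields a system of the same
shape. *)

Require Import Defs.
From HB Require Import structures.
From mathcomp Require Import all_boot all_order all_algebra.
From mathcomp Require Import all_classical all_reals all_analysis.
From mathcomp Require Import ring lra.
Import Order.TTheory GRing.Theory Num.Theory.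
Import numFieldNormedType.Exports.
Local Open Scope classical_set_scope.
Local Open Scope ring_scope.

Set Implicit Arguments.
Unset Strict Implicit.
Unset Printing Implicit Defensive.

(** * Calculus with [is_Ck] *)

Section FrechetEps.
Context {R : realType} {V W : normedModType R}.

(** The eigenvector property is what lets one map v serve both forms. Closedness of v.dX reads
    v_t.X_s = v_s.X_t, that of f(X).dv reads f(X)_t.v_s = f(X)_s.v_t. Since f(X)_s is again parallel
    to p and f(X)_t to q, all four products vanish by orthogonality. What remains is that X and v
    exist with the prescribed directions: (al p)_t = (be q)_s and, after a rotation by a right
    angle, (nu q)_t = (mu p)_s, with p and q taken at X. Expanding both in the frame p, q separates
    them into equations for al_t, be_s, mu_s and nu_t. The obstacle is X itself, which is prescribed
    in both directions: one of its two equations has to be recovered afterwards by a uniqueness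
    argument. The value 1 of all four scalars at the origin makes X and v charts there. A boundary
    point of the domain is handled by factoring a smooth extension of f and intersecting with the
    domain only at the end; gradients on a set contained in the closure of its interior do not
    depend on the extension. *)

Lemma differentiable_epsP (f : V -> W) (x : V) (L : {linear V -> W}) :
  continuous L ->
  (forall e, 0 < e -> \forall h \near (0 : V), `|f (h + x) - f x - L h| <= e * `|h|) ->
  differentiable f x /\ 'd f x = L :> (V -> W).
Proof.
move=> cL Lf.
have fE : f \o shift x = cst (f x) + L +o_ (0 : V) id.
  apply/eqaddoP => e e0; have := Lf e e0; apply: filterS => h.
  by rewrite /= opprD addrA.
have dE : 'd f x = L :> (V -> W) by apply: diff_unique.
by split=> //; apply/diff_locallyP; rewrite dE; split.
Qed.

Lemma differentiable_eps (f : V -> W) (x : V) : differentiable f x ->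
  forall e, 0 < e ->
  \forall h \near (0 : V), `|f (h + x) - f x - 'd f x h| <= e * `|h|.
Proof.
move=> /diff_locally/eqaddoP + e e0 => /(_ e e0).
by apply: filterS => h; rewrite /= opprD addrA.
Qed.

Lemma near_eq_differentiable (f g : V -> W) (x : V) :
  {near x, f =1 g} -> differentiable f x -> differentiable g x.
Proof.
move=> fg df.
have cL : continuous ('d f x) by apply: diff_continuous.
apply: (proj1 (differentiable_epsP cL _)) => e e0.
have := differentiable_eps df e0.
have : \forall h \near (0:V), f (h + x) = g (h + x).
  by move: fg; rewrite (near_shift 0) /=; apply: filterS => h /=; rewrite subr0.
apply: filterS2 => h <-; rewrite -(nbhs_singleton fg) //.
Qed.

End FrechetEps.

Lemma cvg_sum_ord {R : realType} (T : Type) (F : set_system T) (FF : Filter F) n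
    (f : 'I_n -> T -> R) (l : 'I_n -> R) :
  (forall i, f i @ F --> l i) -> (fun x => \sum_i f i x) @ F --> \sum_i l i.
Proof.
elim: n f l => [|n IH] f l fl.
  by rewrite big_ord0; under eq_fun do rewrite big_ord0; exact: cvg_cst.
rewrite big_ord_recl; under eq_fun do rewrite big_ord_recl.
by apply: cvgD; [exact: fl|apply: IH => i; exact: fl].
Qed.

Section SmoothCalculus.
Context {R : realType} {V : normedModType R}.
Implicit Types (O : set V).

(** Openness of [O] turns equality on [O] into equality near each point. This is how a derivative is
    replaced by an explicit formula to which an induction hypothesis applies in the stability lemmas
    below. *)
Lemma is_Ck_eq (W : normedModType R) k O (f g : V -> W) : open O ->
  (forall x, O x -> f x = g x) -> is_Ck k O f -> is_Ck k O g.
Proof.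
move=> oO; elim: k f g => [|k IH] f g fg /=.
  move=> cf x Ox; rewrite /prop_for /continuous_at -(fg x Ox).
  apply: cvg_trans (cf x Ox); apply: near_eq_cvg.
  by apply: filterS (open_nbhs_nbhs (conj oO Ox)) => y /fg ->.
have nfg x : O x -> {near x, f =1 g}.
  by move=> Ox; apply: filterS (open_nbhs_nbhs (conj oO Ox)) => y /fg ->.
move=> [df Df]; split=> [x Ox|v].
  by apply: near_eq_differentiable (df x Ox); exact: nfg.
apply: IH (Df v) => x Ox; apply: near_eq_derive; exact: nfg.
Qed.

Lemma is_CkW (W : normedModType R) k O (f : V -> W) :
  is_Ck k.+1 O f -> is_Ck k O f.
Proof.
elim: k f => [|k IH] f [df Df] /=.
  by move=> x Ox; apply: differentiable_continuous; exact: df.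
by split=> // v; apply: IH; exact: Df.
Qed.

Lemma is_Ck_continuous (W : normedModType R) k O (f : V -> W) :
  is_Ck k O f -> forall x, O x -> {for x, continuous f}.
Proof. by elim: k => [//|k IH] /is_CkW; exact: IH. Qed.

Lemma is_Ck_sub (W : normedModType R) k O O' (f : V -> W) :
  O' `<=` O -> is_Ck k O f -> is_Ck k O' f.
Proof.
move=> OO; elim: k f => [|k IH] f /=; first by move=> cf x /OO; exact: cf.
by move=> [df Df]; split=> [x /OO|v]; [exact: df|exact/IH/Df].
Qed.

Lemma is_Ck_cst (W : normedModType R) k O (c : W) : is_Ck k O (fun _ : V => c).
Proof.
elim: k c => [|k IH] c /=; first by move=> x _; exact: cvg_cst.
split=> [x _|v]; first exact: differentiable_cst.
by rewrite (_ : 'D_v _ = fun=> 0)//; apply/funext => x; exact: derive_cst.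
Qed.

Lemma is_Ck_lin (W : normedModType R) k O (f : {linear V -> W}) :
  continuous f -> is_Ck k O f.
Proof.
move=> cf; case: k => [|k] /=; first by move=> x _; exact: cf.
split=> [x _|v]; first exact: linear_differentiable.
rewrite (_ : 'D_v _ = fun=> f v); first exact: is_Ck_cst.
by apply/funext => x; rewrite deriveE ?diff_lin//; exact: linear_differentiable.
Qed.

Lemma is_CkD (W : normedModType R) k O (f g : V -> W) : open O ->
  is_Ck k O f -> is_Ck k O g -> is_Ck k O (fun x => f x + g x).
Proof.
move=> oO; elim: k f g => [|k IH] f g /=.
  by move=> cf cg x Ox; apply: cvgD; [exact: cf|exact: cg].
move=> [df Df] [dg Dg]; split=> [x Ox|v].
  by apply: differentiableD; [exact: df|exact: dg].
apply: is_Ck_eq (IH _ _ (Df v) (Dg v)) => // x Ox.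
by rewrite -deriveD//; apply: diff_derivable; [exact: df|exact: dg].
Qed.

Lemma is_CkM k O (f g : V -> R) : open O ->
  is_Ck k O f -> is_Ck k O g -> is_Ck k O (fun x => f x * g x).
Proof.
move=> oO; elim: k f g => [|k IH] f g.
  by move=> cf cg x Ox; apply: cvgM; [exact: cf|exact: cg].
move=> Cf Cg; have [df Df] := Cf; have [dg Dg] := Cg; split=> [x Ox|v].
  by apply: differentiableM; [exact: df|exact: dg].
apply: (is_Ck_eq (f := fun x => f x * 'D_v g x + g x * 'D_v f x)) => //.
  move=> x Ox; transitivity ('D_v (f * g) x) => //.
  have dfx : derivable f x v by exact/diff_derivable/df.
  have dgx : derivable g x v by exact/diff_derivable/dg.
  by rewrite deriveM.
by apply: is_CkD => //; apply: IH; do ?[exact: is_CkW|exact: Df|exact: Dg].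
Qed.

Lemma is_Ck_sum (W : normedModType R) k O n (f : 'I_n -> V -> W) : open O ->
  (forall i, is_Ck k O (f i)) -> is_Ck k O (fun x => \sum_i f i x).
Proof.
move=> oO; elim: n f => [|n IH] f Cf.
  by apply: (is_Ck_eq (f := fun=> 0)) => //; [by move=> x _; rewrite big_ord0|exact: is_Ck_cst].
apply: (is_Ck_eq (f := fun x => f ord0 x + \sum_i f (lift ord0 i) x)) => //.
  by move=> x _; rewrite big_ord_recl.
by apply: is_CkD => //; exact: IH.
Qed.

Lemma is_CkN k O (f : V -> R) : open O ->
  is_Ck k O f -> is_Ck k O (fun x => - f x).
Proof.
move=> oO Cf; apply: (is_Ck_eq (f := fun x => (-1) * f x)) => //.
  by move=> x _; rewrite mulN1r.
by apply: is_CkM => //; exact: is_Ck_cst.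
Qed.

Lemma is_CkB k O (f g : V -> R) : open O ->
  is_Ck k O f -> is_Ck k O g -> is_Ck k O (fun x => f x - g x).
Proof. by move=> oO Cf Cg; apply: is_CkD => //; exact: is_CkN. Qed.

(** The derivative of the inverse contains the inverse only at the order already reached, so the
    induction closes; the square root is treated in the same way. *)
Lemma is_CkV k O (f : V -> R) : open O -> (forall x, O x -> f x != 0) ->
  is_Ck k O f -> is_Ck k O (fun x => (f x)^-1).
Proof.
move=> oO f0; elim: k => [|k IH] Cf.
  by move=> x Ox; apply: cvgV; [exact: f0|exact: Cf].
have [df Df] := Cf; split=> [x Ox|v].
  by apply: differentiableV; [exact: df|exact: f0].
apply: (is_Ck_eq (f := fun x => - ((f x)^-1 * (f x)^-1 * 'D_v f x))) => //.
  move=> x Ox; rewrite deriveV ?f0//; last exact/diff_derivable/df.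
  by rewrite scaleNr expr2 invfM.
apply: is_CkN => //; apply: is_CkM => //; last exact: Df.
by apply: is_CkM => //; exact/IH/is_CkW.
Qed.

Lemma is_Ck_sqrt k O (f : V -> R) : open O -> (forall x, O x -> 0 < f x) ->
  is_Ck k O f -> is_Ck k O (fun x => Num.sqrt (f x)).
Proof.
move=> oO f0; elim: k => [|k IH] Cf.
  move=> x Ox; apply: (@continuous_comp _ _ _ f Num.sqrt); first exact: Cf.
  exact: sqrt_continuous.
have [df Df] := Cf.
have ds x : O x -> differentiable (Num.sqrt : R -> R) (f x).
  by move=> /f0 fx0; apply/derivable1_diffP; have [] := is_derive1_sqrt fx0.
split=> [x Ox|v].
  by apply: (@differentiable_comp _ _ _ _ f Num.sqrt); [exact: df|exact: ds].
apply: (is_Ck_eq (f := fun x => 'D_v f x * (2 * Num.sqrt (f x))^-1)) => //.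
  move=> x Ox; rewrite [RHS]deriveE; last first.
    by apply: (@differentiable_comp _ _ _ _ f Num.sqrt); [exact: df|exact: ds].
  rewrite (@diff_comp _ _ _ _ f Num.sqrt) /=; [|exact: df|exact: ds].
  have -> : 'd f x v = 'D_v f x by rewrite deriveE//; exact: df.
  have [_ <-] := is_derive1_sqrt (f0 x Ox).
  rewrite [in LHS](deriveE _ (ds x Ox)).
  by rewrite -[in RHS](mulr1 ('D_v f x)) [RHS]linearZ.
apply: is_CkM => //; first exact: Df.
apply: is_CkV => //.
  by move=> x Ox; rewrite mulf_neq0// gt_eqF// sqrtr_gt0 f0.
by apply: is_CkM => //; [exact: is_Ck_cst|exact/IH/is_CkW].
Qed.

Lemma differentiable_rVP N (f : V -> 'rV[R]_N) x :
  differentiable f x <-> forall i, differentiable (fun z => f z ord0 i) x.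
Proof.
split=> [df i|df].
  apply: (@differentiable_comp _ _ _ _ f (fun M : 'rV[R]_N => M ord0 i)) => //.
  exact: differentiable_coord.
rewrite (_ : f = \sum_i fun z => f z ord0 i *: 'e_i).
  by apply: differentiable_sum => i; exact: differentiableZl.
by apply/funext => z; rewrite fct_sumE -row_sum_delta.
Qed.

Lemma derive_rV N (f : V -> 'rV[R]_N) x v i : differentiable f x ->
  ('D_v f x) ord0 i = 'D_v (fun z => f z ord0 i) x.
Proof. by move=> df; rewrite derive_mx ?mxE//; exact: diff_derivable. Qed.

Lemma cvg_rVP N (T : Type) (F : set_system T) (FF : Filter F) (f : T -> 'rV[R]_N) (l : 'rV[R]_N) :
  f @ F --> l <-> forall i, (fun z => f z ord0 i) @ F --> l ord0 i.
Proof.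
split=> [cf i|cf].
  apply: (cvg_comp f (fun M : 'rV[R]_N => M ord0 i) cf); exact: coord_continuous.
apply/cvgrPdist_le => e e0; near=> z.
rewrite [leLHS]/Num.Def.normr/= mx_normrE; apply: bigmax_le; first exact: ltW.
move=> -[a i] _; rewrite (ord1 a) !mxE.
move: i {a}; near: z; apply: filter_forall => i.
by have /cvgrPdist_le/(_ e e0) := cf i.
Unshelve. all: by end_near. Qed.

Lemma is_Ck_rVP N k O (f : V -> 'rV[R]_N) : open O ->
  is_Ck k O f <-> forall i, is_Ck k O (fun z => f z ord0 i).
Proof.
move=> oO; elim: k f => [|k IH] f.
  split=> [cf i x Ox|cf x Ox].
    by have /cvg_rVP := cf x Ox; exact.
  by apply/cvg_rVP => i; exact: cf.
split=> [[df Df] i|Cf].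
  split=> [x Ox|v]; first by move: i; exact/differentiable_rVP/df.
  have /IH/(_ i) := Df v; apply: is_Ck_eq => // x Ox.
  by rewrite derive_rV//; exact: df.
have df x : O x -> differentiable f x.
  by move=> Ox; apply/differentiable_rVP => i; exact: (Cf i).1.
split=> // v; apply/IH => i; apply: is_Ck_eq ((Cf i).2 v) => // x Ox.
by rewrite derive_rV//; exact: df.
Qed.

Lemma diff_rV_sum (W : normedModType R) N (L : {linear 'rV[R]_N -> W}) v :
  L v = \sum_i v ord0 i *: L 'e_i.
Proof. by rewrite {1}(row_sum_delta v) linear_sum; apply: eq_bigr => i _; rewrite linearZ. Qed.

Lemma derive_comp_rV (W : normedModType R) N (f : V -> 'rV[R]_N) (g : 'rV[R]_N -> W) x v :
  differentiable f x -> differentiable g (f x) ->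
  'D_v (g \o f) x = \sum_i 'D_v (fun z => f z ord0 i) x *: 'D_('e_i) g (f x).
Proof.
move=> df dg; rewrite deriveE; last exact: differentiable_comp.
rewrite diff_comp//= diff_rV_sum; apply: eq_bigr => i _.
by rewrite -(derive_rV v i df) [in RHS]deriveE// [in RHS]deriveE.
Qed.

Lemma derive_rV_sum (W : normedModType R) N (g : 'rV[R]_N -> W) x v :
  differentiable g x -> 'D_v g x = \sum_i v ord0 i *: 'D_('e_i) g x.
Proof.
move=> dg; rewrite deriveE// diff_rV_sum; apply: eq_bigr => i _.
by rewrite deriveE.
Qed.

(** With row vectors in the middle, the chain rule writes the derivative as a finite sum of products
    of scalar functions; the product rule and the induction hypothesis for each ['D_('e_i) g] then
    apply. *)
Lemma is_Ck_comp N k O (P : set 'rV[R]_N) (f : V -> 'rV[R]_N) (g : 'rV[R]_N -> R) :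
  open O -> (forall x, O x -> P (f x)) -> is_Ck k O f -> is_Ck k P g ->
  is_Ck k O (g \o f).
Proof.
move=> oO OP; elim: k g => [|k IH] g Cf Cg.
  by move=> x Ox; apply: continuous_comp; [exact: Cf|exact/Cg/OP].
have [df Df] := Cf; have [dg Dg] := Cg.
split=> [x Ox|v].
  by apply: differentiable_comp; [exact: df|exact/dg/OP].
apply: (is_Ck_eq
  (f := fun x => \sum_i 'D_v (fun z => f z ord0 i) x * ('D_('e_i) g \o f) x)) => //.
  move=> x Ox; have dfx := df x Ox; have dgx := dg _ (OP x Ox).
  by rewrite derive_comp_rV.
apply: is_Ck_sum => // i; apply: is_CkM => //.
    by have /(is_Ck_rVP _ _ oO)/(_ i)[_] := Cf; exact.
by apply: IH; [exact: is_CkW|exact: Dg].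
Qed.

End SmoothCalculus.

Lemma is_Ck_comp_rV (R : realType) (V : normedModType R) N M k (O : set V) (P : set 'rV[R]_N) (f : V -> 'rV[R]_N)
    (g : 'rV[R]_N -> 'rV[R]_M) :
  open O -> open P -> (forall x, O x -> P (f x)) -> is_Ck k O f -> is_Ck k P g ->
  is_Ck k O (g \o f).
Proof.
move=> oO oP OP Cf Cg; apply/is_Ck_rVP => // i.
apply: (is_Ck_comp (P := P) (g := fun z => g z ord0 i)) => //.
by have /(is_Ck_rVP _ _ oP) := Cg; exact.
Qed.

Lemma is_Ck_coord (R : realType) N k (O : set 'rV[R]_N) i : open O ->
  is_Ck k O (fun z => z ord0 i).
Proof.
move=> oO; have Cid : is_Ck k O (idfun : 'rV[R]_N -> 'rV[R]_N).
  by apply: is_Ck_lin => z; exact: cvg_id.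
exact: ((is_Ck_rVP k idfun oO).1 Cid i).
Qed.

(** * Picard iteration and Gronwall estimates *)

Section OneVariable.
Context {R : realType}.
Implicit Types (f df g : R -> R) (a b t : R).

(** The order of [a] and [b] is left open because increments of either sign and primitives from 0 to
    a negative time occur below. *)
Lemma MVT_between f df a b :
  (forall x, Num.min a b <= x <= Num.max a b -> is_derive x 1 f (df x)) ->
  exists2 c, Num.min a b <= c <= Num.max a b & f b - f a = df c * (b - a).
Proof.
wlog ab : a b / a <= b => [W dfx|].
  have [ab|ba] := orP (le_total a b); first exact: W.
  have [|c cab fE] := W b a ba; first by move=> x; rewrite minC maxC; exact: dfx.
  by exists c; [rewrite minC maxC|rewrite -opprB fE; ring].
rewrite (min_l ab) (max_r ab) => dfx.
have [||c] := @MVT_segment R f df a b ab.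
- by move=> x; rewrite in_itv/= => /andP[/ltW ax /ltW xb]; apply: dfx; rewrite ax.
- apply: derivable_within_continuous => x; rewrite in_itv/= => xab.
  by have [] := dfx _ xab.
- by rewrite in_itv/=; exists c.
Qed.

Lemma is_derive_cst0 f a b :
  (forall x, Num.min a b <= x <= Num.max a b -> is_derive x 1 f 0) -> f a = f b.
Proof.
move=> /MVT_between[c _].
by rewrite mul0r => /eqP; rewrite subr_eq0 => /eqP ->.
Qed.

Lemma is_derive_reflect f (d : R) t :
  is_derive (- t) 1 f d -> is_derive t 1 (fun x => f (- x)) (- d).
Proof.
move=> df; rewrite -mulrN1.
by apply: (is_derive1_comp (g := -%R)).
Qed.

Lemma derive_le0_le f df t : 0 <= t ->
  (forall x, 0 <= x <= t -> is_derive x 1 f (df x)) ->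
  (forall x, 0 <= x <= t -> df x <= 0) -> f t <= f 0.
Proof.
move=> t0 dfx df0; have [|c] := @MVT_between f df 0 t.
  by rewrite (min_l t0) (max_r t0).
rewrite (min_l t0) (max_r t0) subr0 => ct; rewrite -subr_le0 => ->.
by rewrite mulr_le0_ge0// df0.
Qed.

Lemma is_derive_expRM (k t : R) :
  is_derive t 1 (fun x => expR (k * x)) (k * expR (k * t)).
Proof.
rewrite mulrC; apply: (is_derive1_comp (f := expR) (g := fun x => k * x)).
by rewrite -[X in is_derive _ _ _ X]mulr1; exact: is_deriveZ.
Qed.

(** For positive times [f y * expR (- C * y)] is nonincreasing; negative times follow by
    reflection. *)
Lemma gronwall_scalar f df (C T : R) : 0 <= T ->
  (forall x : R, `|x| <= T -> is_derive x 1 f (df x)) ->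
  (forall x : R, `|x| <= T -> `|df x| <= C * f x) ->
  forall x : R, `|x| <= T -> f x <= f 0 * expR (C * `|x|).
Proof.
move=> T0 + + x.
wlog x0 : f df x / 0 <= x => [W dfx Cf xT|dfx Cf xT].
  have [x0|/ltW x0] := leP 0 x; first exact: (W f df).
  have := W (fun y => f (- y)) (fun y => - df (- y)) (- x).
  rewrite !normrN !opprK oppr0; apply; rewrite ?oppr_ge0//.
    by move=> y yT; apply: is_derive_reflect; apply: dfx; rewrite normrN.
  by move=> y yT; rewrite normrN Cf// normrN.
rewrite (ger0_norm x0) -ler_pdivrMr ?expR_gt0// -expRN -mulNr.
have := @derive_le0_le (fun y => f y * expR (- C * y))
  (fun y => f y * (- C * expR (- C * y)) + expR (- C * y) * df y) x x0.
rewrite mulr0 expR0 mulr1; apply.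
  move=> y /andP[y0 yx]; apply: is_deriveM; last exact: is_derive_expRM.
  by apply: dfx; rewrite ger0_norm// (le_trans yx)// (le_trans _ xT)// ler_norm.
move=> y /andP[y0 yx].
have yT : `|y| <= T by rewrite ger0_norm// (le_trans yx)// (le_trans _ xT)// ler_norm.
have -> : f y * (- C * expR (- C * y)) + expR (- C * y) * df y =
  expR (- C * y) * (df y - C * f y) by ring.
rewrite mulr_ge0_le0 ?expR_ge0// subr_le0 (le_trans _ (Cf _ yT))//.
exact: ler_norm.
Qed.

(** Integration against an exponential weight gains the factor [1 / k], which is the source of the
    contraction in Picard iteration. For both signs [e], the function
    [e * f y - C / k * expR (k * y)] is nonpositive at 0 and nonincreasing afterwards. *)
Lemma exp_weight_bound f df (C k : R) : 0 < k ->
  (forall x : R, is_derive x 1 f (df x)) -> f 0 = 0 ->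
  (forall x : R, `|df x| <= C * expR (k * `|x|)) ->
  forall x : R, `|f x| <= C / k * expR (k * `|x|).
Proof.
move=> k0 + + + x.
have C0 : (forall x : R, `|df x| <= C * expR (k * `|x|)) -> 0 <= C.
  move=> /(_ 0); rewrite normr0 mulr0 expR0 mulr1; exact: le_trans.
wlog x0 : f df x C0 / 0 <= x => [W dfx f0 Cf|dfx f0 Cf].
  have [x0|/ltW x0] := leP 0 x; first exact: (W f df).
  have := W (fun y => f (- y)) (fun y => - df (- y)) (- x).
  rewrite !normrN !opprK oppr0; apply; rewrite ?oppr_ge0//.
  - by move=> _; exact: C0.
  - by move=> y; exact: is_derive_reflect.
  - by move=> y; rewrite normrN -(normrN y) Cf.
rewrite (ger0_norm x0).
have H (e : R) (e1 : `|e| = 1) : e * f x <= C / k * expR (k * x).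
  have := @derive_le0_le (fun y => e * f y - C / k * expR (k * y))
    (fun y => e * df y - C / k * (k * expR (k * y))) x x0.
  rewrite f0 !mulr0 expR0 => W.
  rewrite -subr_le0; apply: le_trans (W _ _) _.
  - by move=> y _; apply: is_deriveB; apply: is_deriveZ; exact: is_derive_expRM.
  - move=> y /andP[y0 _]; rewrite mulrA divfK ?gt_eqF// subr_le0.
    rewrite (le_trans (ler_norm _))// normrM e1 mul1r -{2}(ger0_norm y0).
    exact: Cf.
  by rewrite sub0r mulr1 oppr_le0 divr_ge0// ?C0// ltW.
rewrite ler_norml lerNl -mulN1r H ?normrN1//=.
by rewrite -[f x]mul1r H ?normr1.
Qed.

Lemma primitive_exists f : continuous f ->
  exists F, (forall t, is_derive t 1 F (f t)) /\ F 0 = 0.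
Proof.
move=> cf.
pose G a x := (\int[lebesgue_measure]_(t in `[a, x]) (f t))%R.
have dG a x : a < x -> is_derive x 1 (G a) (f x).
  move=> ax; have := @continuous_FTC1_closed R f a x (x + 1).
  case.
  - by rewrite ltrDl.
  - apply: continuous_compact_integrable; first exact: segment_compact.
    by apply: continuous_subspaceT.
  - exact: ax.
  - exact: cf.
  - by rewrite derive1E => d dE; split; [exact: d|exact: dE].
(* The derivative of [G a] at [x] is known only for [a < x], so the base point moves with [t] and
   stays to the left of both 0 and [t]; subtracting the value at 0 removes the dependence on it. *)
exists (fun t => G (- `|t| - 1) t - G (- `|t| - 1) 0); split; last by rewrite subrr.
move=> t; set a := - `|t| - 2.
apply: (@near_eq_is_derive _ _ _ (fun x => G a x - G a 0)); last first.
  rewrite -[f t]subr0; apply: is_deriveB.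
  apply: dG; rewrite /a; have := lerNnormlW (lexx `|t|); lra.
near=> x.
have xt : `|x| < `|t| + 1.
  rewrite -(subrK t x) (le_lt_trans (ler_normD _ _))// addrC ltrD2l distrC.
  by near: x; exact: nbhsx_ballx.
set b := - `|x| - 1; have x0 := normr_ge0 x.
(* [G a] and [G b] have the same derivative between 0 and [x], hence differ by a constant there:
   near [t] the moving base point may be exchanged for the fixed one. *)
have H : G a 0 - G b 0 = G a x - G b x.
  apply: (@is_derive_cst0 (fun y => G a y - G b y)) => y /andP[my _].
  rewrite -(subrr (f y)); apply: is_deriveB; apply: dG; apply: lt_le_trans my;
    rewrite lt_min /a /b; have := lerNnormlW (lexx `|x|); lra.
by have -> : G a x = G b x + (G a 0 - G b 0) by [rewrite H; ring]; ring.
Unshelve. all: by end_near. Qed.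

End OneVariable.

(** * Picard iteration on the plane, with two directions of evolution *)

Section Picard.
Context {R : realType}.

Lemma rV_norm_leP N (z : 'rV[R]_N) c : 0 <= c ->
  (`|z| <= c) <-> (forall i, `|z ord0 i| <= c).
Proof.
move=> c0; rewrite [`|z|]/Num.Def.normr/= mx_normrE; split=> [+ i|zc].
  by apply: le_trans; exact: (le_bigmax _ _ (ord0, i)).
by apply: bigmax_le => // -[a i] _; rewrite (ord1 a).
Qed.

Lemma rV_coord_le N (z : 'rV[R]_N) i : `|z ord0 i| <= `|z|.
Proof. by have /rV_norm_leP := lexx `|z|; apply. Qed.

(** Chosen rather than integrated: only its derivative and its value at 0 are ever used. The
    default, the zero function, is taken when no such primitive exists. *)
Definition primitive (h : R -> R) : R -> R :=
  xget (fun=> 0) [set F : R -> R | (forall t : R, is_derive t 1 F (h t)) /\ F 0 = 0].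

Lemma primitiveP h : continuous h ->
  (forall t : R, is_derive t 1 (primitive h) (h t)) /\ primitive h 0 = 0.
Proof.
move=> /primitive_exists[F HF].
exact: (@xgetPex _ (fun=> 0) [set F : R -> R | (forall t : R, is_derive t 1 F (h t)) /\ F 0 = 0]
 (ex_intro _ F HF)).
Qed.

(** The tube lemma for the compact segment [[- T, T]]: a property that holds locally around each
    point of the slice holds on all of it, for [s] in one neighbourhood. *)
Lemma near_segment (P : R -> R -> Prop) (s0 T : R) :
  (forall t0, `|t0| <= T -> \forall t \near t0 & s \near s0, P s t) ->
  \forall s \near s0, forall t, `|t| <= T -> P s t.
Proof.
move=> H; have /compact_near_coveringP cT := @segment_compact R (- T) T.
have : \forall s \near s0, `[- T, T] `<=` P s.
  by apply: (cT R (nbhs s0) P) => t; rewrite /= in_itv/= -ler_norml; exact: H.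
by apply: filterS => s Hs t tT; apply: Hs; rewrite /= in_itv/= -ler_norml.
Qed.

Lemma uniform_on_segment (h : R * R -> R) (s0 T e : R) : continuous h -> 0 < e ->
  \forall s \near s0, forall t, `|t| <= T -> `|h (s, t) - h (s0, t)| <= e.
Proof.
move=> ch e0.
apply: near_segment => t _.
have e2 : 0 < e / 2 by rewrite divr_gt0.
have /cvgrPdist_le/(_ _ e2) ht := ch (s0, t).
have h1 : \forall t' \near t & s \near s0, `|h (s0, t) - h (s, t')| <= e / 2.
  by case: ht => -[A B] /= [As Bt] AB; exists (B, A) => // -[t' s] [/= ? ?]; exact: AB.
have h2 : \forall t' \near t & s \near s0, `|h (s0, t) - h (s0, t')| <= e / 2.
  case: ht => -[A B] /= [As Bt] AB; exists (B, setT) => /=; first by split=> //; exact: filterT.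
  by move=> -[t' s] [/= ? _]; apply: AB => /=; split=> //; exact: nbhs_singleton.
apply: filterS2 h1 h2 => -[t' s] /= h1 h2.
rewrite -(subrKA (h (s0, t))) (splitr e) (le_trans (ler_normD _ _))// lerD//.
by rewrite distrC.
Qed.

Lemma pair_slice_continuous (h : R * R -> R) s : continuous h ->
  continuous (fun t => h (s, t)).
Proof.
move=> ch t; apply: (@continuous_comp _ _ _ (fun t => (s, t)) h); last exact: ch.
exact: cvg_pair (cvg_cst _) cvg_id.
Qed.

Lemma swap_continuous (T : topologicalType) (h : R * R -> T) : continuous h ->
  continuous (fun p : R * R => h (p.2, p.1)).
Proof.
move=> ch p; apply: (@continuous_comp _ _ _ (fun p : R * R => (p.2, p.1)) h); last exact: ch.
by case: p => s t; exact: cvg_pair cvg_snd cvg_fst.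
Qed.

(** The variation is split in two: in [t] at the fixed parameter [s0], where the primitive is
    differentiable, and in the parameter, where the mean value theorem for the difference of two
    primitives reduces it to the uniform closeness of the integrands on a segment. *)
Lemma primitive_continuous2 (h : R * R -> R) : continuous h ->
  continuous (fun p : R * R => primitive (fun t => h (p.1, t)) p.2).
Proof.
move=> ch [s0 t0]; apply/cvgrPdist_le => e e0.
have e2 : 0 < e / 2 by rewrite divr_gt0.
set T := `|t0| + 1; have T0 : 0 < T by rewrite ltr_wpDl.
have eT : 0 < e / 2 / T by rewrite divr_gt0.
have P s := primitiveP (pair_slice_continuous (s := s) ch).
have h1 := uniform_on_segment s0 T ch eT.
have h2 : \forall t \near t0, `|t| <= T.
  near=> t; rewrite /T -(subrK t0 t) (le_trans (ler_normD _ _))// addrC lerD2l distrC.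
  by apply: ltW; near: t; exact: nbhsx_ballx.
have h3 : \forall t \near t0, `|primitive (fun t => h (s0, t)) t0 -
   primitive (fun t => h (s0, t)) t| <= e / 2.
  have c : {for t0, continuous (primitive (fun t => h (s0, t)))}.
    by apply/differentiable_continuous/derivable1_diffP; have [] := (P s0).1 t0.
  by have /cvgrPdist_le/(_ _ e2) := c.
have : \forall s \near s0 & t \near t0,
   (forall t', `|t'| <= T -> `|h (s, t') - h (s0, t')| <= e / 2 / T) /\
   (`|t| <= T /\ `|primitive (fun t => h (s0, t)) t0 - primitive (fun t => h (s0, t)) t| <= e / 2).
  exists ([set s | forall t', `|t'| <= T -> `|h (s, t') - h (s0, t')| <= e / 2 / T],
    [set t | `|t| <= T /\ `|primitive (fun t => h (s0, t)) t0 - primitive (fun t => h (s0, t)) t| <= e / 2]) => //=.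
  by split=> //; exact: filterI.
apply: filterS => -[s t] /= [hs [tT ht]].
rewrite -(subrKA (primitive (fun t => h (s0, t)) t)) (splitr e).
rewrite (le_trans (ler_normD _ _))// lerD//.
have [|c] := @MVT_between R (fun t => primitive (fun t => h (s0, t)) t - primitive (fun t => h (s, t)) t)
  (fun t => h (s0, t) - h (s, t)) 0 t.
  by move=> x _; apply: is_deriveB; [exact: (P s0).1|exact: (P s).1].
rewrite /= !(P _).2 !subr0 => /andP[c1 c2] ->.
have cT : `|c| <= T.
  rewrite ler_norml; move: tT; rewrite ler_norml => /andP[t1 t2].
  rewrite (le_trans _ c1) ?(le_trans c2)//.
    by rewrite ge_max t2 ltW.
  by rewrite le_min t1 lerNl oppr0 ltW.
have -> : e / 2 = e / 2 / T * T by rewrite divfK// gt_eqF.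
by rewrite normrM ler_pM// distrC hs.
Unshelve. all: by end_near. Qed.

(** Completeness in the form of nested intervals: those of radius [2 * c * 2^-1 ^+ n] around [a n]
    decrease, and the supremum of their left ends lies in all of them. *)
Lemma geometric_limit (a : nat -> R) (c : R) :
  (forall n, `|a n.+1 - a n| <= c * 2^-1 ^+ n) ->
  exists l, forall n, `|a n - l| <= 2 * c * 2^-1 ^+ n.
Proof.
move=> ac.
pose lo n := a n - 2 * c * 2^-1 ^+ n; pose hi n := a n + 2 * c * 2^-1 ^+ n.
have c0 : 0 <= c by have := le_trans (normr_ge0 _) (ac 0); rewrite expr0 mulr1.
have q0 n : 0 <= c * 2^-1 ^+ n by rewrite mulr_ge0// exprn_ge0// invr_ge0.
have los n : lo n <= lo n.+1.
  have := ac n; rewrite ler_norml /lo exprS => /andP[H _].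
  have -> : 2 * c * (2^-1 * 2^-1 ^+ n) = c * 2^-1 ^+ n by field.
  have -> : 2 * c * 2^-1 ^+ n = 2 * (c * 2^-1 ^+ n) by ring.
  lra.
have his n : hi n.+1 <= hi n.
  have := ac n; rewrite ler_norml /hi exprS => /andP[_ H].
  have -> : 2 * c * (2^-1 * 2^-1 ^+ n) = c * 2^-1 ^+ n by field.
  have -> : 2 * c * 2^-1 ^+ n = 2 * (c * 2^-1 ^+ n) by ring.
  lra.
have lom m n : (m <= n)%N -> lo m <= lo n.
  by move=> /subnK <-; elim: (n - m)%N => //= k; rewrite addSn => /le_trans; apply.
have him m n : (m <= n)%N -> hi n <= hi m.
  by move=> /subnK <-; elim: (n - m)%N => //= k; rewrite addSn; exact: le_trans.
have lohi m n : lo m <= hi n.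
  apply: le_trans (lom _ _ (leq_maxl m n)) _; apply: le_trans _ (him _ _ (leq_maxr m n)).
  by rewrite /lo /hi lerD2l -subr_ge0 opprK -mulrA; have := q0 (maxn m n); lra.
exists (sup (range lo)) => n; rewrite ler_distl; apply/andP; split.
  rewrite lerBlDr; apply: ge_sup; first by exists (lo 0); exists 0.
  by move=> _ [m _ <-]; exact: lohi.
rewrite -lerBlDr; apply: ub_le_sup; last by exists n.
by exists (hi 0) => _ [m _ <-]; exact: lohi.
Qed.

Section Iteration.
Variables (N : nat) (b : 'I_N -> bool) (f : 'I_N -> R -> R -> 'rV[R]_N -> R).
Variables (K M : R) (u0 : 'rV[R]_N).
Hypothesis K0 : 0 < K.
Hypothesis fc : forall u : R * R -> 'rV[R]_N, continuous u ->
  forall i, continuous (fun p : R * R => f i p.1 p.2 (u p)).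
Hypothesis fK : forall i s t z z', `|f i s t z - f i s t z'| <= K * `|z - z'|.
Hypothesis fM : forall i s t, `|f i s t u0| <= M.

Let T (u : R * R -> 'rV[R]_N) (p : R * R) : 'rV[R]_N :=
  \row_i (u0 ord0 i + if b i then primitive (fun t => f i p.1 t (u (p.1, t))) p.2
                      else primitive (fun s => f i s p.2 (u (s, p.2))) p.1).

(* The Picard operator halves distances measured with this weight, so no
   smallness of the domain is needed. *)
Let E (p : R * R) : R := expR (2 * K * `|p.1|) * expR (2 * K * `|p.2|).

Let fct u i s : continuous u -> continuous (fun t => f i s t (u (s, t))).
Proof.
move=> cu; apply: (@pair_slice_continuous (fun p => f i p.1 p.2 (u p)) s).
exact: fc.
Qed.

Let fcs u i t : continuous u -> continuous (fun s => f i s t (u (s, t))).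
Proof.
move=> cu.
apply: (@pair_slice_continuous (fun p => f i p.2 p.1 (u (p.2, p.1))) t).
apply: (@swap_continuous _ (fun p => f i p.1 p.2 (u p))); exact: fc.
Qed.

Let T_continuous u : continuous u -> continuous (T u).
Proof.
move=> cu p; apply/cvg_rVP => i; rewrite /T.
under eq_fun do rewrite mxE; rewrite mxE.
apply: cvgD; first exact: cvg_cst.
case: (b i).
  apply: (@primitive_continuous2 (fun p => f i p.1 p.2 (u p))); exact: fc.
apply: (@swap_continuous _ (fun p => primitive (fun s => f i s p.1 (u (s, p.1))) p.2)).
apply: (@primitive_continuous2 (fun p => f i p.2 p.1 (u (p.2, p.1)))).
apply: (@swap_continuous _ (fun p => f i p.1 p.2 (u p))); exact: fc.
Qed.

Let k0 : 0 < 2 * K. Proof. by rewrite mulr_gt0. Qed.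

Let primitiveB_bound g h c x : continuous g -> continuous h ->
  (forall y : R, `|g y - h y| <= c * expR (2 * K * `|y|)) ->
  `|primitive g x - primitive h x| <= c / (2 * K) * expR (2 * K * `|x|).
Proof.
move=> cg ch gh; have [Pg g0] := primitiveP cg; have [Ph h0] := primitiveP ch.
apply: (@exp_weight_bound R (fun y => primitive g y - primitive h y)
  (fun y => g y - h y)) => //; last by rewrite g0 h0 subrr.
Qed.

Let E_gt0 p : 0 < E p. Proof. by rewrite mulr_gt0 ?expR_gt0. Qed.

(** In the product weight [E] the factor of the other variable is constant during the integration,
    so both directions gain the same [1 / (2 * K)]. *)
Let T_bound u v c : 0 <= c -> continuous u -> continuous v ->
  (forall i p, `|f i p.1 p.2 (u p) - f i p.1 p.2 (v p)| <= c * E p) ->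
  forall p, `|T u p - T v p| <= c / (2 * K) * E p.
Proof.
move=> c0 cu cv uv [s t].
apply/rV_norm_leP => [|i]; first by rewrite mulr_ge0 ?divr_ge0// ltW.
rewrite /T /= !mxE opprD addrACA subrr add0r /E /=.
case: (b i).
  rewrite mulrA (mulrAC c); apply: primitiveB_bound; [exact: fct|exact: fct|].
  by move=> y; have := uv i (s, y); rewrite /E /= [c * _]mulrA.
rewrite (mulrC (expR _)) mulrA (mulrAC c); apply: primitiveB_bound; [exact: fcs|exact: fcs|].
by move=> y; have := uv i (y, t); rewrite /E /= [expR _ * _]mulrC [c * _]mulrA.
Qed.

Let E_continuous : continuous E.
Proof.
move=> p; apply: cvgM; (apply: continuous_comp; [|exact: continuous_expR]);
  apply: cvgM; [exact: cvg_cst| |exact: cvg_cst|]; apply: continuous_comp;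
  try exact: norm_continuous; [exact: cvg_fst|exact: cvg_snd].
Qed.

Let iterate n := iter n T (fun=> u0).

Let iterate_continuous n : continuous (iterate n).
Proof.
by elim: n => [|n IH]; [move=> p; exact: cvg_cst|exact: T_continuous].
Qed.

(** The weighted size of the first Picard step, obtained by integrating the constant bound [M]
    once. *)
Let C := `|M| / (2 * K).

Let C_ge0 : 0 <= C.
Proof. by rewrite divr_ge0// ltW// k0. Qed.

Let geo_ge0 n : 0 <= 2 * C * 2^-1 ^+ n.
Proof.
by rewrite mulr_ge0 ?exprn_ge0 ?invr_ge0// mulr_ge0 ?C_ge0.
Qed.

Let primitive_bound g x : continuous g -> (forall y : R, `|g y| <= M) ->
  `|primitive g x| <= C * expR (2 * K * `|x|).
Proof.
move=> cg gM; have [Pg g0] := primitiveP cg.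
apply: (@exp_weight_bound R (primitive g) g) => // y.
rewrite (le_trans (gM y))// (le_trans (ler_norm _))// ler_peMr//.
by rewrite -[leLHS]expR0 ler_expR// mulr_ge0// ltW// ?k0.
Qed.

Let iterate_bound n p : `|iterate n.+1 p - iterate n p| <= C * 2^-1 ^+ n * E p.
Proof.
elim: n p => [|n IH] p.
  rewrite expr0 mulr1.
  apply/rV_norm_leP => [|i]; first by rewrite mulr_ge0 ?C_ge0// ltW// E_gt0.
  have e1 (x y : R) : expR (2 * K * `|x|) <= expR (2 * K * `|x|) * expR (2 * K * `|y|).
    by rewrite ler_peMr ?expR_ge0// -[leLHS]expR0 ler_expR// mulr_ge0// ltW// ?k0.
  rewrite /= /T !mxE addrAC subrr add0r /E; case: (b i).
    apply: le_trans (primitive_bound _ _ _) _.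
    - by apply: fct => z; exact: cvg_cst.
    - by move=> y; exact: fM.
    - by rewrite mulrC [leRHS]mulrC [X in _ <= X * _]mulrC ler_wpM2r ?C_ge0// e1.
  apply: le_trans (primitive_bound _ _ _) _.
  - by apply: fcs => z; exact: cvg_cst.
  - by move=> y; exact: fM.
  - by rewrite ler_wpM2l ?C_ge0// e1.
have -> : C * 2^-1 ^+ n.+1 = K * (C * 2^-1 ^+ n) / (2 * K).
  by rewrite exprS; field; rewrite gt_eqF.
apply: (@T_bound (iterate n.+1) (iterate n)); try exact: iterate_continuous.
  apply: mulr_ge0; first exact: ltW.
  by apply: mulr_ge0; [exact: C_ge0|rewrite exprn_ge0 ?invr_ge0].
move=> i q; apply: le_trans (fK _ _ _ _ _) _.
by rewrite -mulrA ler_wpM2l ?IH// ltW.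
Qed.

(* Component [i] evolves in [t] when [b i] holds and in [s] otherwise. *)
Theorem picard : exists u : R * R -> 'rV[R]_N, [/\ continuous u,
  forall i (s t : R), b i ->
    is_derive t 1 (fun t => u (s, t) ord0 i) (f i s t (u (s, t))),
  forall i (s t : R), ~~ b i ->
    is_derive s 1 (fun s => u (s, t) ord0 i) (f i s t (u (s, t))),
  forall i s, b i -> u (s, 0) ord0 i = u0 ord0 i &
  forall i t, ~~ b i -> u (0, t) ord0 i = u0 ord0 i].
Proof.
(* The limit is taken at each point and in each coordinate separately; the explicit error with
   weight [E] restores local uniformity. *)
have /choice[u Hu] : forall p, exists z : 'rV[R]_N, forall n,
    `|iterate n p - z| <= 2 * C * 2^-1 ^+ n * E p.
  move=> p.
  have /choice[z Hz] : forall i, exists l, forall n,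
      `|iterate n p ord0 i - l| <= 2 * (C * E p) * 2^-1 ^+ n.
    move=> i; apply: geometric_limit => n.
    have := rV_coord_le (iterate n.+1 p - iterate n p) i; rewrite !mxE => /le_trans; apply.
    by rewrite (le_trans (iterate_bound n p))// mulrAC.
  exists (\row_i z i) => n.
  apply/rV_norm_leP => [|i]; first by rewrite mulr_ge0 ?geo_ge0// ltW// E_gt0.
  by rewrite !mxE (le_trans (Hz i n))// le_eqVlt; apply/orP; left; apply/eqP; ring.
(* The bound involves [E p + 1] because [E] stays below it near [p], so that the same [n] serves a
   whole neighbourhood. *)
have small p (e : R) : 0 < e -> exists n, 2 * C * 2^-1 ^+ n * (E p + 1) <= e.
  move=> e0; set A := 2 * C * (E p + 1).
  have A0 : 0 <= A by rewrite mulr_ge0 ?addr_ge0 ?(ltW (E_gt0 p))// mulr_ge0 ?C_ge0.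
  exists (Num.Def.archi_bound (A / e)).
  have /archi_boundP : 0 <= A / e by rewrite divr_ge0// ltW.
  move: (Num.Def.archi_bound _) => n An.
  have n2 : n%:R <= 2 ^+ n :> R by rewrite -natrX ler_nat ltnW// ltn_expl.
  have -> : 2 * C * 2^-1 ^+ n * (E p + 1) = A * 2^-1 ^+ n by rewrite /A; ring.
  rewrite exprVn ler_pdivrMr ?exprn_gt0// mulrC -ler_pdivrMr//.
  exact: le_trans (ltW An) n2.
have cu : continuous u.
  move=> p; apply/cvgrPdist_le => e e0.
  have e3 : 0 < e / 3 by rewrite divr_gt0.
  have [n Hn] := small p _ e3.
  have /cvgrPdist_le/(_ _ e3) cn := @iterate_continuous n p.
  have /cvgrPdist_le/(_ _ ltr01) cE := @E_continuous p.
  apply: filterS2 cn cE => q cn cE.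
  have Eq : E q <= E p + 1.
    by rewrite -lerBlDl (le_trans _ cE)// distrC ler_norm.
  have H r : E r <= E p + 1 -> `|iterate n r - u r| <= e / 3.
    move=> Er; rewrite (le_trans (Hu r n))// (le_trans _ Hn)// ler_wpM2l// geo_ge0.
  have -> : u p - u q = - (iterate n p - u p) + (iterate n p - iterate n q) + (iterate n q - u q).
    by rewrite opprB !addrA !subrK.
  have -> : e = e / 3 + e / 3 + e / 3 by field.
  rewrite (le_trans (ler_normD _ _))// lerD ?H// (le_trans (ler_normD _ _))// lerD//.
  by rewrite normrN H// lerDl.
(* Both [T u] and [u] are compared with the iterate of index [n.+1]; each distance is at most half
   of the error at index [n]. *)
have uE p : T u p = u p.
  apply/eqP; rewrite -subr_eq0 -normr_le0; apply/ler_addgt0Pr => e e0; rewrite add0r.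
  have [n Hn] := small p _ e0.
  have -> : T u p - u p = - (T (iterate n) p - T u p) + (iterate n.+1 p - u p).
    by rewrite -[iterate n.+1 p]/(T (iterate n) p) opprB !addrA subrK.
  have -> : e = e / 2 + e / 2 by field.
  rewrite (le_trans (ler_normD _ _))// lerD//.
    rewrite normrN; apply: le_trans (@T_bound (iterate n) u (K * (2 * C * 2^-1 ^+ n)) _ _ _ _ p) _ => //.
    + by rewrite mulr_ge0 ?geo_ge0// ltW.
    + move=> i q; rewrite (le_trans (fK _ _ _ _ _))// -[K * _ * E q]mulrA.
      by rewrite ler_wpM2l ?(ltW K0).
    have -> : K * (2 * C * 2^-1 ^+ n) / (2 * K) * E p = 2 * C * 2^-1 ^+ n * E p / 2.
      by field; rewrite gt_eqF.
    rewrite ler_pM2r ?invr_gt0// (le_trans _ Hn)// ler_wpM2l ?lerDl// geo_ge0.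
  rewrite (le_trans (Hu p n.+1))// exprS.
  have -> : 2 * C * (2^-1 * 2^-1 ^+ n) * E p = 2 * C * 2^-1 ^+ n * E p / 2 by ring.
  rewrite ler_pM2r ?invr_gt0// (le_trans _ Hn)// ler_wpM2l ?lerDl// geo_ge0.
exists u; split => //.
- move=> i s t bi.
  rewrite (_ : (fun t => _) = fun t => u0 ord0 i + primitive (fun t => f i s t (u (s, t))) t).
    rewrite -[X in is_derive _ _ _ X]add0r; have := (primitiveP (@fct u i s cu)).1 t.
    exact: is_deriveD.
  by apply/funext => x; rewrite -[in LHS]uE mxE bi.
- move=> i s t /negbTE bi.
  rewrite (_ : (fun s => _) = fun s => u0 ord0 i + primitive (fun s => f i s t (u (s, t))) s).
    rewrite -[X in is_derive _ _ _ X]add0r; have := (primitiveP (@fcs u i t cu)).1 s.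
    exact: is_deriveD.
  by apply/funext => x; rewrite -[in LHS]uE mxE bi.
- by move=> i s bi; rewrite -uE mxE bi (primitiveP (@fct u i s cu)).2 addr0.
- by move=> i t /negbTE bi; rewrite -uE mxE bi (primitiveP (@fcs u i t cu)).2 addr0.
Qed.

End Iteration.

End Picard.

(** * Gronwall estimate for systems *)

Section Gronwall.
Context {R : realType}.

(** [M] is fixed before [y] and [e], so letting [e] tend to 0 forces [y] to 0. This gives both the
    convergence of difference quotients and the uniqueness for linear equations. *)
Lemma gronwall_system N (C T : R) : 0 <= C -> 0 <= T ->
  exists2 M, 0 < M & forall (y dy : 'I_N -> R -> R) e, 0 < e ->
  (forall i (x : R), `|x| <= T -> is_derive x 1 (y i) (dy i x)) ->
  (forall i, y i 0 = 0) ->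
  (forall i x, `|x| <= T -> `|dy i x| <= C * (\sum_j `|y j x| + e)) ->
  forall i x, `|x| <= T -> `|y i x| <= e * M.
Proof.
(* The sum of the norms plus [e] is at most [(N + 1)] times the square root of the energy [z] below,
   so each of the [N] terms [2 * y j * dy j] is at most [2 * C * (N + 1) * z]. [M] is a square root
   because the estimate is made for [z], which is quadratic. *)
move=> C0 T0; set k := 2 * C * (N%:R * (N%:R + 1)).
have k0 : 0 <= k by rewrite !mulr_ge0// addr_ge0.
exists (Num.sqrt (expR (k * T))); first by rewrite sqrtr_gt0 expR_gt0.
move=> y dy e e0 dyE y0 dyC i x xT.
(* [e ^+ 2] keeps [z] positive and makes its square root dominate both [e] and [y]. *)
pose z x := \sum_i y i x ^+ 2 + e ^+ 2.
have zi j t : y j t ^+ 2 <= z t.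
  rewrite /z (bigD1 j)//= -addrA lerDl addr_ge0 ?sqr_ge0//.
  by apply: sumr_ge0 => ? _; exact: sqr_ge0.
have ze t : e ^+ 2 <= z t.
  by rewrite /z lerDr; apply: sumr_ge0 => ? _; exact: sqr_ge0.
have z0 t : 0 <= z t := le_trans (sqr_ge0 _) (ze t).
have yr j t : `|y j t| <= Num.sqrt (z t) by rewrite -sqrtr_sqr ler_wsqrtr.
have er t : e <= Num.sqrt (z t).
  by rewrite -[leLHS]gtr0_norm// -sqrtr_sqr ler_wsqrtr.
pose dz x := \sum_i (y i x * dy i x + y i x * dy i x).
have := @gronwall_scalar R z dz k T T0 _ _ x xT.
have -> : z 0 = e ^+ 2.
  by rewrite /z big1 ?add0r// => j _; rewrite y0 expr0n.
move=> H; rewrite (le_trans (yr i x))//.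
have -> : e * Num.sqrt (expR (k * T)) = Num.sqrt (e ^+ 2 * expR (k * T)).
  by rewrite sqrtrM ?sqr_ge0// sqrtr_sqr gtr0_norm.
apply: ler_wsqrtr; apply: le_trans (H _ _) _.
- move=> t tT; rewrite -[dz t]addr0 /z.
  have -> : (fun x => \sum_i y i x ^+ 2 + e ^+ 2) = (\sum_i (y i * y i)) + cst (e ^+ 2).
    apply/funext => r /=; rewrite -[RHS]/(_ + _) fct_sumE /cst; congr (_ + _).
  apply: is_deriveD; apply: is_derive_sum => j.
  have := dyE j t tT => Hj; exact: is_deriveM.
- move=> t tT; rewrite /dz; set r := Num.sqrt (z t).
  have r0 : 0 <= r by exact: sqrtr_ge0.
  have Sr : \sum_j `|y j t| <= N%:R * r.
    rewrite (le_trans (ler_sum _ (fun j _ => yr j t)))//.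
    by rewrite sumr_const card_ord -[leLHS]mulr_natl.
  have dj j : `|dy j t| <= C * ((N%:R + 1) * r).
    by rewrite (le_trans (dyC j t tT))// ler_wpM2l// mulrDl mul1r lerD//; exact: er.
  have -> : k * z t = \sum_(j < N) (2 * (r * (C * ((N%:R + 1) * r)))).
    by rewrite sumr_const card_ord -[RHS]mulr_natl /k -(sqr_sqrtr (z0 t)) -/r; ring.
  rewrite (le_trans (ler_norm_sum _ _ _))//; apply: ler_sum => j _.
  by rewrite -mulr2n -[X in `|X|]mulr_natl !normrM normr_nat ler_wpM2l// ler_pM//; exact: yr.
- by rewrite ler_wpM2l ?sqr_ge0// ler_expR ler_wpM2l.
Qed.

End Gronwall.

(** * Mean value estimates in several variables *)

Section Several.
Context {R : realType}.

Lemma is_derive_line (V W : normedModType R) (g : V -> W) (z w : V) (a : R) l :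
  is_derive (z + a *: w) w g l -> is_derive a 1 (fun a => g (z + a *: w)) l.
Proof.
have E : (fun h : R => h^-1 *: (((fun a => g (z + a *: w)) \o shift a) (h *: 1) - g (z + a *: w))) =
  (fun h => h^-1 *: ((g \o shift (z + a *: w)) (h *: w) - g (z + a *: w))).
  apply/funext => h /=; rewrite -[h *: 1]/(h * 1) mulr1 scalerDl.
  by rewrite addrA (addrC z) addrA.
by move=> [dg gl]; split; [rewrite /derivable E|rewrite -gl /derive E].
Qed.

Lemma MVT_rV N (g : 'rV[R]_N -> R) z z' :
  (forall a, 0 <= a <= 1 -> differentiable g (z + a *: (z' - z))) ->
  exists2 a, 0 <= a <= 1 & g z' - g z =
    \sum_j (z' ord0 j - z ord0 j) * 'D_('e_j) g (z + a *: (z' - z)).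
Proof.
move=> dg.
have [|a] := @MVT_between R (fun a => g (z + a *: (z' - z)))
   (fun a => 'D_(z' - z) g (z + a *: (z' - z))) 0 1.
  rewrite min_l// max_r// => a a01; apply: is_derive_line.
  by apply: derivableP; apply: diff_derivable; exact: dg.
rewrite min_l// max_r// => a01.
have zz : z + (z' - z) = z' by rewrite addrC subrK.
rewrite scale1r scale0r addr0 subr0 mulr1 zz => E.
exists a => //; rewrite E derive_rV_sum; last exact: dg.
by apply: eq_bigr => j _; rewrite !mxE.
Qed.

Lemma ball_segment (V : normedModType R) (c z z' : V) r a :
  `|c - z| <= r -> `|c - z'| <= r -> 0 <= a <= 1 -> `|c - (z + a *: (z' - z))| <= r.
Proof.
move=> cz cz' /andP[a0 a1].
have -> : c - (z + a *: (z' - z)) = (1 - a) *: (c - z) + a *: (c - z').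
  rewrite scalerBl scale1r -[in RHS]addrA (addrC (- _)) -scalerBr.
  have -> : c - z' - (c - z) = - (z' - z).
    by rewrite opprB addrC addrA subrK opprB.
  by rewrite scalerN opprD addrA.
rewrite (le_trans (ler_normD _ _))// !normrZ (ger0_norm a0) ger0_norm ?subr_ge0//.
have -> : r = (1 - a) * r + a * r by ring.
by rewrite lerD// ler_wpM2l// subr_ge0.
Qed.

(** The error is uniform in both end points: the mean value theorem puts the derivative at a point
    of the segment between them, and this derivative is close to the one at [c]. Uniformity is
    needed because the base point later moves along a whole slice of the solution. *)
Lemma strict_differentiable N (O : set 'rV[R]_N) (g : 'rV[R]_N -> R) c e :
  open O -> O c -> is_Ck 1 O g -> 0 < e ->
  \forall z \near c & z' \near c,
    `|g z' - g z - \sum_j 'D_('e_j) g z * (z' ord0 j - z ord0 j)| <=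
    e * \sum_j `|z' ord0 j - z ord0 j|.
Proof.
move=> oO Oc [dg Dg] e0.
have e2 : 0 < e / 2 by rewrite divr_gt0.
have Dc j : \forall z \near c, `|'D_('e_j) g c - 'D_('e_j) g z| <= e / 2.
  by have /cvgrPdist_le/(_ _ e2) := Dg 'e_j c Oc.
have near_c : \forall z \near c, O z /\
    forall j, `|'D_('e_j) g c - 'D_('e_j) g z| <= e / 2.
  near=> z; split; first by near: z; exact: open_nbhs_nbhs.
  by near: z; apply: filter_forall.
have [r /= r0 rP] := (nbhs_normP _ _).1 near_c.
have r2 : 0 < r / 2 by rewrite divr_gt0.
have rle z : `|c - z| <= r / 2 -> O z /\
    forall j, `|'D_('e_j) g c - 'D_('e_j) g z| <= e / 2.
  by move=> cz; apply: rP; rewrite /= (le_lt_trans cz)// ltr_pdivrMr// ltr_pMr// ltr1n.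
have nc : \forall z \near c, `|c - z| <= r / 2.
  by apply/nbhs_normP; exists (r / 2) => //= z /= /ltW.
exists ([set z | `|c - z| <= r / 2], [set z | `|c - z| <= r / 2]) => //= -[z z'] /= [cz cz'].
have [|a a01 ->] := @MVT_rV N g z z'.
  by move=> a a01; apply: dg; have [] := rle _ (ball_segment cz cz' a01).
rewrite -sumrB (le_trans (ler_norm_sum _ _ _))// mulr_sumr.
apply: ler_sum => j _; rewrite [_ * (z' ord0 j - _)]mulrC -mulrBr normrM mulrC.
rewrite ler_wpM2r//.
have [_ /(_ j) H1] := rle _ (ball_segment cz cz' a01).
have [_ /(_ j) H2] := rle _ cz.
rewrite -(subrKA ('D_('e_j) g c)) (splitr e) (le_trans (ler_normD _ _))// lerD//.
by rewrite distrC.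
Unshelve. all: by end_near. Qed.

End Several.

Section Clamp.
Context {R : realType}.

(** Composing with this retraction onto [[- r, r]] makes local data global and leaves them unchanged
    inside, so a Picard theorem with global bounds yields local solutions. *)
Definition clamp (r x : R) := Num.max (- r) (Num.min r x).

Lemma clamp_id r x : `|x| <= r -> clamp r x = x.
Proof. by rewrite ler_norml /clamp => /andP[rx xr]; rewrite (min_r xr) (max_r rx). Qed.

Lemma clamp_le r x : 0 <= r -> `|clamp r x| <= r.
Proof.
move=> r0; rewrite ler_norml /clamp le_max lexx/= ge_max ge_min lexx/= andbT.
by rewrite lerNl (le_trans _ r0)// oppr_le0.
Qed.

Lemma clamp_continuous r : continuous (clamp r).
Proof.
move=> x; apply: (continuous_max (f := fun=> - r) (g := fun x => Num.min r x)).
  exact: cvg_cst.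
apply: (continuous_min (f := fun=> r) (g := id)); [exact: cvg_cst|exact: cvg_id].
Qed.

End Clamp.

(** * Semilinear systems in characteristic form *)

Section CharacteristicSystem.
Context {R : realType}.

Definition square (d : R) : set (R * R) := [set p | `|p.1| < d /\ `|p.2| < d].

(** A Goursat problem with constant data: each component is prescribed on the axis transversal to
    its direction of evolution. Only continuity is required of [u] beyond the equations; smoothness
    is a theorem. *)
Definition char_solution N (b : 'I_N -> bool) (O : set 'rV[R]_N)
    (F : 'I_N -> 'rV[R]_N -> R) (u0 : 'rV[R]_N) (d : R) (u : R * R -> 'rV[R]_N) :=
  [/\ forall p, square d p -> O (u p) /\ {for p, continuous u},
    forall i (s t : R), square d (s, t) -> b i ->
      is_derive t 1 (fun t => u (s, t) ord0 i) (F i (u (s, t))),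
    forall i (s t : R), square d (s, t) -> ~~ b i ->
      is_derive s 1 (fun s => u (s, t) ord0 i) (F i (u (s, t))),
    forall i (s : R), `|s| < d -> b i -> u (s, 0) ord0 i = u0 ord0 i &
    forall i (t : R), `|t| < d -> ~~ b i -> u (0, t) ord0 i = u0 ord0 i].

Section Step.
Variables (N : nat) (b : 'I_N -> bool) (O : set 'rV[R]_N).
Variables (F : 'I_N -> 'rV[R]_N -> R) (u0 : 'rV[R]_N) (d : R) (u : R * R -> 'rV[R]_N).
Hypothesis oO : open O.
Hypothesis F1 : forall i, is_Ck 1 O (F i).
Hypothesis sol : char_solution b O F u0 d u.

Let uO p : square d p -> O (u p). Proof. by have [H _ _ _ _] := sol; case/H. Qed.

Let uc p : square d p -> {for p, continuous u}.
Proof. by have [H _ _ _ _] := sol; case/H. Qed.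

Let DF i j p := 'D_('e_j) (F i) (u p).

Let DFc i j p : square d p -> {for p, continuous (DF i j)}.
Proof.
move=> dp; apply: (@continuous_comp _ _ _ u ('D_('e_j) (F i))); first exact: uc.
exact: ((F1 i).2 'e_j _ (uO dp)).
Qed.

Let Fc i p : square d p -> {for p, continuous (fun p => F i (u p))}.
Proof.
move=> dp; apply: (@continuous_comp _ _ _ u (F i)); first exact: uc.
by apply: differentiable_continuous; exact: ((F1 i).1 _ (uO dp)).
Qed.

Lemma square_nbhs p : square d p -> nbhs p (square d).
Proof.
case: p => s t [/= sd td].
have lt_nbhs (x : R) : `|x| < d -> \forall y \near x, `|y| < d.
  by move=> xd; exact: (@cvgr_norm_lt _ _ _ _ _ id x (@cvg_id _ (nbhs x)) _ xd).
by exists ([set x | `|x| < d], [set x | `|x| < d]) => //=; split; exact: lt_nbhs.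
Qed.

Variable (T : R).
Hypotheses (T0 : 0 < T) (Td : T < d).

Let square_seg s t : `|s| <= T -> `|t| <= T -> square d (s, t).
Proof. by move=> sT tT; split; exact: le_lt_trans Td. Qed.

Let cl (p : R * R) := (clamp T p.1, clamp T p.2).

Let clK s t : `|s| <= T -> `|t| <= T -> cl (s, t) = (s, t).
Proof. by move=> sT tT; rewrite /cl /= !clamp_id. Qed.

Let cl_square p : square d (cl p).
Proof. by apply: square_seg; exact: clamp_le (ltW _). Qed.

Let cl_continuous : continuous cl.
Proof.
case=> s t; apply: (@cvg_pair _ _ _ _ (nbhs (clamp T s)) (nbhs (clamp T t))).
  exact: (cvg_comp fst (clamp T) cvg_fst (@clamp_continuous _ T s)).
exact: (cvg_comp snd (clamp T) cvg_snd (@clamp_continuous _ T t)).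
Qed.

Let clamped_continuous (h : R * R -> R) :
  (forall p, square d p -> {for p, continuous h}) -> continuous (h \o cl).
Proof.
by move=> ch p; apply: continuous_comp; [exact: cl_continuous|exact/ch/cl_square].
Qed.

Let clamped_bounded (h : R * R -> R) :
  (forall p, square d p -> {for p, continuous h}) ->
  exists2 B, 0 <= B & forall p, `|h (cl p)| <= B.
Proof.
move=> ch.
have [|||c _ cmax] := @compact_EVT_max (R * R)%type R (fun p => `|h (cl p)|) (`[-T, T] `*` `[-T, T]).
- by exists (0, 0); split; rewrite /= in_itv/= oppr_le0 ltW.
- by apply: compact_setX; exact: segment_compact.
- apply: continuous_subspaceT => p; apply: (@continuous_comp _ _ _ (h \o cl)).
    exact: clamped_continuous.
  exact: norm_continuous.
exists `|h (cl c)| => // p.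
have -> : cl p = cl (cl p) by rewrite /cl /= !(@clamp_id _ T (clamp T _)) ?clamp_le ?ltW.
apply: cmax; rewrite inE; split; rewrite /= in_itv/= -ler_norml clamp_le//; exact: ltW.
Qed.

Let increment s0 s t j := u (s, t) ord0 j - u (s0, t) ord0 j.

Let incrementF i s0 e : `|s0| <= T -> 0 < e -> \forall s \near s0,
  forall t, `|t| <= T ->
  `|F i (u (s, t)) - F i (u (s0, t)) - \sum_j DF i j (s0, t) * increment s0 s t j| <=
   e * \sum_j `|increment s0 s t j|.
Proof.
move=> s0T e0; apply: near_segment => t0 t0T.
have sq := square_seg s0T t0T.
have := strict_differentiable oO (uO sq) (F1 i) e0.
case=> -[A B] /= [Ac Bc] AB.
have [[A1 A2] /= [A1s A2t] A12] := uc sq Ac.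
have [[B1 B2] /= [B1s B2t] B12] := uc sq Bc.
exists (A2 `&` B2, B1) => /=; first by split=> //; exact: filterI.
case=> t s /= [[A2t' B2t'] B1s'].
apply: (AB (u (s0, t), u (s, t))); split => /=.
  by apply: (A12 (s0, t)); split => //=; exact: nbhs_singleton.
exact: (B12 (s, t)).
Qed.

(** For an [s]-evolved component the equation itself gives the [s]-derivative, and the mean value
    theorem makes the convergence of its difference quotients uniform in [t]. *)
Let increment_evolved j s0 e : ~~ b j -> `|s0| <= T -> 0 < e -> \forall s \near s0,
  forall t, `|t| <= T ->
  `|increment s0 s t j - F j (u (s0, t)) * (s - s0)| <= e * `|s - s0|.
Proof.
move=> bj s0T e0; apply: near_segment => t0 t0T.
have sq := square_seg s0T t0T.
have e2 : 0 < e / 2 by rewrite divr_gt0.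
have /cvgrPdist_le/(_ _ e2) Fn := Fc (i := j) sq.
have [[A B] /= [As Bt] AB] := filterI Fn (square_nbhs sq).
have [r /= r0 rA] := (nbhs_ballP _ _).1 As.
exists (B, ball s0 r) => /=; first by split => //; exact: nbhsx_ballx.
case=> t s /= [Bt' sr].
have mid c : Num.min s0 s <= c <= Num.max s0 s -> A c.
  move=> /andP[c1 c2]; apply: rA; move: sr; rewrite -ball_normE /ball_/= !ltr_norml.
  case: (leP s0 s) c1 c2 => ss c1 c2 /andP[? ?]; apply/andP; split; lra.
have [|c cs] := @MVT_between R (fun s => u (s, t) ord0 j) (fun s => F j (u (s, t))) s0 s.
  move=> c /mid Ac; have [_ _ H _ _] := sol; apply: H => //.
  by have [] := AB (c, t) (conj Ac Bt').
rewrite /increment => ->; rewrite -mulrBl normrM ler_wpM2r//.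
have [H1 _] := AB (c, t) (conj (mid _ cs) Bt').
have [H2 _] := AB (s0, t) (conj (nbhs_singleton As) Bt').
rewrite -(subrKA (F j (u (s0, t0)))) (splitr e) (le_trans (ler_normD _ _))// lerD//.
by rewrite distrC.
Qed.

Let bounds : exists A, [/\ 0 <= A, forall i j p, `|DF i j (cl p)| <= A &
  forall j p, `|F j (u (cl p))| <= A].
Proof.
have /choice[B1 B1P] : forall ij : 'I_N * 'I_N, exists B, 0 <= B /\ forall p, `|DF ij.1 ij.2 (cl p)| <= B.
  by move=> ij; have [B B0 BP] := clamped_bounded (@DFc ij.1 ij.2); exists B.
have /choice[B2 B2P] : forall j : 'I_N, exists B, 0 <= B /\ forall p, `|F j (u (cl p))| <= B.
  by move=> j; have [B B0 BP] := clamped_bounded (@Fc j); exists B.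
exists (\sum_ij B1 ij + \sum_j B2 j).
have s1 : 0 <= \sum_ij B1 ij by apply: sumr_ge0 => ij _; exact: (B1P ij).1.
have s2 : 0 <= \sum_j B2 j by apply: sumr_ge0 => j _; exact: (B2P j).1.
split; first exact: addr_ge0.
- move=> i j p; rewrite (le_trans ((B1P (i, j)).2 p))// (bigD1 (i, j))//= -addrA lerDl.
  by rewrite addr_ge0// sumr_ge0// => ij _; exact: (B1P ij).1.
- move=> j p; rewrite (le_trans ((B2P j).2 p))// addrC (bigD1 j)//= -addrA lerDl.
  by rewrite addr_ge0// sumr_ge0// => ij _; exact: (B2P ij).1.
Qed.

(* The equation obtained by differentiating the [t]-evolved components in [s]; the
   [s]-derivative of an [s]-evolved component [j] is already known to be [F j u]. *)
Let linearized i (s t : R) (z : 'rV[R]_N) : R :=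
  if b i then \sum_j DF i j (cl (s, t)) * (if b j then z ord0 j else F j (u (cl (s, t))))
  else 0.

(** The coefficients are clamped to the closed square of half-side [T], hence bounded, and the
    equation is affine in [z], so the global Picard theorem applies; only values inside the square
    matter later. *)
Let linearized_solution : exists p : R * R -> 'rV[R]_N, [/\ continuous p,
  forall i (s t : R), b i ->
    is_derive t 1 (fun t => p (s, t) ord0 i) (linearized i s t (p (s, t))) &
  forall i s, b i -> p (s, 0) ord0 i = 0].
Proof.
have [A [A0 AD AF]] := bounds.
have K0 : 0 < N%:R * A + 1 by rewrite ltr_wpDl// mulr_ge0.
have [|||p [pc p1 _ p2 _]] :=
    @picard R N b linearized (N%:R * A + 1) (\sum_(j < N) A * A) 0 K0.
- move=> v cv i p; rewrite /linearized; case: (b i); last exact: cvg_cst.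
  apply: cvg_sum_ord => j; apply: cvgM.
    by case: p => s t; apply: (clamped_continuous (@DFc i j)).
  case: (b j); last by case: p => s t; apply: (clamped_continuous (@Fc j)).
  by have /cvg_rVP := cv p; exact.
- move=> i s t z z'; rewrite /linearized; case: (b i); last first.
    by rewrite subrr normr0 mulr_ge0// ltW.
  rewrite -sumrB (@le_trans _ _ (\sum_(j < N) (A * `|z - z'|)))//; last first.
    by rewrite sumr_const card_ord -[leLHS]mulr_natl mulrDl mul1r mulrA lerDl.
  rewrite (le_trans (ler_norm_sum _ _ _))//; apply: ler_sum => j _.
  rewrite -mulrBr normrM ler_pM// ?AD//; case: (b j); last by rewrite subrr normr0.
  by have := rV_coord_le (z - z') j; rewrite !mxE.
- move=> i s t; rewrite /linearized; case: (b i); last first.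
    by rewrite normr0 sumr_ge0// => j _; rewrite mulr_ge0.
  rewrite (le_trans (ler_norm_sum _ _ _))//; apply: ler_sum => j _.
  rewrite normrM ler_pM// ?AD//; case: (b j); last exact: AF.
  by rewrite mxE normr0.
exists p; split=> // i s bi; by rewrite p2// mxE.
Qed.

Lemma near_increment (s0 : R) (P : set R) :
  nbhs s0 P -> \forall h \near (0 : R)^', h != 0 /\ P (h + s0).
Proof.
move=> nP; have : \near s0, P s0 := nP.
rewrite (near_shift 0) subr0 => n; rewrite near_withinE.
by apply: filterS n => h Ph hn0; split.
Qed.

(** The difference quotient in [s] and the solution [p] of the linearized equation both vanish at
    [t = 0] in the [t]-evolved components. Their difference satisfies a linear differential
    inequality in [t] whose inhomogeneity tends to 0 with the increment, so Gronwall's estimate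
    makes the quotient converge to [p]. *)
Lemma parameter_derivative_on : exists p : R * R -> 'rV[R]_N, [/\ continuous p,
  forall i (s t : R), b i -> `|s| < T -> `|t| < T ->
    is_derive s 1 (fun s => u (s, t) ord0 i) (p (s, t) ord0 i) /\
    is_derive t 1 (fun t => p (s, t) ord0 i)
      (\sum_j 'D_('e_j) (F i) (u (s, t)) *
        (if b j then p (s, t) ord0 j else F j (u (s, t)))) &
  forall i s, b i -> p (s, 0) ord0 i = 0].
Proof.
have [p [pc p1 p2]] := linearized_solution.
exists p; split=> // i s0 t1 bi s0T t1T; split; last first.
  have := p1 i s0 t1 bi; rewrite /linearized bi.
  by rewrite clK// ltW.
have {}s0T := ltW s0T; have {}t1T := ltW t1T.
have [A [A0 AD AF]] := bounds.
have [B B0 pB] : exists2 B, 0 <= B & forall j t, `|t| <= T -> `|p (s0, t) ord0 j| <= B.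
  have /choice[Bf BfP] : forall j : 'I_N, exists B, 0 <= B /\ forall q, `|p (cl q) ord0 j| <= B.
    move=> j; have [|B B0 BP] := @clamped_bounded (fun q => p q ord0 j); last by exists B.
    by move=> q _; have /cvg_rVP := @pc q; exact.
  exists (\sum_j Bf j); first by apply: sumr_ge0 => j _; exact: (BfP j).1.
  move=> j t tT; rewrite -(clK s0T tT) (le_trans ((BfP j).2 _))// (bigD1 j)//= lerDl.
  by apply: sumr_ge0 => ? _; exact: (BfP _).1.
(* This constant absorbs the three estimates [b1], [b2], [b3] below: [A] bounds the coefficients,
   [A + B] the expected derivatives, and [N] counts the components. *)
pose C := (1 + A) * (1 + N%:R) + N%:R * (A + B).
have C0 : 0 <= C by rewrite addr_ge0 ?mulr_ge0 ?addr_ge0.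
have [M M0 MP] := gronwall_system N C0 (ltW T0).
have lim : (fun h => h^-1 *: (u (h *: 1 + s0, t1) ord0 i - u (s0, t1) ord0 i)) @ 0^' --> p (s0, t1) ord0 i.
  apply/cvgrPdist_le => e e0.
  (* The part [e / M] turns the Gronwall bound [k * M] into [e]; the part 1 allows [k] times the
     error sum to be absorbed into that sum. *)
  pose k := Num.min 1 (e / M).
  have k0 : 0 < k by rewrite lt_min ltr01 divr_gt0.
  have k1 : k <= 1 by rewrite ge_min lexx.
  have n1 : \forall s \near s0, forall i t, `|t| <= T ->
     `|F i (u (s, t)) - F i (u (s0, t)) - \sum_j DF i j (s0, t) * increment s0 s t j| <=
     k * \sum_j `|increment s0 s t j|.
    by near=> s => j; move: j; near: s; apply: filter_forall => j; exact: incrementF.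
  have n2 : \forall s \near s0, forall j, ~~ b j -> forall t, `|t| <= T ->
     `|increment s0 s t j - F j (u (s0, t)) * (s - s0)| <= k * `|s - s0|.
    near=> s => j; move: j; near: s; apply: filter_forall => j.
    have [bj|bj] := boolP (b j); first exact: nearW.
    by apply: filterS (increment_evolved bj s0T k0) => s Hs _.
  have n3 : \forall s \near s0, `|s| < d.
    exact: (@cvgr_norm_lt _ _ _ _ _ id s0 (@cvg_id _ (nbhs s0)) _ (le_lt_trans s0T Td)).
  have n := near_increment (@filterI _ _ (nbhs_filter s0) _ _ n1 (@filterI _ _ (nbhs_filter s0) _ _ n2 n3)).
  apply: filterS n => h [hn0].
  set s := h + s0 => -[m1 [m2 sd]].
  have sh : s - s0 = h by rewrite /s addrK.
  rewrite -[h *: 1]/(h * 1) mulr1 -/s.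
  pose P j t := if b j then p (s0, t) ord0 j else F j (u (s0, t)).
  have PB j t : `|t| <= T -> `|P j t| <= A + B.
    move=> tT; rewrite /P; case: (b j).
      by rewrite (le_trans (pB j t tT))// lerDr.
    by rewrite -(clK s0T tT) (le_trans (AF _ _))// lerDl.
  pose w j t := h^-1 * increment s0 s t j.
  (* Gronwall's estimate runs over the [t]-evolved components alone. The error of the others is
     already at most [k] by [increment_evolved] and enters only through the inhomogeneity. *)
  pose y j t := if b j then w j t - p (s0, t) ord0 j else 0.
  pose dy j t := if b j then h^-1 * (F j (u (s, t)) - F j (u (s0, t))) -
    \sum_k DF j k (s0, t) * P k t else 0.
  have yP j t : `|t| <= T -> `|w j t - P j t| <= `|y j t| + k.
    move=> tT; rewrite /P /y; have [bj|bj] := boolP (b j); first by rewrite lerDl ltW.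
    have -> : w j t - F j (u (s0, t)) =
        h^-1 * (increment s0 s t j - F j (u (s0, t)) * (s - s0)).
      by rewrite sh /w; field.
    rewrite normr0 add0r normrM normfV ler_pdivrMl ?normr_gt0//.
    by rewrite (le_trans (m2 j bj t tT))// sh [leRHS]mulrC.
  have := MP y dy k k0 _ _ _ i t1 t1T.
  rewrite /y bi /w /increment distrC => H.
  apply: le_trans (H _ _ _) _.
  - move=> j t tT; rewrite /y /dy; case: (boolP (b j)) => bj; last exact: is_derive_cst.
    have [_ sP _ _ _] := sol.
    have d1 := sP j s t (conj sd (le_lt_trans tT Td)) bj.
    have d2 := sP j s0 t (square_seg s0T tT) bj.
    have d3 := p1 j s0 t bj.
    have -> : \sum_k DF j k (s0, t) * P k t = linearized j s0 t (p (s0, t)).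
      by rewrite /linearized bj clK.
    by apply: is_deriveB; apply: is_deriveZ; exact: is_deriveB.
  - move=> j; rewrite /y; case: (boolP (b j)) => // bj.
    have [_ _ _ iP _] := sol.
    by rewrite /w /increment !iP// ?p2 ?subrr ?mulr0 ?subr0// (le_lt_trans s0T).
  - move=> j t tT; set S := \sum_j0 `|y j0 t|.
    have S0 : 0 <= S by apply: sumr_ge0.
    have CSk : 0 <= C * (S + k) by rewrite mulr_ge0// addr_ge0// ltW.
    rewrite /dy; case: (boolP (b j)) => bj; last by rewrite normr0.
    have -> : h^-1 * (F j (u (s, t)) - F j (u (s0, t))) - \sum_k DF j k (s0, t) * P k t =
      h^-1 * (F j (u (s, t)) - F j (u (s0, t)) - \sum_k DF j k (s0, t) * increment s0 s t k) +
      \sum_k DF j k (s0, t) * (w k t - P k t).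
      under [X in _ = _ + X]eq_bigr do rewrite mulrBr.
      rewrite sumrB [h^-1 * (_ - \sum_k _)]mulrBr mulr_sumr.
      under [X in _ = _ + (X - _)]eq_bigr do rewrite /w mulrCA.
      by rewrite addrA subrK.
    have b1 : `|h^-1 * (F j (u (s, t)) - F j (u (s0, t)) -
        \sum_k DF j k (s0, t) * increment s0 s t k)| <= k * \sum_j `|w j t|.
      rewrite normrM; apply: le_trans (ler_wpM2l (normr_ge0 _) (m1 j t tT)) _.
      rewrite mulrCA mulr_sumr; under eq_bigr do rewrite -normrM.
      by [].
    have b2 : `|\sum_k DF j k (s0, t) * (w k t - P k t)| <= A * (S + N%:R * k).
      rewrite (le_trans (ler_norm_sum _ _ _))//.
      have -> : A * (S + N%:R * k) = \sum_j A * (`|y j t| + k).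
        by rewrite -mulr_sumr big_split/= sumr_const card_ord -[k *+ N]mulr_natl.
      apply: ler_sum => j' _; rewrite normrM ler_pM ?yP//.
      by rewrite -(clK s0T tT) AD.
    have b3 : \sum_j `|w j t| <= S + N%:R * k + N%:R * (A + B).
      have -> : S + N%:R * k + N%:R * (A + B) = \sum_j (`|y j t| + k + (A + B)).
        by rewrite big_split big_split/= !sumr_const card_ord -[k *+ N]mulr_natl -[(A + B) *+ N]mulr_natl.
      apply: ler_sum => j' _; rewrite -[w j' t](subrK (P j' t)).
      by rewrite (le_trans (ler_normD _ _))// lerD ?yP ?PB.
    rewrite (le_trans (ler_normD _ _))//.
    rewrite (le_trans (lerD b1 b2))//.
    have n0 : 0 <= N%:R :> R by [].
    have kw : k * \sum_j `|w j t| <= (S + N%:R * k) + k * (N%:R * (A + B)).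
      rewrite (le_trans (ler_wpM2l (ltW k0) b3))// mulrDr lerD2r.
      by rewrite ler_piMl// addr_ge0// mulr_ge0// ltW.
    rewrite (le_trans (lerD kw (lexx _)))// /C.
    rewrite -subr_ge0.
    set X := (X in 0 <= X).
    have -> : X = (1 + A) * (N%:R * S + k) + N%:R * (A + B) * S by rewrite /X; ring.
    by rewrite addr_ge0 ?mulr_ge0 ?addr_ge0 ?mulr_ge0// ltW.
  - by rewrite -ler_pdivlMr// /k ge_min lexx orbT.
by split; [apply/cvg_ex; exists (p (s0, t1) ord0 i)|exact: cvg_lim].
Unshelve. all: by end_near. Qed.

End Step.
End CharacteristicSystem.

(** * Prolongation: derivatives of solutions solve a system of the same form *)

Section Regularity.
Context {R : realType}.

Lemma char_solution_swap N b (O : set 'rV[R]_N) F u0 d u :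
  char_solution b O F u0 d u ->
  char_solution (fun i => ~~ b i) O F u0 d (fun p => u (p.2, p.1)).
Proof.
move=> [h1 h2 h3 h4 h5]; split.
- move=> [s t] [/= sd td]; have [Ou cu] := h1 (t, s) (conj td sd); split; first exact: Ou.
  apply: (@continuous_comp _ _ _ (fun p : R * R => (p.2, p.1)) u) => //.
  exact: cvg_pair cvg_snd cvg_fst.
- by move=> i s t [sd td] bi; apply: h3.
- by move=> i s t [sd td]; rewrite negbK; apply: h2.
- by move=> i s sd; exact: h5.
- by move=> i t td; rewrite negbK; exact: h4.
Qed.

Lemma square_sub d (s t : R) : square d (s, t) ->
  exists T, [/\ 0 < T, T < d, `|s| < T & `|t| < T].
Proof.
move=> [/= sd td]; exists ((Num.max `|s| `|t| + d) / 2).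
have m0 : 0 <= Num.max `|s| `|t| by rewrite le_max normr_ge0.
have md : Num.max `|s| `|t| < d by rewrite gt_max sd.
have ms : `|s| <= Num.max `|s| `|t| by rewrite le_max lexx.
have mt : `|t| <= Num.max `|s| `|t| by rewrite le_max lexx orbT.
move: (Num.max _ _) m0 md ms mt => m m0 md ms mt.
by split; lra.
Qed.

(** Defining [p] as the actual [s]-derivative makes it independent of the smaller square on which it
    was constructed, so the local statements glue over the full open square. *)
Lemma parameter_derivative N b (O : set 'rV[R]_N) F u0 d u :
  open O -> (forall i, is_Ck 1 O (F i)) -> char_solution b O F u0 d u ->
  exists p : R * R -> 'rV[R]_N, [/\
  forall i q, square d q -> {for q, continuous (fun q => p q ord0 i)},
  forall i (s t : R), square d (s, t) -> b i ->
    is_derive s 1 (fun s => u (s, t) ord0 i) (p (s, t) ord0 i),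
  forall i (s t : R), square d (s, t) -> b i ->
    is_derive t 1 (fun t => p (s, t) ord0 i)
      (\sum_j 'D_('e_j) (F i) (u (s, t)) *
        (if b j then p (s, t) ord0 j else F j (u (s, t)))) &
  forall i s, `|s| < d -> b i -> p (s, 0) ord0 i = 0].
Proof.
move=> oO F1 sol.
pose p q : 'rV[R]_N := \row_i if b i then 'D_1 (fun s => u (s, q.2) ord0 i) q.1 else 0.
have loc s t : square d (s, t) -> exists2 pT : R * R -> 'rV[R]_N, exists2 T, `|s| < T /\ `|t| < T &
    forall q i, square T q -> b i -> p q ord0 i = pT q ord0 i & [/\ continuous pT,
  forall i, b i ->
    is_derive s 1 (fun s => u (s, t) ord0 i) (pT (s, t) ord0 i),
  forall i, b i -> is_derive t 1 (fun t => pT (s, t) ord0 i)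
      (\sum_j 'D_('e_j) (F i) (u (s, t)) *
        (if b j then pT (s, t) ord0 j else F j (u (s, t)))) &
  forall i, b i -> pT (s, 0) ord0 i = 0].
  move=> /square_sub[T [T0 Td sT tT]].
  have [pT [pc p1 p2]] := parameter_derivative_on oO F1 sol T0 Td.
  exists pT.
    exists T => // -[s' t'] i [/= s'T t'T] bi; rewrite mxE bi /=.
    by have [[_ <-] _] := p1 i s' t' bi s'T t'T.
  split=> // i bi; [|by have [_] := p1 i s t bi sT tT|exact: p2].
  by have [] := p1 i s t bi sT tT.
exists p; split.
- move=> i [s t] dq; have [pT [T [sT tT] pE] [pc _ _ _]] := loc s t dq.
  have pTc : {for (s, t), continuous (fun q => pT q ord0 i)}.
    by have /cvg_rVP := @pc (s, t); exact.
  have [bi|bi] := boolP (b i); last first.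
    rewrite (_ : (fun q => _) = fun=> 0); first exact: cvg_cst.
    by apply/funext => q; rewrite mxE (negbTE bi).
  rewrite /prop_for /continuous_at pE//; apply: cvg_trans pTc; apply: near_eq_cvg.
  have sq : square T (s, t) by [].
  by apply: filterS (square_nbhs sq) => q Tq; rewrite pE.
- move=> i s t dq bi; have [pT [T [sT tT] pE] [_ H _ _]] := loc s t dq.
  by rewrite pE//; exact: H.
- move=> i s t dq bi; have [pT [T [sT tT] pE] [_ _ H _]] := loc s t dq.
  have -> : \sum_j 'D_('e_j) (F i) (u (s, t)) * (if b j then p (s, t) ord0 j else F j (u (s, t)))
    = \sum_j 'D_('e_j) (F i) (u (s, t)) * (if b j then pT (s, t) ord0 j else F j (u (s, t))).
    by apply: eq_bigr => j _; case: (boolP (b j)) => // bj; rewrite pE.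
  apply: near_eq_is_derive (H i bi).
  have : \forall t' \near t, `|t'| < T.
    exact: (@cvgr_norm_lt _ _ _ _ _ id t (@cvg_id _ (nbhs t)) _ tT).
  by apply: filterS => t' t'T; rewrite pE.
- move=> i s sd bi.
  have sq : square d (s, 0) by split=> //=; rewrite normr0 (le_lt_trans _ sd).
  have [pT [T [sT tT] pE] [_ _ _ H]] := loc s 0 sq.
  by rewrite pE// H.
Qed.

Definition prolonged_type N (b : 'I_N -> bool) (k : 'I_(N + N)) :=
  match fintype.split k with inl i => b i | inr i => b i end.

(* The second half of the components stands for the derivative of [u i] along the
   direction in which it is not evolved. *)
Definition prolonged_field N (b : 'I_N -> bool) (F : 'I_N -> 'rV[R]_N -> R)
    (k : 'I_(N + N)) (z : 'rV[R]_(N + N)) : R :=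
  match fintype.split k with
  | inl i => F i (lsubmx z)
  | inr i => \sum_j 'D_('e_j) (F i) (lsubmx z) *
      (if b i == b j then rsubmx z ord0 j else F j (lsubmx z))
  end.

(** Differentiating the equation of [u i] in the transversal direction gives an equation for [r i]
    along the direction in which [u i] evolves. There the transversal derivative of [u j] is [r j]
    if [j] evolves like [i], and [F j u] otherwise. The data for [r] are 0 since those for [u] are
    constant on the axes. The [s]-evolved half follows by exchanging the coordinates. *)
Lemma prolongation N b (O : set 'rV[R]_N) F u0 d u :
  open O -> (forall i, is_Ck 1 O (F i)) -> char_solution b O F u0 d u ->
  exists r : R * R -> 'rV[R]_N,
    char_solution (prolonged_type b) [set z | O (lsubmx z)] (prolonged_field b F)
      (row_mx u0 0) d (fun q => row_mx (u q) (r q)) /\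
    forall i (s t : R), square d (s, t) -> if b i then
      is_derive s 1 (fun s => u (s, t) ord0 i) (r (s, t) ord0 i) else
      is_derive t 1 (fun t => u (s, t) ord0 i) (r (s, t) ord0 i).
Proof.
move=> oO F1 sol; have [p [pc p1 p2 p3]] := parameter_derivative oO F1 sol.
have [p' [pc' p1' p2' p3']] := parameter_derivative oO F1 (char_solution_swap sol).
pose r q : 'rV[R]_N := \row_i if b i then p q ord0 i else p' (q.2, q.1) ord0 i.
have swap_sq s t : square d (s, t) -> square d (t, s) by move=> [].
exists r; split; last first.
  move=> i s t sq; rewrite mxE; case: (boolP (b i)) => bi; first exact: p1.
  by apply: p1' => //; exact: swap_sq.
have [h1 h2 h3 h4 h5] := sol.
have rE q k : row_mx (u q) (r q) ord0 k =
    match fintype.split k with inl i => u q ord0 i | inr i => r q ord0 i end.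
  by rewrite mxE.
split.
- move=> q dq; have [Ou cu] := h1 q dq; split; first by rewrite /= row_mxKl.
  apply/cvg_rVP => k; under eq_fun do rewrite rE; rewrite rE.
  case: (fintype.split k) => i; first by have /cvg_rVP := cu; exact.
  under eq_fun do rewrite mxE; rewrite mxE; case: (boolP (b i)) => bi; first exact: pc.
  apply: (@continuous_comp _ _ _ (fun p : R * R => (p.2, p.1)) (fun q => p' q ord0 i)).
    by case: q {dq Ou cu} => s t; exact: cvg_pair cvg_snd cvg_fst.
  by apply: pc'; case: dq.
- move=> k s t sq; rewrite /prolonged_type /prolonged_field.
  under eq_fun do rewrite rE.
  rewrite row_mxKl row_mxKr; case: (fintype.split k) => i bi; first exact: h2.
  under eq_fun do rewrite mxE bi.
  have := p2 i s t sq bi; congr is_derive; apply: eq_bigr => j _.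
  by rewrite bi eq_sym eqb_id mxE; case: (b j).
- move=> k s t sq; rewrite /prolonged_type /prolonged_field.
  under eq_fun do rewrite rE.
  rewrite row_mxKl row_mxKr; case: (fintype.split k) => i bi; first exact: h3.
  under eq_fun do rewrite mxE (negbTE bi).
  have := p2' i t s (swap_sq _ _ sq) bi; congr is_derive; apply: eq_bigr => j _.
  by rewrite (negbTE bi) mxE; case: (b j).
- move=> k s sd; rewrite /prolonged_type rE [in RHS]mxE; case: (fintype.split k) => i bi.
    exact: h4.
  by rewrite !mxE bi p3.
- move=> k t td; rewrite /prolonged_type rE [in RHS]mxE; case: (fintype.split k) => i bi.
    exact: h5.
  by rewrite !mxE (negbTE bi) p3'.
Qed.

End Regularity.

(** * Smoothness of the solutions *)

Section Plane.
Context {R : realType}.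

Lemma differentiable_linear_epsP (V W : normedModType R) (f L : V -> W) (x : V) :
  linear L -> continuous L ->
  (forall e, 0 < e -> \forall h \near (0 : V), `|f (h + x) - f x - L h| <= e * `|h|) ->
  differentiable f x /\ 'd f x = L :> (V -> W).
Proof.
move=> linL cL fL.
pose L' : {linear V -> W} :=
  HB.pack_for {linear V -> W} L (GRing.isLinear.Build R V W _ L linL).
exact: (@differentiable_epsP R V W f x L').
Qed.

Definition square2 (d : R) : set 'rV[R]_2 :=
  [set z | square d (z ord0 ord0, z ord0 ord_max)].

(** A translation between the pairs used for iteration along slices and the row vectors on which
    gradients and Jacobians live. *)
Definition on_plane (h : R * R -> R) (z : 'rV[R]_2) := h (z ord0 ord0, z ord0 ord_max).

Lemma square2_open d : open (square2 d).
Proof.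
have cc (j : 'I_2) : open [set z : 'rV[R]_2 | `|z ord0 j| < d].
  apply: (@open_comp _ _ (fun z : 'rV[R]_2 => `|z ord0 j|) [set x : R | x < d]); last exact: open_lt.
  move=> z _; apply: (@continuous_comp _ _ _ (fun z : 'rV[R]_2 => z ord0 j) Num.norm).
    exact: (@coord_continuous R 1 2 ord0 j z).
  exact: norm_continuous.
exact: openI (cc ord0) (cc ord_max).
Qed.

Lemma coords_continuous (z : 'rV[R]_2) :
  {for z, continuous (fun z : 'rV[R]_2 => (z ord0 ord0, z ord0 ord_max))}.
Proof.
exact: (cvg_pair (@coord_continuous R 1 2 ord0 ord0 z) (@coord_continuous R 1 2 ord0 ord_max z)).
Qed.

(** The increment is made along two sides of a rectangle, one in [t] and one in [s]; the mean value
    theorem on each side and the continuity of the partial derivatives give the error estimate. *)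
Lemma differentiable_partials (h hs ht : R * R -> R) d :
  (forall q, square d q -> {for q, continuous hs}) ->
  (forall q, square d q -> {for q, continuous ht}) ->
  (forall s t : R, square d (s, t) -> is_derive s 1 (fun s => h (s, t)) (hs (s, t))) ->
  (forall s t : R, square d (s, t) -> is_derive t 1 (fun t => h (s, t)) (ht (s, t))) ->
  forall z, square2 d z -> differentiable (on_plane h) z /\
    forall v, 'D_v (on_plane h) z =
      v ord0 ord0 * on_plane hs z + v ord0 ord_max * on_plane ht z.
Proof.
move=> cs ct ds dt z sq.
pose L (v : 'rV[R]_2) := v ord0 ord0 * on_plane hs z + v ord0 ord_max * on_plane ht z.
have linL : linear L.
  by move=> a v w; rewrite /L !mxE -[a *: _]/(a * _); ring.
have cL : continuous L.
  move=> v; exact: (cvgD (cvgM (@coord_continuous R 1 2 ord0 ord0 v) (cvg_cst _))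
    (cvgM (@coord_continuous R 1 2 ord0 ord_max v) (cvg_cst _))).
suff [H1 H2] : differentiable (on_plane h) z /\ 'd (on_plane h) z = L :> (_ -> _).
  by split=> // v; rewrite deriveE// H2.
apply: differentiable_linear_epsP => // e e0.
have e2 : 0 < e / 2 by rewrite divr_gt0.
set s := z ord0 ord0; set t := z ord0 ord_max.
have /cvgrPdist_le/(_ _ e2) ns := cs _ sq.
have /cvgrPdist_le/(_ _ e2) nt := ct _ sq.
have [[A B] /= [As Bt] AB] := filterI (filterI ns nt) (square_nbhs sq).
have [r /= r0 rA] := (nbhs_ballP _ _).1 As.
have [r' /= r0' rB] := (nbhs_ballP _ _).1 Bt.
near=> k.
have k1 : `|k ord0 ord0| < r.
  by rewrite (le_lt_trans (rV_coord_le k ord0))//; near: k; exact: nbhs0_lt.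
have k2 : `|k ord0 ord_max| < r'.
  by rewrite (le_lt_trans (rV_coord_le k ord_max))//; near: k; exact: nbhs0_lt.
have mid (c x a rr : R) : Num.min x (a + x) <= c <= Num.max x (a + x) -> `|a| < rr ->
    ball x rr c.
  rewrite -ball_normE /ball_/= !ltr_norml => /andP[+ +] /andP[? ?].
  case: (leP x (a + x)) => ss c1 c2; apply/andP; split; lra.
have At c : Num.min s (k ord0 ord0 + s) <= c <= Num.max s (k ord0 ord0 + s) -> A c.
  by move=> H; apply: rA; exact: mid H k1.
have Bs c : Num.min t (k ord0 ord_max + t) <= c <= Num.max t (k ord0 ord_max + t) -> B c.
  by move=> H; apply: rB; exact: mid H k2.
have Bk : B (k ord0 ord_max + t) by apply: Bs; rewrite ge_min le_max lexx !orbT.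
have [|c1 c1P E1] := @MVT_between R (fun s => h (s, k ord0 ord_max + t))
  (fun s => hs (s, k ord0 ord_max + t)) s (k ord0 ord0 + s).
  by move=> c /At Ac; apply: ds; have [_] := AB (c, k ord0 ord_max + t) (conj Ac Bk).
have [|c2 c2P E2] := @MVT_between R (fun t => h (s, t))
  (fun t => ht (s, t)) t (k ord0 ord_max + t).
  by move=> c /Bs Bc; apply: dt; have [_] := AB (s, c) (conj (nbhs_singleton As) Bc).
have -> : on_plane h (k + z) - on_plane h z - L k =
   k ord0 ord0 * (hs (c1, k ord0 ord_max + t) - hs (s, t)) +
   k ord0 ord_max * (ht (s, c2) - ht (s, t)).
  rewrite /on_plane /L !mxE -/s -/t.
  have -> : h (k ord0 ord0 + s, k ord0 ord_max + t) - h (s, t) =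
    (h (k ord0 ord0 + s, k ord0 ord_max + t) - h (s, k ord0 ord_max + t)) +
    (h (s, k ord0 ord_max + t) - h (s, t)) by ring.
  by rewrite E1 E2 !addrK /on_plane -/s -/t; ring.
have [[H1 _] _] := AB (c1, k ord0 ord_max + t) (conj (At _ c1P) Bk).
have [[_ H2] _] := AB (s, c2) (conj (nbhs_singleton As) (Bs _ c2P)).
have -> : e * `|k| = `|k| * (e / 2) + `|k| * (e / 2) by field.
by rewrite (le_trans (ler_normD _ _))// lerD// normrM ler_pM// ?rV_coord_le// distrC.
Unshelve. all: by end_near. Qed.

(** The induction ranges over all systems at once, because the prolongation doubles the number of
    unknowns. By the induction hypothesis [u] and its transversal derivatives [r] are of order [k];
    the partial derivatives of [u] are [F u] and [r], so [u] gains one order. *)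
Theorem char_solution_smooth k N b (O : set 'rV[R]_N) F u0 d u :
  open O -> (forall i k, is_Ck k O (F i)) -> char_solution b O F u0 d u ->
  forall i, is_Ck k (square2 d) (on_plane (fun q => u q ord0 i)).
Proof.
elim: k N b O F u0 u => [|k IH] N b O F u0 u oO Fs sol i.
  move=> z sq; have [h1 _ _ _ _] := sol; have [_ /cvg_rVP cu] := h1 _ sq.
  exact: (@continuous_comp _ _ _ (fun z : 'rV[R]_2 => (z ord0 ord0, z ord0 ord_max))
    (fun q => u q ord0 i) z (@coords_continuous z) (cu i)).
have F1 j : is_Ck 1 O (F j) by exact: Fs.
have [r [rsol rD]] := prolongation oO F1 sol.
have [h1 h2 h3 _ _] := sol.
have lc : continuous (lsubmx : 'rV[R]_(N + N) -> 'rV[R]_N).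
  move=> z; apply/(@cvg_rVP R N _ _ (nbhs_filter z) lsubmx (lsubmx z)) => j; under eq_fun do rewrite mxE; rewrite mxE.
  exact: coord_continuous.
have oO' : open [set z : 'rV[R]_(N + N) | O (lsubmx z)].
  by apply: open_comp => // z _; exact: lc.
have Cl m : is_Ck m [set z : 'rV[R]_(N + N) | O (lsubmx z)] (lsubmx : 'rV[R]_(N + N) -> 'rV[R]_N).
  exact: is_Ck_lin.
have F's j m : is_Ck m [set z : 'rV[R]_(N + N) | O (lsubmx z)] (prolonged_field b F j).
  rewrite /prolonged_field; case: (fintype.split j) => i'.
    exact: (is_Ck_comp (P := O)).
  apply: is_Ck_sum => // j'; apply: is_CkM => //.
    by apply: (is_Ck_comp (P := O) (g := 'D_('e_j') (F i'))) => //; exact: (Fs i' m.+1).2.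
  case: (b i' == b j'); last exact: (is_Ck_comp (P := O)).
  apply: (is_Ck_eq (f := fun z : 'rV[R]_(N + N) => z ord0 (rshift N j'))) => //.
    by move=> z _; rewrite mxE.
  exact: is_Ck_coord.
have IHu j := IH _ _ _ _ _ _ oO Fs sol j.
have IHr j : is_Ck k (square2 d) (on_plane (fun q => r q ord0 j)).
  have := IH _ _ _ _ _ _ oO' F's rsol (rshift N j); apply: is_Ck_eq; first exact: square2_open.
  by move=> z _; rewrite /on_plane row_mxEr.
pose us q := if b i then r q ord0 i else F i (u q).
pose ut q := if b i then F i (u q) else r q ord0 i.
have CF : is_Ck k (square2 d) (on_plane (fun q => F i (u q))).
  apply: (@is_Ck_comp R _ N k (square2 d) O (fun z : 'rV[R]_2 => u (z ord0 ord0, z ord0 ord_max)) (F i)).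
  - exact: square2_open.
  - by move=> z sq; have [] := h1 _ sq.
  - by apply/is_Ck_rVP; [exact: square2_open|exact: IHu].
  - exact: Fs.
have Cs : is_Ck k (square2 d) (on_plane us).
  by rewrite /on_plane /us; case: (b i); [exact: IHr|exact: CF].
have Ct : is_Ck k (square2 d) (on_plane ut).
  by rewrite /on_plane /ut; case: (b i); [exact: CF|exact: IHr].
have [h1' _ _ _ _] := rsol.
have cr q : square d q -> {for q, continuous (fun q => r q ord0 i)}.
  move=> sq; have [_ /cvg_rVP/(_ (rshift N i))] := h1' q sq.
  by under eq_fun do rewrite row_mxEr; rewrite row_mxEr.
have cF q : square d q -> {for q, continuous (fun q => F i (u q))}.
  move=> sq; have [Ou cu] := h1 q sq.
  apply: (@continuous_comp _ _ _ u (F i)) => //.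
  exact: (is_Ck_continuous (Fs i 0)).
have D := @differentiable_partials (fun q => u q ord0 i) us ut d.
have {}D : forall z, square2 d z -> differentiable (on_plane (fun q => u q ord0 i)) z /\
    forall v, 'D_v (on_plane (fun q => u q ord0 i)) z =
      v ord0 ord0 * on_plane us z + v ord0 ord_max * on_plane ut z.
  apply: D.
  - by move=> q sq; rewrite /us; case: (b i); [exact: cr|exact: cF].
  - by move=> q sq; rewrite /ut; case: (b i); [exact: cF|exact: cr].
  - move=> s t sq; rewrite /us; have := rD i s t sq; case: (boolP (b i)) => // bi _.
    exact: h3.
  - move=> s t sq; rewrite /ut; have := rD i s t sq; case: (boolP (b i)) => // bi _.
    exact: h2.
split=> [z sq|v]; first exact: (D z sq).1.
apply: (is_Ck_eq (f := fun z => v ord0 ord0 * on_plane us z + v ord0 ord_max * on_plane ut z)).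
- exact: square2_open.
- by move=> z sq; rewrite (D z sq).2.
- have sqo := @square2_open d.
  by apply: is_CkD => //; apply: is_CkM => //; exact: is_Ck_cst.
Qed.

End Plane.

(** * Symmetry of second derivatives *)

Section Clairaut.
Context {R : realType} {V : normedModType R}.
Implicit Types (O : set V) (f : V -> R).

Lemma second_difference O f x v w h : 0 <= h -> is_Ck 2 O f ->
  (forall a b, 0 <= a <= h -> 0 <= b <= h -> O (x + a *: v + b *: w)) ->
  exists a b, [/\ 0 <= a <= h, 0 <= b <= h &
    f (x + h *: v + h *: w) - f (x + h *: v) - f (x + h *: w) + f x =
    h * h * 'D_v ('D_w f) (x + a *: v + b *: w)].
Proof.
move=> h0 [df Df] Oab; have [dDf _] := Df w.
have isd y u : O y -> is_derive y u f ('D_u f y).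
  by move=> Oy; apply: derivableP; apply: diff_derivable; exact: df.
have isdd y u : O y -> is_derive y u ('D_w f) ('D_u ('D_w f) y).
  by move=> Oy; apply: derivableP; apply: diff_derivable; exact: dDf.
have h0' : 0 <= h <= h by rewrite h0 lexx.
have h00 : 0 <= (0 : R) <= h by rewrite lexx.
have [|b] := @MVT_between R (fun b => f (x + h *: v + b *: w) - f (x + b *: w))
   (fun b => 'D_w f (x + h *: v + b *: w) - 'D_w f (x + b *: w)) 0 h.
  rewrite (min_l h0) (max_r h0) => b bh; apply: is_deriveB; apply: is_derive_line; apply: isd.
    exact: Oab.
  by have := Oab 0 b h00 bh; rewrite scale0r addr0.
rewrite (min_l h0) (max_r h0) !scale0r !addr0 subr0 => bh E1.
have [|a] := @MVT_between R (fun a => 'D_w f (x + b *: w + a *: v))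
   (fun a => 'D_v ('D_w f) (x + b *: w + a *: v)) 0 h.
  rewrite (min_l h0) (max_r h0) => a ah; apply: (is_derive_line (g := 'D_w f)); apply: isdd.
  by rewrite (addrAC x); apply: Oab.
rewrite (min_l h0) (max_r h0) scale0r addr0 subr0 (addrAC x) => ah E2.
exists a, b; split=> //; rewrite (addrAC x (a *: v)).
transitivity (f (x + h *: v + h *: w) - f (x + h *: w) - (f (x + h *: v) - f x)); first by ring.
by rewrite E1 E2; ring.
Qed.

(** Both mixed derivatives, taken at suitable nearby points, equal the same second difference
    divided by [h * h]; continuity brings the two points back to [x]. *)
Lemma derive_swap O f x v w : open O -> is_Ck 2 O f -> O x ->
  'D_v ('D_w f) x = 'D_w ('D_v f) x.
Proof.
move=> oO Cf Ox; apply/eqP; rewrite -subr_eq0 -normr_le0; apply/ler_addgt0Pr => e e0.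
have e2 : 0 < e / 2 by rewrite divr_gt0.
have c1 : {for x, continuous ('D_v ('D_w f))} by exact: ((Cf.2 w).2 v x Ox).
have c2 : {for x, continuous ('D_w ('D_v f))} by exact: ((Cf.2 v).2 w x Ox).
have /cvgrPdist_le/(_ _ e2) n1 := c1; have /cvgrPdist_le/(_ _ e2) n2 := c2.
have [r /= r0 rP] := (nbhs_normP _ _).1
  (filterI (open_nbhs_nbhs (conj oO Ox)) (filterI n1 n2)).
(* With [h = r / m] the parallelogram spanned at [x] by [h *: v] and [h *: w] lies in the open ball
   of radius [r]. *)
pose m := `|v| + `|w| + 1.
have m0 : 0 < m by rewrite ltr_wpDl ?addr_ge0.
pose h := r / m.
have h0 : 0 < h by rewrite divr_gt0.
have near_x a b : 0 <= a <= h -> 0 <= b <= h -> `|x - (x + a *: v + b *: w)| < r.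
  move=> /andP[a0 ah] /andP[b0 bh].
  rewrite -addrA opprD addrA subrr sub0r normrN (le_lt_trans (ler_normD _ _))//.
  rewrite !normrZ !ger0_norm//.
  apply: (@le_lt_trans _ _ (h * `|v| + h * `|w|)).
    by rewrite lerD// ler_wpM2r.
  have -> : r = h * m by rewrite /h divfK// gt_eqF.
  by rewrite /m -mulrDr ltr_pM2l// ltrDl.
have Oab a b : 0 <= a <= h -> 0 <= b <= h -> O (x + a *: v + b *: w).
  by move=> ah bh; have [] := rP _ (near_x a b ah bh).
have [a [b [ah bh E1]]] := second_difference (ltW h0) Cf Oab.
have Oba a' b' : 0 <= a' <= h -> 0 <= b' <= h -> O (x + a' *: w + b' *: v).
  by move=> ah' bh'; rewrite (addrAC x); apply: Oab.
have [a' [b' [ah' bh' E2]]] := second_difference (ltW h0) Cf Oba.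
have E : 'D_v ('D_w f) (x + a *: v + b *: w) = 'D_w ('D_v f) (x + a' *: w + b' *: v).
  have hh : h * h != 0 by rewrite mulf_neq0// gt_eqF.
  apply: (mulfI hh); apply: etrans (esym E1) _; apply: etrans _ E2.
  by rewrite (addrAC x (h *: w)); congr (_ + _); exact: addrAC.
have [_ [H1 _]] := rP _ (near_x a b ah bh).
have [_ [_ H2]] := rP _ (near_x b' a' bh' ah').
rewrite add0r -(subrKA ('D_v ('D_w f) (x + a *: v + b *: w))) (splitr e).
apply: le_trans (ler_normD _ _) _; apply: lerD; first exact: H1.
by rewrite distrC E (addrAC x (a' *: w)); exact: H2.
Qed.

End Clairaut.

(** * Local existence for characteristic systems *)

Section Existence.
Context {R : realType}.

Lemma clamp_lip (r x y : R) : `|clamp r x - clamp r y| <= `|x - y|.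
Proof.
have h1 := ler_norm (x - y); have h2 := ler_norm (y - x).
rewrite distrC in h2; rewrite ler_norml /clamp.
case: (leP r x) => rx; case: (leP r y) => ry;
  [case: (leP (- r) r) => rr| case: (leP (- r) r) => rr; case: (leP (- r) y) => ryy
  | case: (leP (- r) r) => rr; case: (leP (- r) x) => rxx
  | case: (leP (- r) x) => rxx; case: (leP (- r) y) => ryy];
  apply/andP; split; lra.
Qed.

(** The unknown is clamped coordinatewise to a ball around [u0], which makes the field globally
    Lipschitz. The global solution of the clamped system solves the original one as long as it stays
    in that ball. *)
Lemma char_solution_exists N b (O : set 'rV[R]_N) F u0 :
  open O -> O u0 -> (forall i, is_Ck 1 O (F i)) ->
  exists2 d, 0 < d & exists u, char_solution b O F u0 d u.
Proof.
move=> oO Ou0 F1.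
have nD ij : \forall z \near u0, `|'D_('e_ij.2) (F ij.1) u0 - 'D_('e_ij.2) (F ij.1) z| <= 1.
  by have /cvgrPdist_le/(_ _ ltr01) := (F1 ij.1).2 'e_ij.2 u0 Ou0.
have nO : \forall z \near u0, O z /\
    forall ij, `|'D_('e_ij.2) (F ij.1) u0 - 'D_('e_ij.2) (F ij.1) z| <= 1.
  near=> z; split; first by near: z; exact: open_nbhs_nbhs.
  by near: z; apply: filter_forall.
have [r' /= r'0 rP'] := (nbhs_normP _ _).1 nO.
pose r := r' / 2; have r0 : 0 < r by rewrite divr_gt0.
have rP z : `|u0 - z| <= r -> O z /\
    forall i j, `|'D_('e_j) (F i) u0 - 'D_('e_j) (F i) z| <= 1.
  move=> zr; have [|Oz H] := rP' z; last by split=> // i j; exact: (H (i, j)).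
  by rewrite /= (le_lt_trans zr)// /r ltr_pdivrMr// ltr_pMr// ltr1n.
pose cb (z : 'rV[R]_N) : 'rV[R]_N := \row_j (u0 ord0 j + clamp r (z ord0 j - u0 ord0 j)).
have cb_r z : `|u0 - cb z| <= r.
  apply/rV_norm_leP => [|j]; first exact: ltW.
  by rewrite !mxE opprD addrA subrr sub0r normrN clamp_le// ltW.
have cb_lip z z' : `|cb z - cb z'| <= `|z - z'|.
  apply/rV_norm_leP => // j; rewrite !mxE opprD addrACA subrr add0r.
  rewrite (le_trans (clamp_lip _ _ _))// opprD addrACA opprK addNr addr0.
  by have := rV_coord_le (z - z') j; rewrite !mxE.
have cb_id z : `|u0 - z| <= r -> cb z = z.
  move=> zr; apply/rowP => j; rewrite mxE clamp_id ?(addrC (u0 _ _)) ?subrK// distrC.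
  by rewrite (le_trans _ zr)//; have := rV_coord_le (u0 - z) j; rewrite !mxE.
have cb_c : continuous cb.
  move=> z; apply/(@cvg_rVP R N _ _ (nbhs_filter z) cb (cb z)) => j.
  under eq_fun do rewrite mxE; rewrite mxE; apply: cvgD; first exact: cvg_cst.
  apply: (cvg_comp (fun z : 'rV[R]_N => z ord0 j - u0 ord0 j) (clamp r)); last exact: clamp_continuous.
  exact: (cvgB (@coord_continuous R 1 N ord0 j z) (cvg_cst _)).
(* On the ball each partial derivative differs by at most 1 from its value at [u0], so the inner sum
   bounds the Lipschitz constant of [F i]; the final 1 makes [K] positive. *)
pose K := \sum_i \sum_j (`|'D_('e_j) (F i) u0| + 1) + 1.
have Kij0 i j : 0 <= `|'D_('e_j) (F i) u0| + 1 by rewrite addr_ge0.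
have K0 : 0 < K by rewrite ltr_wpDl// sumr_ge0// => i _; rewrite sumr_ge0.
have Fcb i z z' : `|F i (cb z) - F i (cb z')| <= K * `|z - z'|.
  have [|a a01 ->] := @MVT_rV R N (F i) (cb z') (cb z).
    move=> a a01; apply: (F1 i).1.
    by have [] := rP _ (ball_segment (cb_r z') (cb_r z) a01).
  have [_ H] := rP _ (ball_segment (cb_r z') (cb_r z) a01).
  rewrite (le_trans (ler_norm_sum _ _ _))//.
  apply: (@le_trans _ _ (\sum_j (`|'D_('e_j) (F i) u0| + 1) * `|z - z'|)).
    apply: ler_sum => j _; rewrite normrM mulrC ler_pM//.
      rewrite -[X in `|X|](subrK ('D_('e_j) (F i) u0)) addrC (le_trans (ler_normD _ _))//.
      by rewrite lerD// distrC.
    rewrite (le_trans _ (cb_lip z z'))//.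
    by have := rV_coord_le (cb z - cb z') j; rewrite !mxE.
  rewrite -mulr_suml ler_wpM2r// /K [X in _ <= X + _](bigD1 i)//= -addrA lerDl addr_ge0//.
  by rewrite sumr_ge0// => i' _; rewrite sumr_ge0.
have [|||u [uc u1 u2 u3 u4]] := @picard R N b (fun i _ _ z => F i (cb z)) K
   (\sum_i `|F i u0|) u0 K0.
- move=> u cu i p; apply: (@continuous_comp _ _ _ (cb \o u) (F i)).
    by apply: continuous_comp; [exact: cu|exact: cb_c].
  apply: differentiable_continuous; apply: (F1 i).1; exact: (rP _ (cb_r _)).1.
- by move=> i _ _ z z'; exact: Fcb.
- move=> i _ _; rewrite cb_id ?subrr ?normr0 ?(ltW r0)//.
  by rewrite (bigD1 i)//= lerDl sumr_ge0.
have u00 : u (0, 0) = u0.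
  by apply/rowP => i; have [bi|bi] := boolP (b i); [exact: u3|exact: u4].
have /cvgrPdist_le/(_ _ r0) := uc (0, 0).
case=> -[A B] /= [A0 B0] AB.
have [d1 /= d10 d1A] := (nbhs_ballP _ _).1 A0.
have [d2 /= d20 d2B] := (nbhs_ballP _ _).1 B0.
(* By continuity at the origin, where its value is [u0], the solution stays within [r] of [u0] on
   this square, and the clamp is the identity there. *)
exists (Num.min d1 d2); first by rewrite lt_min d10.
exists u.
have ur p : square (Num.min d1 d2) p -> `|u0 - u p| <= r.
  case: p => s t [/=]; rewrite !lt_min => /andP[sd _] /andP[_ td].
  rewrite -u00; apply: (AB (s, t)); split => /=; [apply: d1A|apply: d2B];
    by rewrite -ball_normE /ball_/= sub0r normrN.
split.
- by move=> p sp; split; [exact: (rP _ (ur _ sp)).1|exact: uc].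
- by move=> i s t sp bi; have := u1 i s t bi; rewrite cb_id// ur.
- by move=> i s t sp bi; have := u2 i s t bi; rewrite cb_id// ur.
- by move=> i s _; exact: u3.
- by move=> i t _; exact: u4.
Unshelve. all: by end_near. Qed.

Lemma derive_on_plane0 (h : R * R -> R) z :
  'D_('e_ord0) (on_plane h) z = 'D_1 (fun s => h (s, z ord0 ord_max)) (z ord0 ord0).
Proof.
rewrite /derive; set f := (X in lim (X @ _) = _); set g := (X in _ = lim (X @ _)).
suff -> : f = g by [].
by apply/funext => a; rewrite /f /g /= /on_plane !mxE /= mulr0 add0r.
Qed.

Lemma derive_on_plane1 (h : R * R -> R) z :
  'D_('e_ord_max) (on_plane h) z = 'D_1 (fun t => h (z ord0 ord0, t)) (z ord0 ord_max).
Proof.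
rewrite /derive; set f := (X in lim (X @ _) = _); set g := (X in _ = lim (X @ _)).
suff -> : f = g by [].
by apply/funext => a; rewrite /f /g /= /on_plane !mxE /= mulr0 add0r.
Qed.

(** The form in which the existence and smoothness results are applied below, with directional
    derivatives on row vectors. *)
Theorem char_system N (b : 'I_N -> bool) (O : set 'rV[R]_N) F u0 :
  open O -> O u0 -> (forall i k, is_Ck k O (F i)) ->
  exists2 d, 0 < d & exists U : 'rV[R]_2 -> 'rV[R]_N,
  [/\ forall i k, is_Ck k (square2 d) (fun z => U z ord0 i),
    forall z, square2 d z -> O (U z),
    forall i z, square2 d z ->
      'D_('e_(if b i then ord_max else ord0)) (fun z => U z ord0 i) z = F i (U z) &
    forall i z, square2 d z -> z ord0 (if b i then ord_max else ord0) = 0 ->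
      U z ord0 i = u0 ord0 i].
Proof.
move=> oO Ou0 Fs; have [d d0 [u sol]] := char_solution_exists b oO Ou0 (fun i => Fs i 1%N).
exists d => //; exists (fun z => u (z ord0 ord0, z ord0 ord_max)).
have [u1 u2 u3 u4 u5] := sol; split.
- by move=> i k; exact: (char_solution_smooth k oO Fs sol i).
- by move=> z sz; have [] := u1 _ sz.
- move=> i z sz; case: (boolP (b i)) => bi.
    rewrite (derive_on_plane1 (fun q => u q ord0 i)).
    by have [_ ->] := u2 i _ _ sz bi.
  rewrite (derive_on_plane0 (fun q => u q ord0 i)).
  by have [_ ->] := u3 i _ _ sz bi.
- move=> i z [/= s0 t0]; case: (boolP (b i)) => bi ->; [exact: u4|exact: u5].
Qed.

End Existence.

(** * Inverse function theorem *)

Section SmoothMatrix.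
Context {R : realType} {V : normedModType R}.
Implicit Types (O : set V).

Lemma is_Ck_prod k O n (f : 'I_n -> V -> R) : open O ->
  (forall i, is_Ck k O (f i)) -> is_Ck k O (fun x => \prod_i f i x).
Proof.
move=> oO; elim: n f => [|n IH] f Cf.
  by apply: (is_Ck_eq (f := fun _ : V => (1 : R))) => //; [by move=> x _; rewrite big_ord0|exact: is_Ck_cst].
apply: (is_Ck_eq (f := fun x => f ord0 x * \prod_i f (lift ord0 i) x)) => //.
  by move=> x _; rewrite big_ord_recl.
by apply: is_CkM => //; exact: IH.
Qed.

Lemma is_Ck_big k O (I : Type) (r : seq I) (f : I -> V -> R) : open O ->
  (forall i, is_Ck k O (f i)) -> is_Ck k O (fun x => \sum_(i <- r) f i x).
Proof.
move=> oO Cf; elim: r => [|i r IH].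
  by apply: (is_Ck_eq (f := fun _ : V => (0 : R))) => //; [by move=> x _; rewrite big_nil|exact: is_Ck_cst].
apply: (is_Ck_eq (f := fun x => f i x + \sum_(i <- r) f i x)) => //.
  by move=> x _; rewrite big_cons.
exact: is_CkD.
Qed.

Lemma is_Ck_det k O n (M : V -> 'M[R]_n) : open O ->
  (forall i j, is_Ck k O (fun x => M x i j)) -> is_Ck k O (fun x => \det (M x)).
Proof.
move=> oO CM; apply: is_Ck_big => // s; apply: is_CkM => //; first exact: is_Ck_cst.
by apply: is_Ck_prod => // j; exact: CM.
Qed.

Lemma is_Ck_invmx k O n (M : V -> 'M[R]_n) : open O ->
  (forall x, O x -> \det (M x) != 0) ->
  (forall i j, is_Ck k O (fun x => M x i j)) ->
  forall i j, is_Ck k O (fun x => invmx (M x) i j).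
Proof.
move=> oO M0 CM i j.
apply: (is_Ck_eq (f := fun x => (\det (M x))^-1 * cofactor (M x) j i)) => //.
  by move=> x Ox; rewrite /invmx unitmxE unitfE M0// !mxE.
apply: is_CkM => //.
  by apply: is_CkV => //; exact: is_Ck_det.
apply: is_CkM => //; first exact: is_Ck_cst.
apply: is_Ck_det => // a b.
by apply: (is_Ck_eq (f := fun x => M x (lift j a) (lift i b))) => // x _; rewrite !mxE.
Qed.

End SmoothMatrix.

Section InverseFunction.
Context {R : realType}.

Lemma geometric_le0 (x c : R) : (forall n, x <= c * 2^-1 ^+ n) -> x <= 0.
Proof.
move=> H; rewrite leNgt; apply/negP => x0.
have c0 : 0 <= c by have := H 0%N; rewrite expr0 mulr1; apply: le_trans; exact: ltW.
have /archi_boundP : 0 <= c / x by rewrite divr_ge0// ltW.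
move: (Num.Def.archi_bound _) => n An.
have n2 : n%:R <= 2 ^+ n :> R by rewrite -natrX ler_nat ltnW// ltn_expl.
have := H n; rewrite exprVn ler_pdivlMr ?exprn_gt0// leNgt => /negP; apply.
by rewrite mulrC -ltr_pdivrMr// (lt_le_trans An).
Qed.

(** [T] contracts only on the ball, but the orbit of [z0] drifts by at most
    [c + c / 2 + c / 4 + ...], which is at most [2 * c <= rho], so it never leaves the ball. *)
Lemma contraction_fixpoint n (T : 'rV[R]_n -> 'rV[R]_n) z0 rho :
  (forall z z', `|z0 - z| <= rho -> `|z0 - z'| <= rho -> `|T z - T z'| <= `|z - z'| / 2) ->
  `|T z0 - z0| <= rho / 2 ->
  exists2 z, `|z0 - z| <= rho & T z = z.
Proof.
move=> Tc T0; set c := `|T z0 - z0|; have c0 : 0 <= c by exact: normr_ge0.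
pose s m := iter m T z0.
have q0 m : 0 <= c * 2^-1 ^+ m by rewrite mulr_ge0// exprn_ge0// invr_ge0.
have sP m : `|z0 - s m| <= 2 * c - 2 * (c * 2^-1 ^+ m) /\ `|s m.+1 - s m| <= c * 2^-1 ^+ m.
  elim: m => [|m [IH1 IH2]]; first by rewrite expr0 mulr1 subrr normr0 subrr.
  have b1 : `|z0 - s m.+1| <= 2 * c - 2 * (c * 2^-1 ^+ m.+1).
    rewrite -(subrKA (s m)) (le_trans (ler_normD _ _))// (le_trans (lerD IH1 (lexx _)))//.
    rewrite [`|s m - _|]distrC (le_trans (lerD (lexx _) IH2))// exprS.
    have -> : c * (2^-1 * 2^-1 ^+ m) = c * 2^-1 ^+ m / 2 by field.
    by have := q0 m; lra.
  split=> //; apply: le_trans (Tc _ _ _ _) _.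
  - by rewrite (le_trans b1)//; have := q0 m.+1; move: T0; rewrite -/c; lra.
  - by rewrite (le_trans IH1)//; have := q0 m; move: T0; rewrite -/c; lra.
  - have -> : c * 2^-1 ^+ m.+1 = c * 2^-1 ^+ m / 2 by rewrite exprS; field.
    by rewrite ler_pM2r// invr_gt0.
have sr m : `|z0 - s m| <= rho.
  by have [H _] := sP m; rewrite (le_trans H)//; have := q0 m; move: T0; rewrite -/c; lra.
have /choice[l lP] : forall i, exists l, forall m, `|s m ord0 i - l| <= 2 * c * 2^-1 ^+ m.
  move=> i; apply: geometric_limit => m; have [_ H] := sP m.
  by rewrite (le_trans _ H)//; have := rV_coord_le (s m.+1 - s m) i; rewrite !mxE.
pose z : 'rV[R]_n := \row_i l i.
have sz m : `|s m - z| <= 2 * c * 2^-1 ^+ m.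
  apply/rV_norm_leP => [|i]; first by rewrite -mulrA mulr_ge0.
  by rewrite !mxE.
have zr : `|z0 - z| <= rho.
  rewrite -subr_le0; apply: (@geometric_le0 _ (2 * c)) => m.
  rewrite lerBlDr -(subrKA (s m)) (le_trans (ler_normD _ _))// addrC lerD//.
exists z => //; apply/eqP; rewrite -subr_eq0 -normr_le0.
apply: (@geometric_le0 _ (2 * c)) => m.
rewrite -(subrKA (s m.+1)) (le_trans (ler_normD _ _))//.
have H1 : `|T z - s m.+1| <= 2 * c * 2^-1 ^+ m / 2.
  by rewrite (le_trans (Tc _ _ zr (sr m)))// ler_pM2r ?invr_gt0// distrC.
rewrite (le_trans (lerD H1 (sz m.+1)))// exprS.
by rewrite le_eqVlt; apply/orP; left; apply/eqP; field.
Qed.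

(** Rows index the directions and columns the components, so the differential acts on row vectors by
    multiplication on the right. Eigenvectors below are therefore left eigenvectors of this
    matrix. *)
Definition jac n m (G : 'rV[R]_n -> 'rV[R]_m) z : 'M[R]_(n, m) :=
  \matrix_(i, j) 'D_('e_i) (fun z => G z ord0 j) z.

Lemma diff_jac n m (G : 'rV[R]_n -> 'rV[R]_m) z v : differentiable G z ->
  'd G z v = v *m jac G z.
Proof.
move=> dG; apply/rowP => j; rewrite -deriveE// derive_rV// mxE.
rewrite derive_rV_sum; last exact: (differentiable_rVP _ _).1.
by apply: eq_bigr => i _; rewrite mxE.
Qed.

Lemma mulmx_lip n m (M : 'M[R]_(n, m)) : exists2 C, 0 < C &
  forall v : 'rV[R]_n, `|v *m M| <= C * `|v|.
Proof.
pose C := \sum_k \sum_j `|M k j| + 1.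
have C0 : 0 < C by rewrite ltr_wpDl// sumr_ge0// => k _; rewrite sumr_ge0.
exists C => // v; apply/rV_norm_leP => [|j]; first by rewrite mulr_ge0// ltW.
rewrite mxE (le_trans (ler_norm_sum _ _ _))//.
apply: (@le_trans _ _ (\sum_k \sum_j `|M k j| * `|v|)).
  apply: ler_sum => k _; rewrite normrM mulrC (bigD1 j)//= -[leLHS]addr0 lerD//.
    by rewrite ler_wpM2l// rV_coord_le.
  by rewrite sumr_ge0// => ? _; rewrite mulr_ge0.
under eq_bigr do rewrite -mulr_suml.
by rewrite -mulr_suml ler_wpM2r// lerDl.
Qed.

Lemma mulmx_continuous n m (M : 'M[R]_(n, m)) :
  continuous (fun v : 'rV[R]_n => v *m M).
Proof.
move=> v; apply/(@cvg_rVP R m _ _ (nbhs_filter v) (fun v => v *m M) (v *m M)) => j.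
under eq_fun do rewrite mxE; rewrite mxE; apply: cvg_sum_ord => k.
exact: (cvgM (@coord_continuous R 1 n ord0 k v) (cvg_cst _)).
Qed.

Lemma nbhs_ball_le (V : normedModType R) (x : V) (P : set V) : nbhs x P ->
  exists2 r : R, 0 < r & forall y, `|x - y| <= r -> P y.
Proof.
move=> /nbhs_normP[r /= r0 rP]; exists (r / 2); first by rewrite divr_gt0.
move=> y xy; apply: rP; rewrite /= (le_lt_trans xy)//.
by rewrite ltr_pdivrMr// ltr_pMr// ltr1n.
Qed.

Lemma nbhs_ball_lt (V : normedModType R) (x : V) (P : set V) (r : R) : 0 < r ->
  (forall y, `|x - y| < r -> P y) -> nbhs x P.
Proof. by move=> r0 rP; have : \near x, P x by apply/nbhs_normP; exists r. Qed.

Section Local.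
Variables (n : nat) (O : set 'rV[R]_n) (G : 'rV[R]_n -> 'rV[R]_n) (z0 : 'rV[R]_n).
Hypotheses (oO : open O) (Oz0 : O z0) (Gs : forall k, is_Ck k O G).
Hypothesis J0 : \det (jac G z0) != 0.

Let Gc i k : is_Ck k O (fun z => G z ord0 i).
Proof. exact: ((is_Ck_rVP k G oO).1 (Gs k) i). Qed.

Let jac_smooth k i j : is_Ck k O (fun z => jac G z i j).
Proof.
apply: (is_Ck_eq (f := 'D_('e_i) (fun z => G z ord0 j))) => //.
  by move=> z _; rewrite mxE.
exact: (Gc j k.+1).2.
Qed.

(* [r] is the Lipschitz-small remainder of [G] after normalising its derivative at [z0] to the identity. *)
Let P := invmx (jac G z0).
Let r z := z - G z *m P.

Let J0u : jac G z0 \in unitmx. Proof. by rewrite unitmxE unitfE. Qed.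

Let r_smooth k j : is_Ck k O (fun z => r z ord0 j).
Proof.
apply: (is_Ck_eq (f := fun z : 'rV[R]_n => (z ord0 j - \sum_l G z ord0 l * P l j : R))) => //.
  by move=> z _; rewrite /r !mxE.
apply: is_CkB => //; first exact: is_Ck_coord.
apply: is_Ck_sum => // l; apply: is_CkM => //; exact: is_Ck_cst.
Qed.

Let r_small (e : R) : 0 < e -> \forall z \near z0, forall ij : 'I_n * 'I_n,
  `|'D_('e_ij.1) (fun z => r z ord0 ij.2) z| <= e.
Proof.
move=> e0.
have r0 i j : 'D_('e_i) (fun z => r z ord0 j) z0 = 0.
  have dc : is_derive z0 'e_i (fun z : 'rV[R]_n => z ord0 j) (('e_i : 'rV[R]_n) ord0 j).
    split; first by apply: diff_derivable; exact: differentiable_coord.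
    have E : ('D_('e_i) id z0) ord0 j = 'D_('e_i) (fun z : 'rV[R]_n => z ord0 j) z0.
      exact: (derive_rV (f := id)).
    by apply: etrans (esym E) _; rewrite (@derive_id R 'rV[R]_n).
  have dg l : is_derive z0 'e_i (fun z => G z ord0 l) (jac G z0 i l).
    rewrite mxE; apply: derivableP; apply: diff_derivable; exact: (Gc l 1).1.
  have -> : (fun z => r z ord0 j) = (fun z : 'rV[R]_n => z ord0 j) - \sum_l (P l j \*: fun z => G z ord0 l).
    apply/funext => z; rewrite /r !mxE -[RHS]/(_ - _) fct_sumE; congr (_ - _).
    by apply: eq_bigr => l _; rewrite mulrC.
  have [_ ->] := is_deriveB dc (is_derive_sum (fun l => is_deriveZ (P l j) (dg l))).
  have -> : \sum_l P l j *: jac G z0 i l = (jac G z0 *m P) i j.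
    by rewrite mxE; apply: eq_bigr => l _; rewrite -[_ *: _]/(_ * _) mulrC.
  by rewrite mulmxV// !mxE eqxx/= eq_sym subrr.
near=> z => ij; move: ij; near: z; apply: filter_forall => -[i j] /=.
have c : {for z0, continuous ('D_('e_i) (fun z => r z ord0 j))} := (r_smooth 1 j).2 'e_i z0 Oz0.
have /cvgrPdist_le/(_ _ e0) := c; apply: filterS => z.
by rewrite r0 sub0r normrN.
Unshelve. all: by end_near. Qed.

Let local_ball : exists2 rho, 0 < rho & forall z, `|z0 - z| <= rho ->
  [/\ O z, \det (jac G z) != 0 &
    forall z', `|z0 - z'| <= rho -> `|r z - r z'| <= `|z - z'| / 2].
Proof.
(* The mean value theorem adds [n] terms, each at most [e] times the distance, which keeps the
   Lipschitz constant of [r] below one half. *)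
pose e : R := (2 * (n%:R + 1))^-1.
have n1 : 0 < n%:R + 1 :> R by rewrite ltr_wpDl.
have e0 : 0 < e by rewrite invr_gt0 mulr_gt0.
have nO : nbhs z0 O by exact: open_nbhs_nbhs.
have nJ : \forall z \near z0, \det (jac G z) != 0.
  have c : {for z0, continuous (fun z => \det (jac G z))}.
    by apply: (@is_Ck_continuous R _ _ 0 O) => //; apply: is_Ck_det => // i j; exact: jac_smooth.
  have J0' : 0 < `|\det (jac G z0)| by rewrite normr_gt0.
  have /cvgrPdist_lt/(_ _ J0') := c; apply: filterS => z.
  by apply: contraTneq => ->; rewrite subr0 ltxx.
have [rho rho0 rhoP] := nbhs_ball_le (filterI nO (filterI nJ (r_small e0))).
exists rho => // z zr; have [Oz [Jz _]] := rhoP z zr; split=> // z' z'r.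
apply/rV_norm_leP => [|j]; first by rewrite divr_ge0.
have [|a a01] := @MVT_rV R n (fun z => r z ord0 j) z' z.
  move=> a a01; apply: (r_smooth 1 j).1.
  by have [] := rhoP _ (ball_segment z'r zr a01).
have -> : (r z - r z') ord0 j = r z ord0 j - r z' ord0 j.
  by rewrite [LHS]mxE [X in _ + X = _]mxE.
move=> ->; have [_ [_ H]] := rhoP _ (ball_segment z'r zr a01).
rewrite (le_trans (ler_norm_sum _ _ _))//.
apply: (@le_trans _ _ (\sum_(k < n) `|z - z'| * e)).
  apply: ler_sum => k _; rewrite normrM ler_pM//; last exact: (H (k, j)).
  by have := rV_coord_le (z - z') k; rewrite !mxE.
rewrite sumr_const card_ord -mulrnAr ler_wpM2l// -[leLHS]mulr_natl /e.
by rewrite ler_pdivrMr ?mulr_gt0// mulrA mulVf// mul1r lerDl.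
Qed.

(** With [K z = z - r z], solving [K z = w] is a fixed point problem for [w + r z], a contraction.
    [A] is the part of the ball that [K] sends into a small ball [W], so its image under [G] is
    exactly the preimage of [W] under a linear map, and is open for that reason. *)
Theorem inverse_function : exists A H, [/\ open A, A z0, A `<=` O,
  open (G @` A) & [/\ forall k, is_Ck k (G @` A) H,
    forall z, A z -> H (G z) = z & forall z, A z -> \det (jac G z) != 0]].
Proof.
have [rho rho0 rhoP] := local_ball.
pose K z := G z *m P.
have rK z : K z = z - r z by rewrite /r /K opprB addrC subrK.
have Kc z : O z -> {for z, continuous K}.
  move=> Oz; apply: (@continuous_comp _ _ _ G (fun v => v *m P)).
    exact: is_Ck_continuous (Gs 0) z Oz.
  exact: mulmx_continuous.
have Kinj z z' : `|z0 - z| <= rho -> `|z0 - z'| <= rho -> `|z - z'| <= 2 * `|K z - K z'|.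
  move=> zr z'r; have [_ _ /(_ z' z'r) H] := rhoP z zr.
  have : `|z - z'| <= `|K z - K z'| + `|r z - r z'|.
    have -> : z - z' = (K z - K z') + (r z - r z').
      by rewrite !rK; move: (r z) (r z') => a c; apply/rowP => j; rewrite !mxE; ring.
    exact: ler_normD.
  by lra.
have nb : \forall z \near z0, `|z0 - z| < rho.
  by apply/nbhs_normP; exists rho.
pose W := [set w | `|K z0 - w| < rho / 2].
pose A := [set z | `|z0 - z| < rho /\ W (K z)].
pose B := [set y : 'rV[R]_n | W (y *m P)].
have WO (w : 'rV[R]_n) : W w -> nbhs w W.
  move=> Ww; apply: (@nbhs_ball_lt _ _ _ (rho / 2 - `|K z0 - w|)); first by rewrite subr_gt0.
  move=> w' ww'; rewrite /W /= -(subrKA w) (le_lt_trans (ler_normD _ _))//.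
  by rewrite addrC -ltrBrDr.
have AO : A `<=` O by move=> z [/ltW zr _]; have [] := rhoP z zr.
have oA : open A.
  rewrite openE => z Az; have [zr Wz] := Az; apply: filterI.
    apply: (@nbhs_ball_lt _ _ _ (rho - `|z0 - z|)); first by rewrite subr_gt0.
    move=> w' ww'; rewrite /= -(subrKA z) (le_lt_trans (ler_normD _ _))//.
    by rewrite addrC -ltrBrDr.
  exact: (Kc z (AO z Az) _ (WO _ Wz)).
have oB : open B.
  rewrite openE => y By.
  exact: (@mulmx_continuous _ _ P y _ (WO _ By)).
have GA : G @` A = B.
  apply/seteqP; split=> [_ [z [zr Wz] <-] //|y By].
  have [||z zr zfix] := @contraction_fixpoint n (fun z => y *m P + r z) z0 rho.
  - move=> z z' zr z'r; rewrite opprD addrACA subrr add0r.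
    by have [_ _] := rhoP z zr; apply.
  - have -> : y *m P + r z0 - z0 = y *m P - K z0.
      rewrite (rK z0); move: (r z0) (y *m P) => a p.
      by apply/rowP => j; rewrite !mxE; ring.
    by rewrite distrC ltW.
  have Kz : K z = y *m P by rewrite (rK z) -{1}zfix addrK.
  have Gz : G z = y.
    have := congr1 (fun v => v *m jac G z0) Kz.
    by rewrite /K /P !mulmxKV.
  exists z => //; split; last by rewrite Kz.
  (* The fixed point is known only in the closed ball. The strict bound [rho / 2] defining [W] and
     the factor one half for [r] place it in the open one. *)
  have H : `|z - z0| <= `|y *m P - K z0| + `|r z - r z0|.
    have -> : z - z0 = (y *m P - K z0) + (r z - r z0).
      rewrite -{1}zfix rK; move: (r z) (r z0) (y *m P) => a c p.
      by apply/rowP => j; rewrite !mxE; ring.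
    exact: ler_normD.
  have [_ _ /(_ z0) H2] := rhoP z zr; have := H2; rewrite subrr normr0 => /(_ (ltW rho0)) H3.
  have H4 : `|z - z0| <= `|y *m P - K z0| + `|z - z0| / 2 by rewrite (le_trans H)// lerD.
  have := By; rewrite /B /W /= distrC => H5.
  by rewrite distrC; lra.
have injA z z' : A z -> A z' -> G z = G z' -> z = z'.
  move=> [zr _] [z'r _] E; apply/eqP; rewrite -subr_eq0 -normr_le0.
  by rewrite (le_trans (Kinj z z' (ltW zr) (ltW z'r)))// /K E subrr normr0 mulr0.
pose H y := xget z0 [set z | A z /\ G z = y].
have HG z : A z -> H (G z) = z.
  move=> Az; have [A1 G1] : [set z' | A z' /\ G z' = G z] (H (G z)).
    by apply: (xgetPex z0); exists z.
  exact: injA.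
have GH y : (G @` A) y -> A (H y) /\ G (H y) = y.
  by move=> [z Az <-]; rewrite HG.
exists A, H; split=> //.
- by split=> //; rewrite /W /= ?subrr normr0 ?divr_gt0.
- by rewrite GA.
have [CP CP0 CPP] := mulmx_lip P.
have Hlip y y' : (G @` A) y -> (G @` A) y' -> `|H y - H y'| <= 2 * CP * `|y - y'|.
  move=> /GH[[h1 _] E1] /GH[[h2 _] E2]; rewrite (le_trans (Kinj _ _ (ltW h1) (ltW h2)))//.
  by rewrite /K E1 E2 -mulmxBl -mulrA ler_wpM2l.
have oGA : open (G @` A) by rewrite GA.
have Hd y : (G @` A) y -> differentiable H y /\
    'd H y = (fun v => v *m invmx (jac G (H y))) :> (_ -> _).
  move=> GAy; have [Az GHy] := GH y GAy; set z := H y in Az GHy *.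
  have Jz : \det (jac G z) != 0 by case: Az => /ltW zr _; have [] := rhoP z zr.
  have [C2 C20 C2P] := mulmx_lip (invmx (jac G z)).
  have dG := (Gs 1).1 z (AO z Az).
  apply: differentiable_linear_epsP.
  - by move=> a v w; rewrite mulmxDl scalemxAl.
  - exact: mulmx_continuous.
  - move=> e e0; pose C3 := C2 * (2 * CP).
    have C30 : 0 < C3 by rewrite !mulr_gt0.
    have eC : 0 < e / C3 by rewrite divr_gt0.
    have [r1 r10 r1P] := nbhs_ball_le (differentiable_eps dG eC).
    have n1 : \forall h \near (0 : 'rV[R]_n), (G @` A) (h + y).
      have : \near y, (G @` A) y by exact: (open_nbhs_nbhs (conj oGA GAy)).
      by rewrite (near_shift 0) subr0.
    have n2 : \forall h \near (0 : 'rV[R]_n), `|h| <= r1 / (2 * CP).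
      apply/nbhs_normP; exists (r1 / (2 * CP)); first by rewrite /= divr_gt0// mulr_gt0.
      by move=> h /=; rewrite sub0r normrN => /ltW.
    apply: filterS2 n1 n2 => h GAh hr.
    set k := H (h + y) - z.
    have kh : `|k| <= 2 * CP * `|h|.
      by rewrite (le_trans (Hlip _ _ GAh GAy))// addrK.
    have kr : `|0 - k| <= r1.
      by rewrite sub0r normrN (le_trans kh)// mulrC -ler_pdivlMr// mulr_gt0.
    have := r1P k kr; rewrite /= /k subrK (GH _ GAh).2 GHy addrK -/k diff_jac// => H1.
    (* The linearization error of [H] is minus that of [G] multiplied by the inverse Jacobian; the
       Lipschitz bound on [H] turns an error small relative to [k] into one small relative to
       [h]. *)
    have -> : k - h *m invmx (jac G z) = - ((h - k *m jac G z) *m invmx (jac G z)).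
      by rewrite mulmxBl mulmxK ?unitmxE ?unitfE// opprB.
    rewrite normrN (le_trans (C2P _))//.
    have -> : e * `|h| = C2 * (e / C3 * (2 * CP * `|h|)).
      by rewrite /C3; field; rewrite !gt_eqF.
    by rewrite ler_wpM2l ?(ltW C20)// (le_trans H1)// ler_wpM2l// ltW.
split=> [k||z [/ltW zr _]]; [|by []|by have [] := rhoP z zr].
elim: k => [|k IH].
  by move=> y /Hd[dH _]; exact: differentiable_continuous.
split=> [y /Hd[]//|v].
apply/is_Ck_rVP => // j.
(* The derivative of [H] is the inverse Jacobian of [G] evaluated along [H], so it has the order
   already known for [H]. *)
apply: (is_Ck_eq (f := fun y => (\sum_i v ord0 i * invmx (jac G (H y)) i j : R))) => //.
  by move=> y /Hd[dH dE]; rewrite deriveE// dE mxE.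
apply: is_Ck_sum => // i; apply: is_CkM => //; first exact: is_Ck_cst.
apply: (is_Ck_comp (P := A) (f := H) (g := fun z => invmx (jac G z) i j)) => //.
  by move=> y /GH[].
apply: is_Ck_invmx => //.
  by move=> z [/ltW zr _]; have [] := rhoP z zr.
by move=> a b; apply: is_Ck_sub AO _; exact: jac_smooth.
Qed.

End Local.
End InverseFunction.

(** * Potentials and characteristic coordinates *)

Section PlaneCalculus.
Context {R : realType}.

(** The coefficients are bounded on a compact segment around [x]; the Gronwall bound for systems
    then holds with inhomogeneity [e / M] for every positive [e]. *)
Lemma linear_ode_zero N (y : 'I_N -> R -> R) (A : 'I_N -> 'I_N -> R -> R) d :
  (forall i j (x : R), `|x| < d -> {for x, continuous (A i j)}) ->
  (forall i (x : R), `|x| < d -> is_derive x 1 (y i) (\sum_j A i j x * y j x)) ->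
  (forall i, y i 0 = 0) -> forall i x, `|x| < d -> y i x = 0.
Proof.
move=> cA dy y0 i x xd.
have [T [T0 Td xT _]] := @square_sub R d x x (conj xd xd).
have /choice[B BP] : forall ij : 'I_N * 'I_N, exists B, 0 <= B /\
    forall t, `|t| <= T -> `|A ij.1 ij.2 t| <= B.
  move=> [a b] /=.
  have TT : - T <= T by rewrite (le_trans _ (ltW T0))// oppr_le0 ltW.
  have [|c _ cP] := @EVT_max R (fun t => `|A a b t|) (- T) T TT.
    apply: continuous_in_subspaceT => t; rewrite inE/= in_itv/= -ler_norml => tT.
    apply: (@continuous_comp _ _ _ (A a b) Num.norm); last exact: norm_continuous.
    by apply: cA; exact: le_lt_trans Td.
  exists `|A a b c|; split=> // t; rewrite ler_norml => tT.
  by apply: cP; rewrite in_itv.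
pose C := \sum_ij B ij.
have C0 : 0 <= C by apply: sumr_ge0 => ij _; exact: (BP ij).1.
have [M M0 MP] := gronwall_system N C0 (ltW T0).
apply/eqP; rewrite -normr_le0; apply/ler_addgt0Pr => e e0; rewrite add0r.
have -> : e = e / M * M by rewrite divfK// gt_eqF.
apply: (MP y (fun i x => \sum_j A i j x * y j x)) => //.
- by rewrite divr_gt0.
- by move=> a t tT; apply: dy; exact: le_lt_trans Td.
- move=> a t tT; rewrite mulrDr -[leLHS]addr0 lerD//; last first.
    by rewrite mulr_ge0// divr_ge0// ltW.
  rewrite (le_trans (ler_norm_sum _ _ _))// mulr_sumr; apply: ler_sum => j _.
  rewrite normrM ler_wpM2r// (le_trans ((BP (a, j)).2 t tT))// /C (bigD1 (a, j))//= lerDl.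
  by apply: sumr_ge0 => ij _; exact: (BP ij).1.
- exact: ltW.
Qed.

(** Projection along ['e_c] onto the axis that carries the data: every point of a square is reached
    from its projection along a line inside the square. *)
Definition erase (c : 'I_2) (z : 'rV[R]_2) : 'rV[R]_2 := z - z ord0 c *: 'e_c.

Lemma square2P d (z : 'rV[R]_2) : square2 d z <-> forall c, `|z ord0 c| < d.
Proof.
split=> [[/= z0 z1] c|H]; last by split; exact: H.
by case: (unliftP ord0 c) => [j ->|->//]; rewrite (ord1 j) (_ : lift _ _ = ord_max)//; exact: val_inj.
Qed.

Lemma plane_line d c (z : 'rV[R]_2) a : square2 d z -> `|a| < d ->
  square2 d (erase c z + a *: 'e_c).
Proof.
move=> /square2P zd ad; apply/square2P => j; rewrite /erase !mxE eqxx/=.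
have [->|_] := eqVneq j c; first by rewrite mulr1 subrr add0r mulr1.
by rewrite !mulr0 subr0 addr0.
Qed.

(** Uniqueness is applied on each line parallel to ['e_c]. It serves to propagate identities that
    hold on an axis to the whole square. *)
Lemma plane_ode_zero d c N (y : 'I_N -> 'rV[R]_2 -> R) (A : 'I_N -> 'I_N -> 'rV[R]_2 -> R) :
  (forall i j z, square2 d z -> {for z, continuous (A i j)}) ->
  (forall i, is_Ck 1 (square2 d) (y i)) ->
  (forall i z, square2 d z -> 'D_('e_c) (y i) z = \sum_j A i j z * y j z) ->
  (forall i z, square2 d z -> z ord0 c = 0 -> y i z = 0) ->
  forall i z, square2 d z -> y i z = 0.
Proof.
move=> cA Cy dy y0 i z sz; have /square2P zd := sz.
pose l (a : R) := erase c z + a *: 'e_c.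
have lz : z = l (z ord0 c) by rewrite /l /erase subrK.
rewrite lz.
apply: (@linear_ode_zero N (fun i a => y i (l a)) (fun i j a => A i j (l a)) d) => //.
- move=> a b x xd; apply: (@continuous_comp _ _ _ l (A a b)).
    apply: cvgD; first exact: cvg_cst.
    by apply: cvgZl; exact: cvg_id.
  by apply: cA; exact: plane_line.
- move=> a x xd; rewrite -dy; last exact: plane_line.
  apply: is_derive_line; apply: derivableP; apply: diff_derivable.
  by apply: (Cy a).1; exact: plane_line.
- move=> a; apply: y0.
    by apply: plane_line => //; rewrite normr0 (le_lt_trans _ (zd c)).
  by rewrite /l /erase !mxE !eqxx/= mulr1 subrr mul0r addr0.
Qed.

Lemma plane_derive0 d c (y : 'rV[R]_2 -> R) : is_Ck 1 (square2 d) y ->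
  (forall z, square2 d z -> 'D_('e_c) y z = 0) ->
  (forall z, square2 d z -> z ord0 c = 0 -> y z = 0) ->
  forall z, square2 d z -> y z = 0.
Proof.
move=> Cy dy y0 z sz.
have cA (i j : 'I_1) w : square2 d w -> {for w, continuous (fun _ : 'rV[R]_2 => 0 : R)}.
  by move=> _; exact: (@cst_continuous _ _ (0 : R) w).
apply: (@plane_ode_zero d c 1 (fun=> y) (fun _ _ _ => 0) cA (fun=> Cy) _ (fun=> y0) ord0 z sz).
by move=> _ w sw; rewrite big_ord1 mul0r dy.
Qed.

Lemma plane_ode_zero2 d c (y1 y2 a11 a12 a21 a22 : 'rV[R]_2 -> R) :
  is_Ck 0 (square2 d) a11 -> is_Ck 0 (square2 d) a12 ->
  is_Ck 0 (square2 d) a21 -> is_Ck 0 (square2 d) a22 ->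
  is_Ck 1 (square2 d) y1 -> is_Ck 1 (square2 d) y2 ->
  (forall z, square2 d z -> 'D_('e_c) y1 z = a11 z * y1 z + a12 z * y2 z) ->
  (forall z, square2 d z -> 'D_('e_c) y2 z = a21 z * y1 z + a22 z * y2 z) ->
  (forall z, square2 d z -> z ord0 c = 0 -> y1 z = 0 /\ y2 z = 0) ->
  forall z, square2 d z -> y1 z = 0 /\ y2 z = 0.
Proof.
move=> c11 c12 c21 c22 cy1 cy2 d1 d2 y0 z sz.
pose y (i : 'I_2) := if i == ord0 then y1 else y2.
pose A (i j : 'I_2) := if i == ord0 then (if j == ord0 then a11 else a12)
  else (if j == ord0 then a21 else a22).
have cA i j w : square2 d w -> {for w, continuous (A i j)}.
  by rewrite /A; case: ifP => _; case: ifP => _; move: w.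
have cy i : is_Ck 1 (square2 d) (y i) by rewrite /y; case: ifP.
have dy i w : square2 d w -> 'D_('e_c) (y i) w = \sum_j A i j w * y j w.
  move=> sw; rewrite big_ord_recl big_ord1 /A /y /=.
  by case: ifP => _; [exact: d1|exact: d2].
have yb i w : square2 d w -> w ord0 c = 0 -> y i w = 0.
  by move=> sw wc; have [y10 y20] := y0 w sw wc; rewrite /y; case: ifP.
have H i := @plane_ode_zero d c 2 y A cA cy dy yb i z sz.
by split; [exact: (H ord0)|exact: (H ord_max)].
Qed.

Lemma derive_indep (V W : normedModType R) (f : V -> W) z v :
  (forall h : R, f (h *: v + z) = f z) -> 'D_v f z = 0.
Proof.
move=> H; rewrite /derive; set g := (X in lim (X @ _)).
rewrite (_ : g = fun=> 0); first by apply: cvg_lim => //; exact: cvg_cst.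
by apply/funext => h; rewrite /g /= H subrr scaler0.
Qed.

(** ['e_c'] is tangent to the axis on which [y] is constant. This supplies the zero data for
    equations satisfied by derivatives. *)
Lemma plane_derive_boundary d c c' (y : 'rV[R]_2 -> R) k : c != c' ->
  (forall z, square2 d z -> z ord0 c = 0 -> y z = k) ->
  forall z, square2 d z -> z ord0 c = 0 -> 'D_('e_c') y z = 0.
Proof.
move=> cc y0 z sz zc.
have n : \forall h \near (0 : R)^', h^-1 *: ((y \o shift z) (h *: 'e_c') - y z) = 0.
  have : \forall h \near (0 : R), square2 d (h *: 'e_c' + z).
    have cl : (fun h : R => h *: ('e_c' : 'rV[R]_2) + z) @ (0 : R) --> (0 : R) *: ('e_c' : 'rV[R]_2) + z.
      by apply: cvgD; [apply: cvgZl; exact: cvg_id|exact: cvg_cst].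
    apply: cl; rewrite scale0r add0r.
    by apply: open_nbhs_nbhs; split=> //; exact: square2_open.
  move=> /nbhs_dnbhs; apply: filterS => h sh.
  rewrite /= (y0 z)// y0 ?subrr ?scaler0//.
  by rewrite !mxE (negbTE cc) /= mulr0 add0r.
by apply: cvg_lim => //; apply: cvg_near_cst; exact: n.
Qed.

Definition pt (x y : R) : 'rV[R]_2 := \row_j if j == ord0 then x else y.

Lemma pt_eta (z : 'rV[R]_2) : pt (z ord0 ord0) (z ord0 ord_max) = z.
Proof.
apply/rowP => c; rewrite mxE; case: eqP => [->//|].
by case: (unliftP ord0 c) => [j ->|->//] _; rewrite (ord1 j); congr (z _ _); exact: val_inj.
Qed.

Lemma pt0 x y : pt x y ord0 ord0 = x. Proof. by rewrite mxE. Qed.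
Lemma pt1 x y : pt x y ord0 ord_max = y. Proof. by rewrite mxE. Qed.

Lemma is_Ck_pt (V : normedModType R) k (O : set V) (x y : V -> R) : open O ->
  is_Ck k O x -> is_Ck k O y -> is_Ck k O (fun z => pt (x z) (y z)).
Proof.
move=> oO Cx Cy; apply/is_Ck_rVP => // j.
apply: (is_Ck_eq (f := fun z => (if j == ord0 then x z else y z : R))) => //.
  by move=> z _; rewrite mxE.
by case: (j == ord0).
Qed.

Section DeriveRules.
Context {V : normedModType R}.
Implicit Types (f g : V -> R).

Lemma derD f g z v : differentiable f z -> differentiable g z ->
  'D_v (fun z => f z + g z) z = 'D_v f z + 'D_v g z.
Proof.
by move=> /(@diff_derivable _ _ _ f _ v) df /(@diff_derivable _ _ _ g _ v) dg; exact: (deriveD df dg).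
Qed.

Lemma derB f g z v : differentiable f z -> differentiable g z ->
  'D_v (fun z => f z - g z) z = 'D_v f z - 'D_v g z.
Proof.
by move=> /(@diff_derivable _ _ _ f _ v) df /(@diff_derivable _ _ _ g _ v) dg; exact: (deriveB df dg).
Qed.

Lemma derN f z v : differentiable f z -> 'D_v (fun z => - f z) z = - 'D_v f z.
Proof. by move=> /(@diff_derivable _ _ _ f _ v) df; exact: (deriveN df). Qed.

Lemma derM f g z v : differentiable f z -> differentiable g z ->
  'D_v (fun z => f z * g z) z = f z * 'D_v g z + g z * 'D_v f z.
Proof.
by move=> /(@diff_derivable _ _ _ f _ v) df /(@diff_derivable _ _ _ g _ v) dg; exact: (deriveM df dg).
Qed.

Lemma der_rV2 (g : 'rV[R]_2 -> R) (X : V -> 'rV[R]_2) z v :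
  differentiable X z -> differentiable g (X z) ->
  'D_v (fun z => g (X z)) z =
    'D_v (fun z => X z ord0 ord0) z * 'D_('e_ord0) g (X z) +
    'D_v (fun z => X z ord0 ord_max) z * 'D_('e_ord_max) g (X z).
Proof.
move=> dX dg; have := @derive_comp_rV R V R 2 X g z v dX dg.
rewrite big_ord_recl big_ord1 (_ : lift _ _ = ord_max) //; exact: val_inj.
Qed.

Lemma near_eq_der O f g z v : open O -> O z -> (forall w : V, O w -> f w = g w) ->
  'D_v f z = 'D_v g z.
Proof.
move=> oO Oz fg; apply: near_eq_derive.
by apply: filterS (open_nbhs_nbhs (conj oO Oz)) => w /fg.
Qed.

Lemma is_Ck_diff k O f z : O z -> is_Ck k.+1 O f -> differentiable f z.
Proof. by move=> Oz [H _]; exact: H. Qed.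

End DeriveRules.

Section Potential.
Variables (d : R) (a b : 'rV[R]_2 -> R).
Hypotheses (d0 : 0 < d) (sa : smooth_open (square2 d) a) (sb : smooth_open (square2 d) b).
Hypothesis closed_form : forall z, square2 d z -> 'D_('e_ord_max) a z = 'D_('e_ord0) b z.

Let o (k : nat) (H : (k < 4)%N) : 'I_4 := Ordinal H.
Let i0 : 'I_4 := @o 0 isT.
Let i1 : 'I_4 := @o 1 isT.
Let i2 : 'I_4 := @o 2 isT.
Let i3 : 'I_4 := @o 3 isT.

(* Components 0 and 2 reproduce the coordinates [s], [t]; the potential is the sum
   of component 1, which integrates [a (s, 0)], and component 3, which integrates
   [b (s, t)]. *)
Let F (i : 'I_4) (z : 'rV[R]_4) : R :=
  nth 0 [:: 1; a (pt (z ord0 i0) 0); 1; b (pt (z ord0 i0) (z ord0 i2))] i.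

(** The Poincaré lemma on a square. Obtaining the potential from a characteristic system yields its
    smoothness without differentiation under an integral sign, at the price of a possibly smaller
    square. *)
Lemma potential : exists d', 0 < d' <= d /\ exists h, [/\ smooth_open (square2 d') h,
  forall z, square2 d' z -> 'D_('e_ord0) h z = a z &
  forall z, square2 d' z -> 'D_('e_ord_max) h z = b z].
Proof.
pose O := [set z : 'rV[R]_4 | `|z ord0 i0| < d /\ `|z ord0 i2| < d].
have oO : open O.
  have cc (j : 'I_4) : open [set z : 'rV[R]_4 | `|z ord0 j| < d].
    apply: (@open_comp _ _ (fun z : 'rV[R]_4 => `|z ord0 j|) [set x : R | x < d]); last exact: open_lt.
    move=> z _; apply: (@continuous_comp _ _ _ (fun z : 'rV[R]_4 => z ord0 j) Num.norm).
      exact: (@coord_continuous R 1 4 ord0 j z).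
    exact: norm_continuous.
  exact: openI (cc i0) (cc i2).
have Fs i k : is_Ck k O (F i).
  have Cc j : is_Ck k O (fun z => z ord0 j) by exact: is_Ck_coord.
  have C0 : is_Ck k O (fun=> 0 : R) by exact: is_Ck_cst.
  case: i => -[|[|[|[|//]]]] Hi; rewrite /F /=; try exact: is_Ck_cst.
  - apply: (is_Ck_comp (P := square2 d)) (sa k) => //; last exact: is_Ck_pt.
    by move=> z [z0 _]; split; rewrite /= ?pt0 ?pt1 ?normr0.
  - apply: (is_Ck_comp (P := square2 d)) (sb k) => //; last exact: is_Ck_pt.
    by move=> z [z0 z2]; split; rewrite /= ?pt0 ?pt1.
have [|d1 d10 [U [Us UO Ud Ui]]] := @char_system R 4 (fun i => 2 <= i)%N O F 0 oO _ Fs.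
  by split; rewrite !mxE normr0.
exists (Num.min d1 d).
have sub1 : square2 (Num.min d1 d) `<=` square2 d1.
  by move=> z [/=]; rewrite !lt_min => /andP[? _] /andP[? _].
have subd : square2 (Num.min d1 d) `<=` square2 d.
  by move=> z [/=]; rewrite !lt_min => /andP[_ ?] /andP[_ ?].
split; first by rewrite lt_min d10 d0 ge_min lexx orbT.
set D := Num.min d1 d in sub1 subd *.
have so := @square2_open R D.
have {}Us (i : 'I_4) k : is_Ck k (square2 D) (fun z => U z ord0 i) by exact: is_Ck_sub sub1 (Us i k).
have {}Ud (i : 'I_4) z : square2 D z -> 'D_('e_(if (2 <= i)%N then ord_max else ord0)) (fun z => U z ord0 i) z = F i (U z).
  by move=> /sub1; exact: Ud.
have {}Ui (i : 'I_4) z : square2 D z -> z ord0 (if (2 <= i)%N then ord_max else ord0) = 0 -> U z ord0 i = 0.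
  by move=> /sub1 sz zc; rewrite Ui// mxE.
have saD k : is_Ck k (square2 D) a by exact: is_Ck_sub subd (sa k).
have sbD k : is_Ck k (square2 D) b by exact: is_Ck_sub subd (sb k).
have dcoord (c c' : 'I_2) z : 'D_('e_c) (fun z : 'rV[R]_2 => z ord0 c') z = ('e_c : 'rV[R]_2) ord0 c'.
  have E : ('D_('e_c) id z) ord0 c' = 'D_('e_c) (fun z : 'rV[R]_2 => z ord0 c') z.
    exact: (derive_rV (f := id)).
  by apply: etrans (esym E) _; rewrite (@derive_id R 'rV[R]_2).
have Ucoord (c : 'I_2) (i : 'I_4) : (forall z, square2 D z -> 'D_('e_c) (fun z => U z ord0 i) z = 1) ->
    (forall z, square2 D z -> z ord0 c = 0 -> U z ord0 i = 0) ->
    forall z, square2 D z -> U z ord0 i = z ord0 c.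
  move=> DU U0 z sz; apply/eqP; rewrite -subr_eq0; apply/eqP.
  apply: (@plane_derive0 D c (fun z => U z ord0 i - z ord0 c)) => //.
  - by apply: is_CkB => //; exact: is_Ck_coord.
  - move=> w sw; rewrite derB ?DU ?dcoord ?mxE ?eqxx/= ?subrr//.
      exact: (is_Ck_diff sw (Us i 1%N)).
    exact: differentiable_coord.
  - by move=> w sw w0; rewrite w0 subr0; exact: U0.
have U0 := @Ucoord ord0 i0 (Ud i0) (Ui i0).
have U2 := @Ucoord ord_max i2 (Ud i2) (Ui i2).
pose eta z := U z ord0 i1; pose zeta z := U z ord0 i3.
pose a0 (z : 'rV[R]_2) := a (pt (z ord0 ord0) 0).
have sq_pt z : square2 D z -> square2 D (pt (z ord0 ord0) 0).
  have D0 : 0 < D by rewrite /D lt_min d10.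
  by move=> [z0 _]; split; rewrite /= ?pt0 ?pt1 ?normr0.
have Ca0 k : is_Ck k (square2 D) a0.
  apply: (is_Ck_comp (P := square2 D) (f := fun z : 'rV[R]_2 => pt (z ord0 ord0) 0)) => //.
  apply: is_Ck_pt => //; [exact: is_Ck_coord|exact: is_Ck_cst].
have Dta0 z : 'D_('e_ord_max) a0 z = 0.
  by apply: derive_indep => h; rewrite /a0 !mxE/= mulr0 add0r.
have Dseta z : square2 D z -> 'D_('e_ord0) eta z = a0 z.
  by move=> sz; rewrite (Ud i1 z sz) /F /= U0.
have Dtzeta z : square2 D z -> 'D_('e_ord_max) zeta z = b z.
  by move=> sz; rewrite (Ud i3 z sz) /F /= U0// U2// pt_eta.
have Dteta z : square2 D z -> 'D_('e_ord_max) eta z = 0.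
  move: z; apply: (@plane_derive0 D ord0).
  - exact: (Us i1 2%N).2.
  - move=> z sz; rewrite (derive_swap _ _ so (Us i1 2%N) sz).
    by rewrite (near_eq_der _ so sz Dseta) Dta0.
  - by apply: plane_derive_boundary => // z; exact: (Ui i1).
(* This is where closedness enters: the difference of the two sides has zero [t]-derivative and
   vanishes on the axis [t = 0]. *)
have Dszeta z : square2 D z -> 'D_('e_ord0) zeta z = a z - a0 z.
  move=> sz; apply/eqP; rewrite -subr_eq0; apply/eqP; move: z sz.
  have Cz : is_Ck 1 (square2 D) ('D_('e_ord0) zeta) by exact: (Us i3 2%N).2.
  have Caa : is_Ck 1 (square2 D) (fun z => a z - a0 z).
    exact: (is_CkB so (saD 1%N) (Ca0 1%N)).
  apply: (@plane_derive0 D ord_max).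
  - exact: (is_CkB so Cz Caa).
  - move=> z sz; rewrite derB; [|exact: (is_Ck_diff sz Cz)|exact: (is_Ck_diff sz Caa)].
    rewrite derB; [|exact: (is_Ck_diff sz (saD 1%N))|exact: (is_Ck_diff sz (Ca0 1%N))].
    rewrite (derive_swap _ _ so (Us i3 2%N) sz) (near_eq_der _ so sz Dtzeta) Dta0 subr0.
    by rewrite closed_form ?subrr//; exact: subd.
  - move=> z sz z1.
    have -> : a0 z = a z by rewrite /a0 -[in RHS](pt_eta z) z1.
    by rewrite subrr subr0; apply: (@plane_derive_boundary D ord_max) => // w; exact: (Ui i3).
exists (fun z => eta z + zeta z); split.
- by move=> k; exact: (is_CkD so (Us i1 k) (Us i3 k)).
- move=> z sz; rewrite derD; [|exact: (is_Ck_diff sz (Us i1 1%N))|exact: (is_Ck_diff sz (Us i3 1%N))].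
  by rewrite Dseta// Dszeta// addrC subrK.
- move=> z sz; rewrite derD; [|exact: (is_Ck_diff sz (Us i1 1%N))|exact: (is_Ck_diff sz (Us i3 1%N))].
  by rewrite Dteta// Dtzeta// add0r.
Qed.

End Potential.
End PlaneCalculus.

(** * Coordinates adapted to a frame of vector fields *)

Section CharacteristicCoordinates.
Context {R : realType}.
Variables (A : set 'rV[R]_2) (x0 : 'rV[R]_2) (p1 p2 q1 q2 : 'rV[R]_2 -> R).
Hypotheses (oA : open A) (Ax0 : A x0).
Hypotheses (sp1 : smooth_open A p1) (sp2 : smooth_open A p2).
Hypotheses (sq1 : smooth_open A q1) (sq2 : smooth_open A q2).
Hypothesis frame : forall x, A x -> p1 x * q2 x - p2 x * q1 x != 0.

(** The derivative of [f] along the vector field [(r1, r2)]; the differences formed below are the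
    components of the Lie bracket of p and q. *)
Let along (r1 r2 f : 'rV[R]_2 -> R) x :=
  r1 x * 'D_('e_ord0) f x + r2 x * 'D_('e_ord_max) f x.

Let along_smooth r1 r2 f : smooth_open A r1 -> smooth_open A r2 -> smooth_open A f ->
  smooth_open A (along r1 r2 f).
Proof.
move=> s1 s2 sf k; have D v : is_Ck k A ('D_v f) := (sf k.+1).2 v.
exact: (is_CkD oA (is_CkM oA (s1 k) (D _)) (is_CkM oA (s2 k) (D _))).
Qed.

Let frame_coordinates (w1 w2 : 'rV[R]_2 -> R) : smooth_open A w1 -> smooth_open A w2 ->
  exists c1 c2 : 'rV[R]_2 -> R, [/\ smooth_open A c1, smooth_open A c2,
    forall x, A x -> w1 x = c1 x * p1 x + c2 x * q1 x &
    forall x, A x -> w2 x = c1 x * p2 x + c2 x * q2 x].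
Proof.
move=> s1 s2; pose D x := p1 x * q2 x - p2 x * q1 x.
have sD k : is_Ck k A (fun x => (D x)^-1).
  apply: is_CkV => //.
  exact: (is_CkB oA (is_CkM oA (sp1 k) (sq2 k)) (is_CkM oA (sp2 k) (sq1 k))).
exists (fun x => (w1 x * q2 x - w2 x * q1 x) * (D x)^-1).
exists (fun x => (w2 x * p1 x - w1 x * p2 x) * (D x)^-1); split.
- move=> k; exact: (is_CkM oA (is_CkB oA (is_CkM oA (s1 k) (sq2 k)) (is_CkM oA (s2 k) (sq1 k))) (sD k)).
- move=> k; exact: (is_CkM oA (is_CkB oA (is_CkM oA (s2 k) (sp1 k)) (is_CkM oA (s1 k) (sp2 k))) (sD k)).
- by move=> x Ax; rewrite /D; field; exact: frame.
- by move=> x Ax; rewrite /D; field; exact: frame.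
Qed.

Let i0 : 'I_8 := @Ordinal 8 0 isT.
Let i1 : 'I_8 := @Ordinal 8 1 isT.
Let i2 : 'I_8 := @Ordinal 8 2 isT.
Let i3 : 'I_8 := @Ordinal 8 3 isT.
Let i4 : 'I_8 := @Ordinal 8 4 isT.
Let i5 : 'I_8 := @Ordinal 8 5 isT.
Let i6 : 'I_8 := @Ordinal 8 6 isT.
Let i7 : 'I_8 := @Ordinal 8 7 isT.

(* Each unknown may be evolved in one direction only, so the point [x] is split as
   [base], evolved in [s] (and constant in [t], by uniqueness for linear equations),
   plus an increment evolved in [t]. *)
Let base (z : 'rV[R]_8) := pt (z ord0 i0) (z ord0 i1).
Let point (z : 'rV[R]_8) := pt (z ord0 i0 + z ord0 i4) (z ord0 i1 + z ord0 i5).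

(** Write [p, q] = c1 p + c2 q, D_p p = a1 p + b1 q and D_q q = a2 p + b2 q. Comparing coefficients
    in (al p)_t = (be q)_s gives al_t = al be c1 and be_s = - al be c2; comparing them in (nu q)_t =
    (mu p)_s gives mu_s = nu be a2 - mu al a1 and nu_t = mu al b1 - nu be b2. *)
Lemma characteristic_coordinates : exists2 d, 0 < d &
  exists (x : 'rV[R]_2 -> 'rV[R]_2) (al be mu nu : 'rV[R]_2 -> R),
  [/\ [/\ smooth_open (square2 d) x, smooth_open (square2 d) al,
        smooth_open (square2 d) be, smooth_open (square2 d) mu & smooth_open (square2 d) nu],
     forall z, square2 d z -> A (x z),
     forall z, square2 d z ->
      [/\ 'D_('e_ord0) (fun z => x z ord0 ord0) z = al z * p1 (x z),
          'D_('e_ord0) (fun z => x z ord0 ord_max) z = al z * p2 (x z),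
          'D_('e_ord_max) (fun z => x z ord0 ord0) z = be z * q1 (x z) &
          'D_('e_ord_max) (fun z => x z ord0 ord_max) z = be z * q2 (x z)],
     forall z, square2 d z ->
       'D_('e_ord_max) (fun z => nu z * q1 (x z)) z = 'D_('e_ord0) (fun z => mu z * p1 (x z)) z /\
       'D_('e_ord_max) (fun z => nu z * q2 (x z)) z = 'D_('e_ord0) (fun z => mu z * p2 (x z)) z &
     [/\ x 0 = x0, al 0 = 1, be 0 = 1, mu 0 = 1 & nu 0 = 1]].
Proof.
have [c1 [c2 [sc1 sc2 I11 I12]]] :
  exists c1 c2 : 'rV[R]_2 -> R, [/\ smooth_open A c1, smooth_open A c2,
    forall x, A x -> along p1 p2 q1 x - along q1 q2 p1 x = c1 x * p1 x + c2 x * q1 x &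
    forall x, A x -> along p1 p2 q2 x - along q1 q2 p2 x = c1 x * p2 x + c2 x * q2 x].
  by apply: frame_coordinates => k; apply: (is_CkB oA); exact: along_smooth.
have [a1 [b1 [sa1 sb1 I21 I22]]] := frame_coordinates (along_smooth sp1 sp2 sp1) (along_smooth sp1 sp2 sp2).
have [a2 [b2 [sa2 sb2 I31 I32]]] := frame_coordinates (along_smooth sq1 sq2 sq1) (along_smooth sq1 sq2 sq2).
(* Entries 0 to 3 evolve in [s], entries 4 to 7 in [t]. The base point follows p without the factor
   [al], which equals 1 on the axis [t = 0]. *)
pose F (i : 'I_8) (z : 'rV[R]_8) : R :=
  let be := z ord0 i2 in let mu := z ord0 i3 in
  let al := z ord0 i6 in let nu := z ord0 i7 in
  nth 0 [:: p1 (base z); p2 (base z);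
    - (al * be * c2 (point z)); nu * be * a2 (point z) - mu * al * a1 (point z);
    be * q1 (point z); be * q2 (point z);
    al * be * c1 (point z); mu * al * b1 (point z) - nu * be * b2 (point z)] i.
pose O := [set z | A (base z)] `&` [set z | A (point z)].
pose u0 : 'rV[R]_8 := \row_i nth 0 [:: x0 ord0 ord0; x0 ord0 ord_max; 1; 1; 0; 0; 1; 1] i.
have sb k (O' : set 'rV[R]_8) : open O' -> is_Ck k O' base.
  by move=> oO'; apply: is_Ck_pt => //; exact: is_Ck_coord.
have spt k (O' : set 'rV[R]_8) : open O' -> is_Ck k O' point.
  by move=> oO'; apply: is_Ck_pt => //; apply: is_CkD => //; exact: is_Ck_coord.
have oO : open O.
  apply: openI; (apply: open_comp; last exact: oA) => z _.
    exact: (sb 0%N setT openT).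
  exact: (spt 0%N setT openT).
have Ou0 : O u0.
  by split; rewrite /= /base /point !mxE/= ?addr0 pt_eta.
have Fs i k : is_Ck k O (F i).
  have Cc j : is_Ck k O (fun z => z ord0 j) by exact: is_Ck_coord.
  have Cb (h : 'rV[R]_2 -> R) : smooth_open A h -> is_Ck k O (fun z => h (base z)).
    have OA z : O z -> A (base z) by case.
    by move=> sh; exact: (is_Ck_comp (f := base) (g := h) oO OA (sb k O oO) (sh k)).
  have Cp (h : 'rV[R]_2 -> R) : smooth_open A h -> is_Ck k O (fun z => h (point z)).
    have OA z : O z -> A (point z) by case.
    by move=> sh; exact: (is_Ck_comp (f := point) (g := h) oO OA (spt k O oO) (sh k)).
  have C3 j j' (h : 'rV[R]_2 -> R) : smooth_open A h -> is_Ck k O (fun z => z ord0 j * z ord0 j' * h (point z)).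
    by move=> sh; exact: (is_CkM oO (is_CkM oO (Cc j) (Cc j')) (Cp h sh)).
  case: i => -[|[|[|[|[|[|[|[|//]]]]]]]] Hi; rewrite /F /=.
  - exact: Cb.
  - exact: Cb.
  - exact: (is_CkN oO (C3 i6 i2 c2 sc2)).
  - exact: (is_CkB oO (C3 i7 i2 a2 sa2) (C3 i3 i6 a1 sa1)).
  - exact: (is_CkM oO (Cc i2) (Cp q1 sq1)).
  - exact: (is_CkM oO (Cc i2) (Cp q2 sq2)).
  - exact: (C3 i6 i2 c1 sc1).
  - exact: (is_CkB oO (C3 i3 i6 b1 sb1) (C3 i7 i2 b2 sb2)).
have [d d0 [U [Us UO Ud Ui]]] := char_system (fun i => 4 <= i)%N oO Ou0 Fs.
have so := @square2_open R d.
pose g z := base (U z); pose x z := point (U z).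
pose al z := U z ord0 i6; pose be z := U z ord0 i2.
pose mu z := U z ord0 i3; pose nu z := U z ord0 i7.
have gA z : square2 d z -> A (g z) by move=> /UO[].
have xA z : square2 d z -> A (x z) by move=> /UO[].
have UU k : is_Ck k (square2 d) U by apply/is_Ck_rVP.
have sg k : is_Ck k (square2 d) g.
  have cT (z : 'rV[R]_2) : square2 d z -> setT (U z) by [].
  exact: (is_Ck_comp_rV (f := U) (g := base) so openT cT (UU k) (sb k setT openT)).
have sx k : is_Ck k (square2 d) x.
  have cT (z : 'rV[R]_2) : square2 d z -> setT (U z) by [].
  exact: (is_Ck_comp_rV (f := U) (g := point) so openT cT (UU k) (spt k setT openT)).
have Chg (h : 'rV[R]_2 -> R) k : smooth_open A h -> is_Ck k (square2 d) (fun z => h (g z)).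
  by move=> sh; exact: (is_Ck_comp (f := g) (g := h) so gA (sg k) (sh k)).
have Chx (h : 'rV[R]_2 -> R) k : smooth_open A h -> is_Ck k (square2 d) (fun z => h (x z)).
  by move=> sh; exact: (is_Ck_comp (f := x) (g := h) so xA (sx k) (sh k)).
have dg z : square2 d z -> differentiable g z by move=> sz; exact: (sg 1%N).1.
have dx z : square2 d z -> differentiable x z by move=> sz; exact: (sx 1%N).1.
have dU i z : square2 d z -> differentiable (fun z => U z ord0 i) z.
  by move=> sz; exact: (Us i 1%N).1.
have dA (h : 'rV[R]_2 -> R) z : smooth_open A h -> A z -> differentiable h z.
  by move=> sh Az; exact: (sh 1%N).1.
have g0E : (fun z => g z ord0 ord0) = (fun z => U z ord0 i0).
  by apply/funext => z; rewrite /g pt0.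
have g1E : (fun z => g z ord0 ord_max) = (fun z => U z ord0 i1).
  by apply/funext => z; rewrite /g pt1.
have x0E : (fun z => x z ord0 ord0) = (fun z => U z ord0 i0 + U z ord0 i4).
  by apply/funext => z; rewrite /x pt0.
have x1E : (fun z => x z ord0 ord_max) = (fun z => U z ord0 i1 + U z ord0 i5).
  by apply/funext => z; rewrite /x pt1.
have Dhg c (h : 'rV[R]_2 -> R) z : smooth_open A h -> square2 d z ->
    'D_('e_c) (fun z => h (g z)) z =
    'D_('e_c) (fun z => U z ord0 i0) z * 'D_('e_ord0) h (g z) +
    'D_('e_c) (fun z => U z ord0 i1) z * 'D_('e_ord_max) h (g z).
  move=> sh sz; rewrite der_rV2 ?g0E ?g1E//; first exact: dg.
  by apply: dA => //; exact: gA.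
have Dhx c (h : 'rV[R]_2 -> R) z : smooth_open A h -> square2 d z ->
    'D_('e_c) (fun z => h (x z)) z =
    'D_('e_c) (fun z => x z ord0 ord0) z * 'D_('e_ord0) h (x z) +
    'D_('e_c) (fun z => x z ord0 ord_max) z * 'D_('e_ord_max) h (x z).
  move=> sh sz; rewrite der_rV2//; first exact: dx.
  by apply: dA => //; exact: xA.
(* Differentiating g_s = p(g) in [t] gives a linear equation along [s] for g_t, with zero data on
   [s = 0]. *)
have Dtg z : square2 d z -> 'D_('e_ord_max) (fun z => U z ord0 i0) z = 0 /\
    'D_('e_ord_max) (fun z => U z ord0 i1) z = 0.
  have Cd (h : 'rV[R]_2 -> R) v : smooth_open A h -> is_Ck 0 (square2 d) (fun z => 'D_v h (g z)).
    move=> sh; have sDv : smooth_open A ('D_v h) := fun k => (sh k.+1).2 v.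
    exact: (Chg _ 0%N sDv).
  have Ds (h : 'rV[R]_2 -> R) i z' : smooth_open A h -> (forall w, square2 d w ->
      'D_('e_ord0) (fun z => U z ord0 i) w = h (g w)) -> square2 d z' ->
      'D_('e_ord0) ('D_('e_ord_max) (fun z => U z ord0 i)) z' =
      'D_('e_ord0) h (g z') * 'D_('e_ord_max) (fun z => U z ord0 i0) z' +
      'D_('e_ord_max) h (g z') * 'D_('e_ord_max) (fun z => U z ord0 i1) z'.
    move=> sh Uh sz'; rewrite (derive_swap _ _ so (Us i 2%N) sz').
    by rewrite (near_eq_der _ so sz' Uh) Dhg// mulrC [X in _ + X]mulrC.
  move: z; apply: (plane_ode_zero2 (c := ord0) (Cd p1 _ sp1) (Cd p1 _ sp1) (Cd p2 _ sp2) (Cd p2 _ sp2)).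
  - exact: (Us i0 2%N).2.
  - exact: (Us i1 2%N).2.
  - by move=> z sz; apply: (Ds p1) => // w sw; rewrite (Ud i0).
  - by move=> z sz; apply: (Ds p2) => // w sw; rewrite (Ud i1).
  - by move=> z sz z0; split; apply: plane_derive_boundary sz z0 => // w; [exact: (Ui i0)|exact: (Ui i1)].
have Dtx z : square2 d z -> 'D_('e_ord_max) (fun z => x z ord0 ord0) z = be z * q1 (x z) /\
    'D_('e_ord_max) (fun z => x z ord0 ord_max) z = be z * q2 (x z).
  move=> sz; have [t0 t1] := Dtg z sz; rewrite x0E x1E !derD; try exact: dU.
  by rewrite t0 t1 !add0r (Ud i4)// (Ud i5).
have Dtal z : square2 d z -> 'D_('e_ord_max) al z = al z * be z * c1 (x z) by exact: (Ud i6).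
have Dsbe z : square2 d z -> 'D_('e_ord0) be z = - (al z * be z * c2 (x z)) by exact: (Ud i2).
have Dtnu z : square2 d z -> 'D_('e_ord_max) nu z = mu z * al z * b1 (x z) - nu z * be z * b2 (x z).
  exact: (Ud i7).
have Dsmu z : square2 d z -> 'D_('e_ord0) mu z = nu z * be z * a2 (x z) - mu z * al z * a1 (x z).
  exact: (Ud i3).
(* The defect [e = x_s - al p(x)] solves [e_t = be Dq(x) e] and vanishes at [t = 0]. *)
have Dsx z : square2 d z -> 'D_('e_ord0) (fun z => x z ord0 ord0) z = al z * p1 (x z) /\
    'D_('e_ord0) (fun z => x z ord0 ord_max) z = al z * p2 (x z).
  have Cd (h : 'rV[R]_2 -> R) v : smooth_open A h -> is_Ck 0 (square2 d) (fun z => be z * 'D_v h (x z)).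
    move=> sh; have sDv : smooth_open A ('D_v h) := fun k => (sh k.+1).2 v.
    exact: (is_CkM so (Us i2 0%N) (Chx _ 0%N sDv)).
  have Cx k c : is_Ck k (square2 d) (fun z => x z ord0 c) by exact: ((is_Ck_rVP k x so).1 (sx k) c).
  have Ce (p : 'rV[R]_2 -> R) c : smooth_open A p -> is_Ck 1 (square2 d)
      (fun z => 'D_('e_ord0) (fun z => x z ord0 c) z - al z * p (x z)).
    move=> sp; have h1 : is_Ck 1 (square2 d) ('D_('e_ord0) (fun z => x z ord0 c)) := (Cx 2%N c).2 _.
    exact: (is_CkB so h1 (is_CkM so (Us i6 1%N) (Chx p 1%N sp))).
  have De (p q : 'rV[R]_2 -> R) c z' : smooth_open A p -> smooth_open A q ->
      (forall y, A y -> along p1 p2 q y - along q1 q2 p y = c1 y * p y + c2 y * q y) ->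
      (forall w, square2 d w -> 'D_('e_ord_max) (fun z => x z ord0 c) w = be w * q (x w)) ->
      square2 d z' ->
      'D_('e_ord_max) (fun z => 'D_('e_ord0) (fun z => x z ord0 c) z - al z * p (x z)) z' =
      be z' * 'D_('e_ord0) q (x z') * ('D_('e_ord0) (fun z => x z ord0 ord0) z' - al z' * p1 (x z')) +
      be z' * 'D_('e_ord_max) q (x z') * ('D_('e_ord0) (fun z => x z ord0 ord_max) z' - al z' * p2 (x z')).
    move=> sp sq I1 Dtc sz'.
    have h1 : is_Ck 1 (square2 d) ('D_('e_ord0) (fun z => x z ord0 c)) := (Cx 2%N c).2 _.
    have h2 : is_Ck 1 (square2 d) (fun z => al z * p (x z)).
      exact: (is_CkM so (Us i6 1%N) (Chx p 1%N sp)).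
    rewrite derB; [|exact: (is_Ck_diff sz' h1)|exact: (is_Ck_diff sz' h2)].
    rewrite (derive_swap _ _ so (Cx 2%N c) sz') (near_eq_der _ so sz' Dtc).
    have dP := is_Ck_diff sz' (Chx p 1%N sp); have dQ := is_Ck_diff sz' (Chx q 1%N sq).
    have dal : differentiable al z' by exact: dU.
    have dbe : differentiable be z' by exact: dU.
    rewrite !derM//.
    have [t0 t1] := Dtx z' sz'.
    rewrite !Dhx// t0 t1 Dtal// Dsbe//.
    have := I1 _ (xA _ sz'); rewrite /along.
    move: ('D_('e_ord0) q (x z')) ('D_('e_ord_max) q (x z')) ('D_('e_ord0) p (x z')) ('D_('e_ord_max) p (x z')).
    move: (p1 (x z')) (p2 (x z')) (q1 (x z')) (q2 (x z')) (p (x z')) (q (x z')) (c1 (x z')) (c2 (x z')).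
    move: (al z') (be z') ('D_('e_ord0) (fun z => x z ord0 ord0) z') ('D_('e_ord0) (fun z => x z ord0 ord_max) z').
    clear; move=> al be X Y p1 p2 q1 q2 p q c1 c2 q0 q1' p0 p1' I1.
    apply/eqP; rewrite -subr_eq0.
    have -> : be * (X * q0 + Y * q1') + q * - (al * be * c2) - (al * (be * q1 * p0 + be * q2 * p1') + p * (al * be * c1)) -
      (be * q0 * (X - al * p1) + be * q1' * (Y - al * p2)) =
      al * be * (p1 * q0 + p2 * q1' - (q1 * p0 + q2 * p1') - (c1 * p + c2 * q)) by ring.
    by rewrite I1 subrr mulr0.
  move=> sz; rewrite -[X in X = _ /\ _]subr0.
  have H := plane_ode_zero2 (c := ord_max) (Cd q1 'e_ord0 sq1) (Cd q1 'e_ord_max sq1)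
    (Cd q2 'e_ord0 sq2) (Cd q2 'e_ord_max sq2) (Ce p1 ord0 sp1) (Ce p2 ord_max sp2).
  have [||w sw w1|] := H _ _ _ z sz.
  - by move=> w sw; apply: De => // w' sw'; have [] := Dtx w' sw'.
  - by move=> w sw; apply: De => // w' sw'; have [] := Dtx w' sw'.
  (* On the axis [t = 0] the increment is 0 and [al] is 1, so the defect reduces to the equation of
     the base point. *)
  - have xg : x w = g w by rewrite /x /point (Ui i4)// (Ui i5)// !mxE/= !addr0.
    have al1 : al w = 1 by rewrite /al (Ui i6)// mxE.
    have b4 : 'D_('e_ord0) (fun z => U z ord0 i4) w = 0.
      by apply: plane_derive_boundary sw w1 => // w'; exact: (Ui i4).
    have b5 : 'D_('e_ord0) (fun z => U z ord0 i5) w = 0.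
      by apply: plane_derive_boundary sw w1 => // w'; exact: (Ui i5).
    rewrite al1 xg !mul1r x0E x1E !derD; try exact: dU.
    by rewrite b4 b5 !addr0 (Ud i0)// (Ud i1)// !subrr.
  - by rewrite subr0 => /eqP; rewrite subr_eq0 => /eqP -> /eqP; rewrite subr_eq0 => /eqP ->.
exists d => //; exists x, al, be, mu, nu; split.
- by split=> // k; exact: Us.
- exact: xA.
- by move=> z sz; have [? ?] := Dsx z sz; have [? ?] := Dtx z sz; split.
- move=> z sz.
  have [e1 e2] := Dsx z sz; have [e3 e4] := Dtx z sz.
  have C (p q : 'rV[R]_2 -> R) : smooth_open A p -> smooth_open A q -> along p1 p2 p (x z) = a1 (x z) * p (x z) + b1 (x z) * q (x z) -> along q1 q2 q (x z) = a2 (x z) * p (x z) + b2 (x z) * q (x z) ->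
    'D_('e_ord_max) (fun z => nu z * q (x z)) z = 'D_('e_ord0) (fun z => mu z * p (x z)) z.
    move=> sp sq E1 E2.
    have dP := is_Ck_diff sz (Chx p 1%N sp); have dQ := is_Ck_diff sz (Chx q 1%N sq).
    have dmu : differentiable mu z by exact: dU.
    have dnu : differentiable nu z by exact: dU.
    rewrite !derM//.
    rewrite !Dhx// e1 e2 e3 e4 Dtnu// Dsmu//; move: E1 E2; rewrite /along.
    move: ('D_('e_ord0) q (x z)) ('D_('e_ord_max) q (x z)) ('D_('e_ord0) p (x z)) ('D_('e_ord_max) p (x z)).
    move: (p1 (x z)) (p2 (x z)) (q1 (x z)) (q2 (x z)) (p (x z)) (q (x z)).
    move: (a1 (x z)) (b1 (x z)) (a2 (x z)) (b2 (x z)) (al z) (be z) (mu z) (nu z).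
    clear; move=> a1 b1 a2 b2 al be mu nu p1 p2 q1 q2 p q q0 q1' p0 p1' E1 E2.
    apply/eqP; rewrite -subr_eq0.
    have -> : nu * (be * q1 * q0 + be * q2 * q1') + q * (mu * al * b1 - nu * be * b2) -
      (mu * (al * p1 * p0 + al * p2 * p1') + p * (nu * be * a2 - mu * al * a1)) =
      nu * be * (q1 * q0 + q2 * q1' - (a2 * p + b2 * q)) - mu * al * (p1 * p0 + p2 * p1' - (a1 * p + b1 * q)) by ring.
    by rewrite E1 E2 !subrr !mulr0 subrr.
  have Az := xA z sz.
  split; first exact: (C p1 q1 sp1 sq1 (I21 _ Az) (I31 _ Az)).
  exact: (C p2 q2 sp2 sq2 (I22 _ Az) (I32 _ Az)).
- have s0 : square2 d 0 by apply/square2P => c; rewrite mxE normr0.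
  have U0 i : U 0 ord0 i = u0 ord0 i by apply: Ui => //; rewrite mxE.
  split; rewrite /al /be /mu /nu ?U0 ?mxE//.
  by rewrite /x /point !U0 !mxE/= !addr0 pt_eta.
Qed.

End CharacteristicCoordinates.

(** * Factorization into gradients *)

Section Factorization.
Context {R : realType}.

(* For eigenvalues [l1], [l2] of [m = [[a, b], [c, d]]], the rows of [m - l2] and of
   [m - l1] are left eigenvectors for [l1] and [l2] by Cayley-Hamilton. *)
Lemma eigenvectors_independent (a b c d l1 l2 : R) : l1 != l2 ->
  l1 + l2 = a + d -> l1 * l2 = a * d - b * c ->
  exists e0 e1 f0 f1,
    (e0 * (a - l2) + e1 * c) * (f0 * b + f1 * (d - l1)) -
    (e0 * b + e1 * (d - l2)) * (f0 * (a - l1) + f1 * c) != 0.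
Proof.
move=> l12 lD lM; have l12' : l1 - l2 != 0 by rewrite subr_eq0.
have [b0|b0] := eqVneq b 0; last first.
  exists 1, 0, 1, 0; rewrite (_ : _ - _ = b * (l1 - l2)); last by ring.
  by rewrite mulf_neq0.
have [c0|c0] := eqVneq c 0; last first.
  exists 0, 1, 0, 1; rewrite (_ : _ - _ = - (c * (l1 - l2))); last by ring.
  by rewrite oppr_eq0 mulf_neq0.
have ll : (a - l1) * (a - l2) = 0.
  have -> : (a - l1) * (a - l2) = a ^+ 2 - a * (l1 + l2) + l1 * l2 by ring.
  by rewrite lD lM b0; ring.
move/eqP: ll; rewrite mulf_eq0 !subr_eq0 => /orP[/eqP al|/eqP al].
  have dl : d = l2 by apply: (addrI a); rewrite -lD al.
  exists 1, 0, 0, 1; rewrite b0 c0 al dl (_ : _ - _ = - ((l1 - l2) * (l1 - l2))); last by ring.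
  by rewrite oppr_eq0 mulf_neq0.
have dl : d = l1 by apply: (addrI a); rewrite -lD al addrC.
exists 0, 1, 1, 0; rewrite b0 c0 al dl (_ : _ - _ = (l1 - l2) * (l1 - l2)); last by ring.
by rewrite mulf_neq0.
Qed.

Lemma is_Ck_near_gt0 (V : normedModType R) (O : set V) (f : V -> R) x :
  open O -> is_Ck 0 O f -> O x -> 0 < f x ->
  exists A, [/\ open A, A x, A `<=` O & forall y, A y -> 0 < f y].
Proof.
move=> oO Cf Ox fx.
have n : \forall y \near x, 0 < f y by exact: (cvgr_gt (f x) (Cf x Ox) _ fx).
have n0 : nbhs x (O `&` [set y | 0 < f y]).
  by apply: filterI; first exact: open_nbhs_nbhs.
exists (interior (O `&` [set y | 0 < f y])); split=> //; first exact: open_interior.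
  by move=> y /interior_subset[].
by move=> y /interior_subset[].
Qed.

Lemma det2 (M : 'M[R]_2) :
  \det M = M ord0 ord0 * M ord_max ord_max - M ord0 ord_max * M ord_max ord0.
Proof.
rewrite (expand_det_row _ ord0) big_ord_recl big_ord1 /cofactor !det_mx11 !mxE /=.
have -> : lift ord0 ord0 = ord_max :> 'I_2 by exact: val_inj.
have -> : lift ord_max ord0 = ord0 :> 'I_2 by exact: val_inj.
by rewrite expr0 expr1; ring.
Qed.

(** A negative determinant makes the discriminant tr^2 - 4 det positive near [x0], so its square
    root and the eigenvalues are smooth there. The coefficients [e0], [e1], [f0], [f1] are frozen at
    [x0]: the resulting combinations of rows satisfy the eigenvector equations nearby by
    Cayley-Hamilton, and their independence persists by continuity. *)
Lemma eigenframe (F : 'rV[R]_2 -> 'rV[R]_2) (O : set 'rV[R]_2) x0 :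
  open O -> O x0 -> smooth_open O F -> \det (jac F x0) < 0 ->
  exists (A : set 'rV[R]_2) (p1 p2 q1 q2 l1 l2 : 'rV[R]_2 -> R),
  [/\ [/\ open A, A x0 & A `<=` O],
    [/\ smooth_open A p1, smooth_open A p2, smooth_open A q1 & smooth_open A q2],
    forall x, A x -> p1 x * q2 x - p2 x * q1 x != 0 &
    forall x c, A x ->
      p1 x * jac F x ord0 c + p2 x * jac F x ord_max c = l1 x * pt (p1 x) (p2 x) ord0 c /\
      q1 x * jac F x ord0 c + q2 x * jac F x ord_max c = l2 x * pt (q1 x) (q2 x) ord0 c].
Proof.
move=> oO Ox0 sF det0.
pose m i j x := jac F x i j.
have sm i j k : is_Ck k O (m i j).
  apply: (is_Ck_eq (f := 'D_('e_i) (fun z => F z ord0 j))) => //.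
    by move=> z _; rewrite /m mxE.
  exact: ((is_Ck_rVP k.+1 F oO).1 (sF k.+1) j).2.
pose a := m ord0 ord0; pose b := m ord0 ord_max.
pose c := m ord_max ord0; pose d := m ord_max ord_max.
pose disc x := (a x + d x) * (a x + d x) - 4 * (a x * d x - b x * c x).
have sdisc k : is_Ck k O disc.
  have s4 := is_Ck_cst k O (4 : R).
  exact: (is_CkB oO (is_CkM oO (is_CkD oO (sm _ _ k) (sm _ _ k)) (is_CkD oO (sm _ _ k) (sm _ _ k)))
    (is_CkM oO s4 (is_CkB oO (is_CkM oO (sm _ _ k) (sm _ _ k)) (is_CkM oO (sm _ _ k) (sm _ _ k))))).
have disc0 : 0 < disc x0.
  have H : a x0 * d x0 - b x0 * c x0 < 0 by move: det0; rewrite det2.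
  by rewrite /disc; have := sqr_ge0 (a x0 + d x0); rewrite expr2; lra.
have [A1 [oA1 A1x0 A1O disc_gt0]] := is_Ck_near_gt0 oO (sdisc 0%N) Ox0 disc0.
have sm1 i j k : is_Ck k A1 (m i j) by exact: is_Ck_sub A1O (sm i j k).
have ssq k : is_Ck k A1 (fun x => Num.sqrt (disc x)).
  by apply: is_Ck_sqrt => //; exact: is_Ck_sub A1O (sdisc k).
pose l1 x := (a x + d x + Num.sqrt (disc x)) * 2^-1.
pose l2 x := (a x + d x - Num.sqrt (disc x)) * 2^-1.
have sl1 k : is_Ck k A1 l1.
  exact: (is_CkM oA1 (is_CkD oA1 (is_CkD oA1 (sm1 _ _ k) (sm1 _ _ k)) (ssq k)) (is_Ck_cst k A1 (2^-1 : R))).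
have sl2 k : is_Ck k A1 l2.
  exact: (is_CkM oA1 (is_CkB oA1 (is_CkD oA1 (sm1 _ _ k) (sm1 _ _ k)) (ssq k)) (is_Ck_cst k A1 (2^-1 : R))).
have lD x : l1 x + l2 x = a x + d x by rewrite /l1 /l2; field.
have lM x : A1 x -> l1 x * l2 x = a x * d x - b x * c x.
  move=> Ax; have sq := sqr_sqrtr (ltW (disc_gt0 x Ax)).
  have -> : l1 x * l2 x = ((a x + d x) * (a x + d x) - Num.sqrt (disc x) ^+ 2) / 4.
    by rewrite /l1 /l2; field.
  by rewrite sq /disc; field.
have l12 : l1 x0 != l2 x0.
  rewrite -subr_eq0 (_ : _ - _ = Num.sqrt (disc x0)); last by rewrite /l1 /l2; field.
  by rewrite gt_eqF// sqrtr_gt0.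
have [e0 [e1 [f0 [f1 frame0]]]] := eigenvectors_independent l12 (lD x0) (lM x0 A1x0).
pose p1 x := e0 * (a x - l2 x) + e1 * c x; pose p2 x := e0 * b x + e1 * (d x - l2 x).
pose q1 x := f0 * (a x - l1 x) + f1 * c x; pose q2 x := f0 * b x + f1 * (d x - l1 x).
have comb (r0 r1 : R) (g0 g1 : 'rV[R]_2 -> R) : smooth_open A1 g0 -> smooth_open A1 g1 ->
    smooth_open A1 (fun x => r0 * g0 x + r1 * g1 x).
  move=> s0 s1 k; have cst (r : R) := is_Ck_cst k A1 r.
  exact: (is_CkD oA1 (is_CkM oA1 (cst r0) (s0 k)) (is_CkM oA1 (cst r1) (s1 k))).
have sp1 : smooth_open A1 p1.
  by apply: (comb e0 e1 (fun x => a x - l2 x) c) => k; [exact: (is_CkB oA1 (sm1 _ _ k) (sl2 k))|exact: sm1].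
have sp2 : smooth_open A1 p2.
  by apply: (comb e0 e1 b (fun x => d x - l2 x)) => k; [exact: sm1|exact: (is_CkB oA1 (sm1 _ _ k) (sl2 k))].
have sq1 : smooth_open A1 q1.
  by apply: (comb f0 f1 (fun x => a x - l1 x) c) => k; [exact: (is_CkB oA1 (sm1 _ _ k) (sl1 k))|exact: sm1].
have sq2 : smooth_open A1 q2.
  by apply: (comb f0 f1 b (fun x => d x - l1 x)) => k; [exact: sm1|exact: (is_CkB oA1 (sm1 _ _ k) (sl1 k))].
pose fr x := p1 x * q2 x - p2 x * q1 x.
(* Squaring turns the nonvanishing of the frame determinant into positivity, which persists near
   [x0]. *)
have sfr : is_Ck 0 A1 (fun x => fr x * fr x).
  have sf := is_CkB oA1 (is_CkM oA1 (sp1 0%N) (sq2 0%N)) (is_CkM oA1 (sp2 0%N) (sq1 0%N)).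
  exact: (is_CkM oA1 sf sf).
have fr0 : 0 < fr x0 * fr x0 by rewrite -expr2 exprn_even_gt0.
have [A [oA Ax0 AA1 frA]] := is_Ck_near_gt0 oA1 sfr A1x0 fr0.
exists A, p1, p2, q1, q2, l1, l2; split.
- by split=> //; exact: subset_trans AA1 A1O.
- by split=> k; apply: is_Ck_sub AA1 _; [exact: sp1|exact: sp2|exact: sq1|exact: sq2].
- by move=> x /frA; apply: contraTneq; rewrite /fr => ->; rewrite mulr0 ltxx.
move=> x i Ax; have E1 := lD x; have E2 := lM x (AA1 x Ax).
have key (r0 r1 l l' : R) : l + l' = a x + d x -> l * l' = a x * d x - b x * c x ->
    (r0 * (a x - l') + r1 * c x) * a x + (r0 * b x + r1 * (d x - l')) * c x = l * (r0 * (a x - l') + r1 * c x) /\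
    (r0 * (a x - l') + r1 * c x) * b x + (r0 * b x + r1 * (d x - l')) * d x = l * (r0 * b x + r1 * (d x - l')).
  move: (a x) (b x) (c x) (d x) => a' b' c' d' D M.
  have -> : d' = l + l' - a' by rewrite D; ring.
  have bc : b' * c' = a' * (l + l' - a') - l * l' by rewrite M D; ring.
  split; apply/eqP; rewrite -subr_eq0.
    rewrite (_ : _ - _ = r0 * (b' * c' - (a' * (l + l' - a') - l * l'))); last by ring.
    by rewrite bc subrr mulr0.
  rewrite (_ : _ - _ = r1 * (b' * c' - (a' * (l + l' - a') - l * l'))); last by ring.
  by rewrite bc subrr mulr0.
have [k1 k2] := key e0 e1 (l1 x) (l2 x) E1 E2.
have [k3 k4] := key f0 f1 (l2 x) (l1 x) (etrans (addrC _ _) E1) (etrans (mulrC _ _) E2).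
case: (unliftP ord0 i) => [j ->|->].
  rewrite (ord1 j) (_ : lift _ _ = ord_max) ?pt1//; exact: val_inj.
by rewrite !pt0.
Qed.

(** In the closedness condition for v.dx the second derivatives of x cancel by symmetry, which
    leaves exactly the assumed identity v_t.x_s = v_s.x_t. *)
Lemma wedge_potential d (v1 v2 x1 x2 : 'rV[R]_2 -> R) : 0 < d ->
  smooth_open (square2 d) v1 -> smooth_open (square2 d) v2 ->
  smooth_open (square2 d) x1 -> smooth_open (square2 d) x2 ->
  (forall z, square2 d z ->
    'D_('e_ord_max) v1 z * 'D_('e_ord0) x1 z + 'D_('e_ord_max) v2 z * 'D_('e_ord0) x2 z =
    'D_('e_ord0) v1 z * 'D_('e_ord_max) x1 z + 'D_('e_ord0) v2 z * 'D_('e_ord_max) x2 z) ->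
  exists d', 0 < d' <= d /\ exists h, smooth_open (square2 d') h /\
    forall c z, square2 d' z -> 'D_('e_c) h z = v1 z * 'D_('e_c) x1 z + v2 z * 'D_('e_c) x2 z.
Proof.
move=> d0 sv1 sv2 sx1 sx2 wedge.
have so := @square2_open R d.
have sD (x : 'rV[R]_2 -> R) c : smooth_open (square2 d) x -> smooth_open (square2 d) ('D_('e_c) x).
  by move=> sx k; exact: (sx k.+1).2.
pose a c z := v1 z * 'D_('e_c) x1 z + v2 z * 'D_('e_c) x2 z.
have sa c : smooth_open (square2 d) (a c).
  move=> k; exact: (is_CkD so (is_CkM so (sv1 k) (sD _ c sx1 k)) (is_CkM so (sv2 k) (sD _ c sx2 k))).
have Da c c' z : square2 d z -> 'D_('e_c) (a c') z =
    v1 z * 'D_('e_c) ('D_('e_c') x1) z + 'D_('e_c') x1 z * 'D_('e_c) v1 z +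
    (v2 z * 'D_('e_c) ('D_('e_c') x2) z + 'D_('e_c') x2 z * 'D_('e_c) v2 z).
  move=> sz.
  have h1 := is_Ck_diff sz (sv1 1%N); have h2 := is_Ck_diff sz (sv2 1%N).
  have h3 := is_Ck_diff sz (sD _ c' sx1 1%N); have h4 := is_Ck_diff sz (sD _ c' sx2 1%N).
  have h5 := is_Ck_diff sz (is_CkM so (sv1 1%N) (sD _ c' sx1 1%N)).
  have h6 := is_Ck_diff sz (is_CkM so (sv2 1%N) (sD _ c' sx2 1%N)).
  by rewrite derD// !derM.
have [|d' [d'0 [h [sh h0 h1]]]] := @potential R d (a ord0) (a ord_max) d0 (sa _) (sa _).
  move=> z sz; rewrite (Da _ _ _ sz) (Da _ _ _ sz).
  rewrite (derive_swap _ _ so (sx1 2%N) sz) (derive_swap 'e_ord_max _ so (sx2 2%N) sz).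
  move: (wedge z sz).
  move: ('D_('e_ord0) ('D_('e_ord_max) x1) z) ('D_('e_ord0) ('D_('e_ord_max) x2) z).
  move: ('D_('e_ord0) x1 z) ('D_('e_ord0) x2 z) ('D_('e_ord_max) x1 z) ('D_('e_ord_max) x2 z).
  move: ('D_('e_ord0) v1 z) ('D_('e_ord0) v2 z) ('D_('e_ord_max) v1 z) ('D_('e_ord_max) v2 z).
  move=> r1 r2 r3 r4 r5 r6 r7 r8 r9 r10; move: (v1 z) (v2 z) => y1 y2 W.
  have -> : r7 * r1 = r3 * r5 + r4 * r6 - r8 * r2 by rewrite W; ring.
  by ring.
exists d'; split; first exact: d'0.
exists h; split; first exact: sh.
move=> c z sz.
case: (unliftP ord0 c) => [j ->|->]; last exact: h0.
rewrite (ord1 j) (_ : lift _ _ = ord_max); [exact: h1|exact: val_inj].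
Qed.

(** By the chain rule the differential of [phi] is both w.dX and the gradient of [phi \o H] paired
    with dX; invertibility of the Jacobian of [X] allows the two covectors to be identified. *)
Lemma gradient_chart n (A : set 'rV[R]_n.+1) (X H w : 'rV[R]_n.+1 -> 'rV[R]_n.+1)
    (phi : 'rV[R]_n.+1 -> R) :
  open A -> open (X @` A) -> smooth_open A X -> smooth_open (X @` A) H -> smooth_open A phi ->
  (forall z, A z -> H (X z) = z) -> (forall z, A z -> \det (jac X z) != 0) ->
  (forall c z, A z -> 'D_('e_c) phi z = \sum_j w z ord0 j * jac X z c j) ->
  forall z, A z -> gradient (phi \o H) (X z) = w z.
Proof.
move=> oA oXA sX sH sphi HX J0 Dphi z Az.
have XAz : (X @` A) (X z) by exists z.
have HA y : (X @` A) y -> A (H y) by move=> [z' Az' <-]; rewrite HX.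
have dphi : differentiable (phi \o H) (X z).
  exact: (is_Ck_diff XAz (is_Ck_comp oXA HA (sH 1%N) (sphi 1%N))).
have dX : differentiable X z by exact: (sX 1%N).1.
have E c : 'D_('e_c) phi z = \sum_j gradient (phi \o H) (X z) ord0 j * jac X z c j.
  have <- : 'D_('e_c) ((phi \o H) \o X) z = 'D_('e_c) phi z.
    by apply: (near_eq_der _ oA Az) => y Ay; rewrite /= HX.
  rewrite derive_comp_rV//; apply: eq_bigr => j _.
  by rewrite !mxE -[_ *: _]/(_ * _) mulrC.
have Ju : jac X z \in unitmx by rewrite unitmxE unitfE J0.
have : jac X z *m (gradient (phi \o H) (X z))^T = jac X z *m (w z)^T.
  apply/colP => c; rewrite [LHS]mxE [RHS]mxE.
  transitivity ('D_('e_c) phi z).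
    by rewrite E; apply: eq_bigr => j _; rewrite [(_^T) _ _]mxE mulrC.
  by rewrite Dphi//; apply: eq_bigr => j _; rewrite [(_^T) _ _]mxE mulrC.
by move=> /(congr1 (mulmx (invmx (jac X z)))); rewrite !mulKmx// => /trmx_inj.
Qed.

Lemma jacobian_jac n m (F : 'rV[R]_n -> 'rV[R]_m) x : differentiable F x ->
  'J F x = jac F x.
Proof.
by move=> dF; apply/row_matrixP => i; rewrite !rowE mul_rV_lin1 diff_jac.
Qed.

Lemma legendre_charts (F : 'rV[R]_2 -> 'rV[R]_2) (O : set 'rV[R]_2) x0 :
  open O -> O x0 -> smooth_open O F -> \det (jac F x0) < 0 ->
  exists2 d, 0 < d & exists (X v : 'rV[R]_2 -> 'rV[R]_2) (phi psi : 'rV[R]_2 -> R),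
  [/\ [/\ smooth_open (square2 d) X, smooth_open (square2 d) v,
          smooth_open (square2 d) phi & smooth_open (square2 d) psi],
      X 0 = x0 /\ forall z, square2 d z -> O (X z),
      \det (jac X 0) != 0 /\ \det (jac v 0) != 0,
      forall c z, square2 d z -> 'D_('e_c) phi z = \sum_j v z ord0 j * jac X z c j &
      forall c z, square2 d z -> 'D_('e_c) psi z = \sum_j F (X z) ord0 j * jac v z c j].
Proof.
move=> oO Ox0 sF det0.
have [A [p1 [p2 [q1 [q2 [l1 [l2 [[oA Ax0 AO] [sp1 sp2 sq1 sq2] frame eig]]]]]]]] :=
  eigenframe oO Ox0 sF det0.
have [d d0 [X [al [be [mu [nu [[sX sal sbe smu snu] XA DX closed [X0 al0 be0 mu0 nu0]]]]]]]] :=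
  characteristic_coordinates oA Ax0 sp1 sp2 sq1 sq2 frame.
have so := @square2_open R d.
have spX (p : 'rV[R]_2 -> R) : smooth_open A p -> smooth_open (square2 d) (fun z => p (X z)).
  by move=> sp k; exact: (is_Ck_comp so XA (sX k) (sp k)).
have sM (f g : 'rV[R]_2 -> R) : smooth_open (square2 d) f -> smooth_open (square2 d) g ->
    smooth_open (square2 d) (fun z => f z * g z).
  by move=> sf sg k; exact: (is_CkM so (sf k) (sg k)).
have sN (f : 'rV[R]_2 -> R) : smooth_open (square2 d) f -> smooth_open (square2 d) (fun z => - f z).
  by move=> sf k; exact: (is_CkN so (sf k)).
have snq1 := sM _ _ snu (spX _ sq1); have snq2 := sM _ _ snu (spX _ sq2).
have smp1 := sM _ _ smu (spX _ sp1); have smp2 := sM _ _ smu (spX _ sp2).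
(* The components of v are potentials chosen so that v_s is nu q and v_t is mu p, each turned by a
   right angle. *)
have [|d1 [/andP[d1_0 d1d] [v1 [sv1 D0v1 D1v1]]]] := potential d0 (sN _ snq2) (sN _ smp2).
  move=> z sz; rewrite (derN _ (is_Ck_diff sz (snq2 1%N))) (derN _ (is_Ck_diff sz (smp2 1%N))).
  by rewrite (closed z sz).2.
have [|d2 [/andP[d2_0 d2d] [v2 [sv2 D0v2 D1v2]]]] := potential d0 snq1 smp1.
  by move=> z sz; exact: (closed z sz).1.
have sub (e e' : R) : e <= e' -> square2 e `<=` square2 e'.
  by move=> ee z /square2P H; apply/square2P => c; exact: lt_le_trans (H c) ee.
pose e := Num.min d1 d2.
have e0 : 0 < e by rewrite lt_min d1_0.
have ed1 : square2 e `<=` square2 d1 by apply: sub; rewrite ge_min lexx.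
have ed2 : square2 e `<=` square2 d2 by apply: sub; rewrite ge_min lexx orbT.
have ed : square2 e `<=` square2 d by exact: subset_trans ed1 (sub _ _ d1d).
have soe := @square2_open R e.
have sv1e : smooth_open (square2 e) v1 by move=> k; exact: is_Ck_sub ed1 (sv1 k).
have sv2e : smooth_open (square2 e) v2 by move=> k; exact: is_Ck_sub ed2 (sv2 k).
have sXe : smooth_open (square2 e) X by move=> k; exact: is_Ck_sub ed (sX k).
pose y k z := F (X z) ord0 k.
have XO z : square2 d z -> O (X z) by move=> sz; exact: AO (XA z sz).
have sFX : smooth_open (square2 e) (fun z => F (X z)).
  move=> k; apply: (is_Ck_comp_rV soe oO _ (sXe k) (sF k)) => z sz; exact: XO (ed z sz).
have sXi i : smooth_open (square2 e) (fun z => X z ord0 i).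
  by move=> k; exact: ((is_Ck_rVP k X soe).1 (sXe k) i).
have sFi i : smooth_open O (fun z => F z ord0 i).
  by move=> k; exact: ((is_Ck_rVP k F oO).1 (sF k) i).
have sy i : smooth_open (square2 e) (y i).
  by move=> k; exact: ((is_Ck_rVP k (fun z => F (X z)) soe).1 (sFX k) i).
(* The eigenvector equations keep the derivatives of F(X) parallel to p and q, which makes the
   second wedge condition an identity with both sides zero. *)
have Dy k z : square2 e z ->
    'D_('e_ord0) (y k) z = al z * (l1 (X z) * pt (p1 (X z)) (p2 (X z)) ord0 k) /\
    'D_('e_ord_max) (y k) z = be z * (l2 (X z) * pt (q1 (X z)) (q2 (X z)) ord0 k).
  move=> sz; have sz' := ed z sz.
  have dX : differentiable X z by exact: (sX 1%N).1.
  have dF := is_Ck_diff (XO z sz') (sFi k 1%N).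
  have [a1 a2 a3 a4] := DX z sz'; have [eg1 eg2] := eig (X z) k (XA z sz').
  rewrite /y (der_rV2 _ dX dF) (der_rV2 _ dX dF) a1 a2 a3 a4 -eg1 -eg2.
  rewrite [jac F (X z) ord0 k]mxE [jac F (X z) ord_max k]mxE.
  move: ('D_('e_ord0) (fun x => F x ord0 k) (X z)) ('D_('e_ord_max) (fun x => F x ord0 k) (X z)) => r1 r2.
  by split; ring.
have [|d3 [/andP[d3_0 d3e] [phi [sphi Dphi]]]] := wedge_potential e0 sv1e sv2e (sXi ord0) (sXi ord_max).
  move=> z sz; have [a1 a2 a3 a4] := DX z (ed z sz).
  rewrite a1 a2 a3 a4 (D0v1 _ (ed1 z sz)) (D0v2 _ (ed2 z sz)) (D1v1 _ (ed1 z sz)) (D1v2 _ (ed2 z sz)).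
  by ring.
have [|d4 [/andP[d4_0 d4e] [psi [spsi Dpsi]]]] := wedge_potential e0 (sy ord0) (sy ord_max) sv1e sv2e.
  move=> z sz.
  rewrite (Dy ord0 z sz).1 (Dy ord0 z sz).2 (Dy ord_max z sz).1 (Dy ord_max z sz).2 !pt0 !pt1.
  rewrite (D0v1 _ (ed1 z sz)) (D0v2 _ (ed2 z sz)) (D1v1 _ (ed1 z sz)) (D1v2 _ (ed2 z sz)).
  by ring.
pose m := Num.min d3 d4.
have m3 : square2 m `<=` square2 d3 by apply: sub; rewrite ge_min lexx.
have m4 : square2 m `<=` square2 d4 by apply: sub; rewrite ge_min lexx orbT.
have me : square2 m `<=` square2 e by exact: subset_trans m3 (sub _ _ d3e).
have som := @square2_open R m.
have se0 : square2 e 0 by apply/square2P => c; rewrite mxE normr0.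
have lift1 : lift ord0 ord0 = ord_max :> 'I_2 by exact: val_inj.
exists m; first by rewrite lt_min d3_0.
exists X, (fun z => pt (v1 z) (v2 z)), phi, psi; split.
- split=> k; [exact: is_Ck_sub me (sXe k)| |exact: is_Ck_sub m3 (sphi k)|exact: is_Ck_sub m4 (spsi k)].
  exact: is_Ck_sub me (is_Ck_pt soe (sv1e k) (sv2e k)).
- by split=> // z sz; exact: XO (ed z (me z sz)).
(* At the origin the four scalars are 1, and the Jacobian determinants of X and v are the frame
   determinant at [x0] and its opposite. *)
- have [a1 a2 a3 a4] := DX 0 (ed 0 se0).
  have F0 : p1 x0 * q2 x0 - p2 x0 * q1 x0 != 0 by exact: frame.
  split; rewrite det2 !mxE.
    by rewrite a1 a2 a3 a4 X0 al0 be0 !mul1r.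
  have -> : (fun z => pt (v1 z) (v2 z) ord0 ord0) = v1 by apply/funext => z; rewrite pt0.
  have -> : (fun z => pt (v1 z) (v2 z) ord0 ord_max) = v2 by apply/funext => z; rewrite pt1.
  rewrite (D0v1 _ (ed1 0 se0)) (D0v2 _ (ed2 0 se0)) (D1v1 _ (ed1 0 se0)) (D1v2 _ (ed2 0 se0)).
  rewrite X0 mu0 nu0 (_ : _ - _ = - (p1 x0 * q2 x0 - p2 x0 * q1 x0)); last by ring.
  by rewrite oppr_eq0.
- move=> c z sz; rewrite (Dphi c z (m3 z sz)) big_ord_recl big_ord1 lift1 pt0 pt1.
  by rewrite [jac _ _ _ _]mxE [jac _ _ _ ord_max]mxE.
move=> c z sz; rewrite (Dpsi c z (m4 z sz)) big_ord_recl big_ord1 lift1.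
rewrite [jac _ _ _ _]mxE [jac _ _ _ ord_max]mxE.
have -> : (fun z => pt (v1 z) (v2 z) ord0 ord0) = v1 by apply/funext => u; rewrite pt0.
by have -> : (fun z => pt (v1 z) (v2 z) ord0 ord_max) = v2 by apply/funext => u; rewrite pt1.
Qed.

Lemma open_preimage_on (V W : normedModType R) (O : set V) (P : set W) (f : V -> W) :
  open O -> open P -> is_Ck 0 O f -> open (O `&` f @^-1` P).
Proof.
move=> oO oP Cf; rewrite openE => x [Ox Px]; apply: filterI.
  exact: open_nbhs_nbhs.
by apply: (Cf x Ox); exact: open_nbhs_nbhs.
Qed.

Lemma smooth_open_gradient n (O : set 'rV[R]_n.+1) (phi : 'rV[R]_n.+1 -> R) :
  open O -> smooth_open O phi -> smooth_open O (gradient phi).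
Proof.
move=> oO sphi k; apply/(is_Ck_rVP k (gradient phi) oO) => i.
by apply: (is_Ck_eq oO _ ((sphi k.+1).2 'e_i)) => z _; rewrite mxE.
Qed.

(** Two successive applications of the inverse function theorem give one neighbourhood of the origin
    on which both [X] and [v] are charts. [X \o H2] inverts the first gradient, since that gradient
    is [v] read in the chart [X]. *)
Lemma gradient_factorization (F : 'rV[R]_2 -> 'rV[R]_2) (O : set 'rV[R]_2) x0 :
  open O -> O x0 -> smooth_open O F -> \det (jac F x0) < 0 ->
  exists (W W' : set 'rV[R]_2) (phi psi : 'rV[R]_2 -> R) (K : 'rV[R]_2 -> 'rV[R]_2),
  [/\ [/\ open W, W x0, W `<=` O & open W'],
      [/\ smooth_open W phi, smooth_open W' psi & smooth_open W' K],
      forall y, W y -> W' (gradient phi y) /\ K (gradient phi y) = y,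
      forall z, W' z -> W (K z) /\ gradient phi (K z) = z &
      forall y, W y -> F y = gradient psi (gradient phi y)].
Proof.
move=> oO Ox0 sF det0.
have [d d0 [X [v [phi [psi [[sX sv sphi spsi] [X0 XO] [JX Jv] Dphi Dpsi]]]]]] :=
  legendre_charts oO Ox0 sF det0.
have so := @square2_open R d.
have s0 : square2 d 0 by apply/square2P => c; rewrite mxE normr0.
have [A1 [H1 [oA1 A10 A1s oXA1 [sH1 HX1 JX1]]]] := inverse_function so s0 sX JX.
have sub1 (g : 'rV[R]_2 -> 'rV[R]_2) : smooth_open (square2 d) g -> smooth_open A1 g.
  by move=> sg k; exact: is_Ck_sub A1s (sg k).
have [A [H2 [oA A0 AA1 ovA [sH2 Hv Jv2]]]] := inverse_function oA1 A10 (sub1 _ sv) Jv.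
have As : A `<=` square2 d by exact: subset_trans AA1 A1s.
(* The second application shrank [A1] to [A]; the image of the smaller set stays open because it is
   a preimage under the continuous inverse [H1]. *)
have XAE : X @` A = (X @` A1) `&` H1 @^-1` A.
  apply/seteqP; split=> [_ [z Az <-]|_ [[z Az <-]]].
    by split; [exists z => //; exact: AA1|rewrite /= HX1//; exact: AA1].
  by rewrite /= HX1// => A'z; exists z.
have oXA : open (X @` A) by rewrite XAE; exact: open_preimage_on oXA1 oA (sH1 0%N).
have HX z : A z -> H1 (X z) = z by move=> /AA1; exact: HX1.
have sXA : smooth_open A X by move=> k; exact: is_Ck_sub As (sX k).
have svA : smooth_open A v by move=> k; exact: is_Ck_sub As (sv k).
have sphiA : smooth_open A phi by move=> k; exact: is_Ck_sub As (sphi k).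
have spsiA : smooth_open A psi by move=> k; exact: is_Ck_sub As (spsi k).
have sH1A : smooth_open (X @` A) H1.
  by move=> k; apply: is_Ck_sub (sH1 k); exact: image_subset.
have JXA z : A z -> \det (jac X z) != 0 by move=> /AA1; exact: JX1.
have H1A y : (X @` A) y -> A (H1 y) by move=> [z Az <-]; rewrite HX.
have H2A y : (v @` A) y -> A (H2 y) by move=> [z Az <-]; rewrite Hv.
have gphi z : A z -> gradient (phi \o H1) (X z) = v z.
  by apply: (gradient_chart oA oXA sXA sH1A sphiA HX JXA) => c y Ay; exact: Dphi c y (As y Ay).
have gpsi z : A z -> gradient (psi \o H2) (v z) = F (X z).
  apply: (gradient_chart (w := fun z => F (X z)) oA ovA svA sH2 spsiA Hv Jv2) => c y Ay.
  exact: Dpsi c y (As y Ay).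
exists (X @` A), (v @` A), (phi \o H1), (psi \o H2), (X \o H2); split.
- split=> //; first by exists 0.
  by move=> _ [z Az <-]; apply: XO; exact: As.
- split=> k; first exact: (is_Ck_comp oXA H1A (sH1A k) (sphiA k)).
    exact: (is_Ck_comp ovA H2A (sH2 k) (spsiA k)).
  exact: (is_Ck_comp_rV ovA oA H2A (sH2 k) (sXA k)).
- by move=> _ [z Az <-]; rewrite gphi//= Hv//; split=> //; exists z.
- by move=> _ [z Az <-]; rewrite /= Hv// gphi//; split=> //; exists z.
by move=> _ [z Az <-]; rewrite gphi// gpsi.
Qed.

Lemma smooth_extension_id (V W : normedModType R) (S O : set V) (g : V -> W) :
  open O -> S `<=` O -> smooth_open O g -> smooth_extension S g g.
Proof. by move=> oO SO sg; exists O; split. Qed.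

Lemma gradient_onE n (S O : set 'rV[R]_n.+1) (phi : 'rV[R]_n.+1 -> R) x :
  S `<=` closure (interior S) -> open O -> S `<=` O -> smooth_open O phi -> S x ->
  gradient_on S phi x = gradient phi x.
Proof.
move=> rS oO SO sphi Sx; apply/rowP => i; rewrite !mxE.
exact: derive_extend rS (smooth_extension_id oO SO sphi) Sx.
Qed.

Lemma smooth_on_eq (V W : normedModType R) (S O : set V) (f g : V -> W) :
  open O -> S `<=` O -> smooth_open O g -> (forall x, S x -> f x = g x) -> smooth_on S f.
Proof.
move=> oO SO sg fg; exists g, O; split=> // x /set_mem Sx; exact/esym/fg.
Qed.

End Factorization.

Theorem proposition3 (R : realType) (D1 D2 : set 'rV[R]_2)
  (f : 'rV[R]_2 -> 'rV[R]_2)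
  (hD1 : compact_domain D1) (hD2 : compact_domain D2)
  (hf : diffeomorphism D1 D2 f) (hor : orientation_reversing D1 f)
  (x : 'rV[R]_2) (hx : D1 x) :
  exists (U : set 'rV[R]_2) (phi psi : 'rV[R]_2 -> R),
    let V := gradient_on U phi @` U in
    open_nbhd_in D1 x U /\
    smooth_on U phi /\
    smooth_on V psi /\
    diffeomorphism U V (gradient_on U phi) /\
    diffeomorphism V (f @` U) (gradient_on V psi) /\
    (forall y, U y -> f y = gradient_on V psi (gradient_on U phi y)).
Proof.
have [sf fD1 [g [sg fK gK]]] := hf.
(* Both [f] and its inverse are replaced by smooth extensions to open sets, since [x] may be a
   boundary point of [D1]. *)
have [Q [oQ D1Q sF Ff]] := extendP sf.
have [P [oP D2P sG Gg]] := extendP sg.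
set F := extend D1 f in sF Ff; set G := extend D2 g in sG Gg.
have Ff' y : D1 y -> F y = f y by move=> Dy; rewrite Ff// inE.
have detF : \det (jac F x) < 0.
  by rewrite -jacobian_jac; [exact: hor|exact: (sF 1%N).1 (D1Q _ hx)].
have [W [W' [phi [psi [K [[oW Wx WO oW'] [sphi spsi sK] gradP KP FE]]]]]] :=
  gradient_factorization oQ (D1Q _ hx) sF detF.
pose U := D1 `&` W.
have nU : open_nbhd_in D1 x U by exists W.
have rU : U `<=` closure (interior U) by exact: compact_domain_regular hD1 nU.
have UW : U `<=` W by move=> y [].
have gU y : U y -> gradient_on U phi y = gradient phi y.
  by move=> Uy; exact: gradient_onE rU oW UW sphi Uy.
exists U, phi, psi; set V := gradient_on U phi @` U => V0.
have VW : V `<=` W' by move=> _ [y Uy <-]; rewrite gU//; exact: (gradP y (UW y Uy)).1.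
have KV z : V z -> U (K z).
  by move=> [y Uy <-]; rewrite gU// (gradP y (UW y Uy)).2.
have VE z : W' z -> U (K z) -> V z.
  by move=> W'z Uz; exists (K z) => //; rewrite gU// (KP z W'z).2.
have cgrad y : W y -> {for y, continuous (gradient phi)}.
  by move=> Wy; have := smooth_open_gradient oW sphi 0%N; apply.
(* Needed for gradients on [V] to be independent of the extension. Points of the interior of [U] are
   dense in [U], and [gradient phi] sends them to interior points of [V] because its inverse [K] is
   continuous on an open set. *)
have rV : V `<=` closure (interior V).
  move=> _ [y Uy <-] B; rewrite gU// => nB.
  have nB' : nbhs y (W `&` gradient phi @^-1` B).
    apply: filterI; [exact: open_nbhs_nbhs (conj oW (UW y Uy))|exact: cgrad (UW y Uy) _ nB].
  have [t [Ut [Wt Bt]]] := rU y Uy _ nB'.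
  have [W't Kt] := gradP t Wt.
  exists (gradient phi t); split=> //; rewrite /interior.
  have oV : open (W' `&` K @^-1` (interior U)).
    exact: open_preimage_on oW' (open_interior U) (sK 0%N).
  apply: (filterS _ (open_nbhs_nbhs (conj oV (conj W't _)))); last by rewrite /= Kt.
  by move=> z [W'z /interior_subset Uz]; exact: VE.
have gV z : V z -> gradient_on V psi z = gradient psi z.
  by move=> Vz; exact: gradient_onE rV oW' VW spsi Vz.
have UD1 y : U y -> D1 y by case.
have fE y : U y -> f y = gradient_on V psi (gradient_on U phi y).
  move=> Uy; have Vy : V (gradient_on U phi y) by exists y.
  by rewrite gV// gU// -FE ?Ff'//; [exact: UD1|exact: UW].
have fg y : D1 y -> G (f y) = y.
  move=> Dy; have D2y : D2 (f y) by rewrite -fD1; exists y.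
  by rewrite Gg ?inE// fK// inE.
split=> //; split; first exact: smooth_on_eq oW UW sphi _.
split; first exact: smooth_on_eq oW' VW spsi _.
split; last split=> //.
  split=> //; first exact: smooth_on_eq oW UW (smooth_open_gradient oW sphi) gU.
  exists K; split; first exact: smooth_on_eq oW' VW sK _.
    by move=> y /set_mem Uy; rewrite gU// (gradP y (UW y Uy)).2.
  by move=> z /set_mem Vz; rewrite gU ?(KP z (VW z Vz)).2//; exact: KV.
split; first exact: smooth_on_eq oW' VW (smooth_open_gradient oW' spsi) gV.
  apply/seteqP; split=> [_ [_ [y Uy <-] <-]|_ [y Uy <-]].
    by rewrite -fE//; exists y.
  by exists (gradient_on U phi y); [exists y|rewrite -fE].
(* The inverse of the second gradient is [gradient phi] after [G], with [G] the extension of the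
   inverse of [f]; this open set is where that composition is smooth. *)
have oPW : open (P `&` G @^-1` W) by exact: open_preimage_on oP oW (sG 0%N).
have QW z : (P `&` G @^-1` W) z -> W (G z) by case.
have sQ : smooth_open (P `&` G @^-1` W) (gradient phi \o G).
  move=> k; apply: (is_Ck_comp_rV oPW oW QW _ (smooth_open_gradient oW sphi k)).
  by apply: is_Ck_sub (sG k) => z [].
exists (gradient phi \o G); split.
- apply: smooth_on_eq oPW _ sQ _ => // _ [y Uy <-]; have Dy := UD1 y Uy; split.
    by apply: D2P; rewrite -fD1; exists y.
  by rewrite /= fg//; exact: UW.
- move=> _ /set_mem[y Uy <-]; rewrite -fE//= fg; last exact: UD1.
  by rewrite gU.
move=> _ /set_mem[y Uy <-]; rewrite /= fg; last exact: UD1.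
by rewrite -gU// -fE.
Qed.
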